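(* Let $g_1,\dots,g_N$ be distinct functions in $L^2(\mathbb{R})$ and let $\Lambda_1,\dots,\Lambda_N\subset\mathbb{R}^2$ all be uniformly discrete. Put $G_n:=V_\phi g_n$. Then there is a constant $C>0$ (depending on the separation constants and the Riesz sequence or frame bounds) such that: \begin{enumerate} \item If $\bigcup_{n=1}^N G(g_n,\Lambda_n)$ is a Riesz sequence, then for all $R>0$ \[ \sup_{(a,b)\in\mathbb{R}^2}\sum_{n=1}^N|\Lambda_n\cap Q_{(a,b)}(R)|\le(2R+1)^2+C\sum_{n=1}^N I_{G_n}\!\left(R+\tfrac14\right). \] \item If $\bigcup_{n=1}^N G(g_n,\Lambda_n)$ is a frame, then for all $R>\tfrac12$ \[ \inf_{(a,b)\in\mathbb{R}^2}\sum_{n=1}^N|\Lambda_n\cap Q_{(a,b)}(R)|\ge(2R-1)^2-C\sum_{n=1}^N I_{G_n}\!\left(R-\tfrac12\right). \] \end{enumerate}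
   Context: For $g\in L^2(\mathbb{R})$ and $(a,b)\in\mathbb{R}^2$ put $g_{ab}(t)=e^{2\pi i b t}g(t-a)$. The Gabor system is $G(g,\Lambda)=\{g_{\lambda\mu}\}_{(\lambda,\mu)\in\Lambda}$. $\phi(t)=c\,e^{-t^2}$ with $\|\phi\|_{L^2}=1$, and $V_\phi g(x,y)=\int g(t)\overline{\phi(t-x)}e^{-2\pi i y t}\,dt$. $Q_{(a,b)}(R)=\{(x,y):|x-a|\le R,\ |y-b|\le R\}$ and $Q^c_0(R)=\mathbb{R}^2\setminus Q_0(R)$. A set is uniformly discrete if distinct points are at distance greater than some $\delta>0$. For $G\in L^2(\mathbb{R}^2)$, $I_G(R):=\int_{Q_0(R)}\int_{Q^c_0(R+\frac14)}|G(t-x,s-y)|^2\,dt\,ds\,dx\,dy$, where $(x,y)$ ranges over $Q_0(R)$ and $(t,s)$ over $Q^c_0(R+\tfrac14)$. Riesz sequence: $A\sum|a_k|^2\le\|\sum a_kf_k\|^2\le B\sum|a_k|^2$. Frame: $A\|f\|^2\le\sum|\langle f,f_k\rangle|^2\le B\|f\|^2$. *)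

(* Defs.v *)
From HB Require Import structures.
From mathcomp Require Import all_boot all_order all_algebra.
From mathcomp Require Import all_classical all_reals all_analysis.
From mathcomp Require Import complex.
Set Implicit Arguments. Unset Strict Implicit. Unset Printing Implicit Defensive.
Import Order.TTheory GRing.Theory Num.Theory.
Local Open Scope classical_set_scope.
Local Open Scope ring_scope.

Section Gabor.
Variable R : realType.

Definition cabs2 (z : R[i]) : R := complex.Re z ^+ 2 + complex.Im z ^+ 2.

Definition cinteg (f : R -> R[i]) : R[i] :=
  Complex (Rintegral (@lebesgue_measure R) setT (fun t => complex.Re (f t)))
          (Rintegral (@lebesgue_measure R) setT (fun t => complex.Im (f t))).

Definition inL2 (f : R -> R[i]) : Prop :=
  measurable_fun setT (fun t => complex.Re (f t)) /\
  measurable_fun setT (fun t => complex.Im (f t)) /\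
  (\int[@lebesgue_measure R]_t (cabs2 (f t))%:E < +oo)%E.

Definition l2norm2 (f : R -> R[i]) : R :=
  Rintegral (@lebesgue_measure R) setT (fun t => cabs2 (f t)).

Definition l2inner (f h : R -> R[i]) : R[i] := cinteg (fun t => f t * conjc (h t)).

Definition cexpi (theta : R) : R[i] := Complex (cos theta) (sin theta).

Definition tfshift (a b : R) (g : R -> R[i]) : R -> R[i] :=
  fun t => cexpi (2 * pi * b * t) * g (t - a).

(* the normalized Gaussian gauss(t) = c e^{-t^2}, c = (2/pi)^(1/4),
   so that ||gauss||_{L^2} = 1 *)
Definition gauss_c : R := (2 / pi) `^ (4^-1).
Definition gauss (t : R) : R := gauss_c * expR (- t ^+ 2).

(* short-time Fourier transform
   V_phi g(x,y) = \int g(t) conj(gauss(t-x)) e^{-2 pi i y t} dt  (gauss is real) *)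
Definition stft (g : R -> R[i]) (x y : R) : R[i] :=
  cinteg (fun t => g t * Complex (gauss (t - x)) 0 * cexpi (- (2 * pi * y * t))).

Definition Qsq (a b r : R) : set (R * R) :=
  [set p | `|p.1 - a| <= r /\ `|p.2 - b| <= r].

(* I_G(r) = \int_{(x,y) in Q_0(r)} \int_{(t,s) in Q_0(r+1/4)^c}
             |G(t-x, s-y)|^2 dt ds dx dy   (iterated; integrand >= 0) *)
Definition IG (G : R -> R -> R[i]) (r : R) : \bar R :=
  (\int[@lebesgue_measure R]_(x in `[(- r)%R, r])
    \int[@lebesgue_measure R]_(y in `[(- r)%R, r])
      \int[@lebesgue_measure R]_t
        \int[@lebesgue_measure R]_(s in [set s | ~ Qsq 0 0 (r + 4^-1)%R (t, s)])
          (cabs2 (G (t - x) (s - y)))%:E)%E.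

(* Lam is delta-dsep: distinct points at Euclidean distance > delta.
   Lam is uniformly discrete iff it is delta-dsep for some delta > 0. *)
Definition dsep (delta : R) (Lam : set (R * R)) : Prop :=
  forall p q, Lam p -> Lam q -> p <> q ->
    delta < Num.sqrt ((p.1 - q.1) ^+ 2 + (p.2 - q.2) ^+ 2).

Definition npoints (X : set (R * R)) : \bar R := (\esum_(p in X) 1)%E.

(* The union of the Gabor systems G(g_n, Lam_n), n < N, as an indexed family:
   index set {(n, lambda) | lambda in Lam_n}, atom (g_n)_{lambda}. *)
Definition gab_index (N : nat) (Lam : 'I_N -> set (R * R)) : set ('I_N * (R * R)) :=
  [set k | Lam k.1 k.2].
Definition gab_atom (N : nat) (g : 'I_N -> R -> R[i]) (k : 'I_N * (R * R)) :
  R -> R[i] := tfshift k.2.1 k.2.2 (g k.1).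

Definition is_riesz_seq {I : eqType} (S : set I) (f : I -> R -> R[i]) (A B : R) : Prop :=
  forall (s : seq I) (c : I -> R[i]), uniq s -> (forall k, k \in s -> S k) ->
    A * (\sum_(k <- s) cabs2 (c k)) <=
      l2norm2 (fun t => \sum_(k <- s) c k * f k t) <= B * (\sum_(k <- s) cabs2 (c k)).

Definition is_frame {I : choiceType} (S : set I) (f : I -> R -> R[i]) (A B : R) : Prop :=
  forall h : R -> R[i], inL2 h ->
    ((A * l2norm2 h)%:E <= \esum_(k in S) (cabs2 (l2inner h (f k)))%:E)%E /\
    (\esum_(k in S) (cabs2 (l2inner h (f k)))%:E <= (B * l2norm2 h)%:E)%E.

Definition distinct_L2 (N : nat) (g : 'I_N -> R -> R[i]) : Prop :=
  forall n m : 'I_N, n <> m ->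
    ~ {ae @lebesgue_measure R, forall t, g n t = g m t}.

End Gabor.

(* Main.v *)
Require Import Defs.
From HB Require Import structures.
From mathcomp Require Import all_boot all_order all_algebra.
From mathcomp Require Import all_classical all_reals all_analysis.
From mathcomp Require Import complex.
From mathcomp Require Import measurable_realfun lebesgue_integral_under ring lra.
Import Order.TTheory GRing.Theory Num.Theory.
Import numFieldNormedType.Exports.
Local Open Scope classical_set_scope.
Local Open Scope ring_scope.
Set Implicit Arguments. Unset Strict Implicit. Unset Printing Implicit Defensive.

(** Write phi_z for the time-frequency shifts of the Gaussian; z |-> <g, phi_z> = V_phi g(z)
    is an isometry from L2(R) into L2(R^2).  Let f_1, ..., f_n be the atoms whose index lies
    in the square Q(r), and let P be the orthogonal projection onto their span, so that
    the integral of |P phi_z|^2 over z is the trace n.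

    For a Riesz sequence, |P phi_z|^2 is bounded by 1, used on Q(r + 1/2), and by
    A^-1 sum_k |V_phi f_k(z)|^2, used outside.  For a frame, take approximate duals w_k of
    the f_k and their span: the distance of phi_z to this span is at most
    A^-1 sum |<phi_z, f_k>|^2 over the k outside Q(r), up to an arbitrarily small error, and
    integrating over Q(r - 1/2) bounds (2r-1)^2 by n plus the tail.

    Both tails are sums of |V_phi g_n|^2 over translates of Lam_n.  They are turned into
    the integrals I_G by the mean value inequality
    |V_phi g(p)|^2 <= C int_{p + [-rho, rho]^2} |V_phi g|^2, because for small rho the squares
    centred at the points of Lam_n are disjoint.  The inequality comes from Cauchy's formula
    for exp(2ts) on rectangles in the variable s, averaged over their size.

    Complex coefficients are handled by the real inner product [rip] on the doubled family
    f_k, i f_k, which is why n appears as the trace of a 2n x 2n real matrix. *)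

(** * Real L2 spaces and substitution *)

(** The gap 1/4 in I_G dictates the radii. A box of radius rho <= 1/4 about a point of Q(r) stays in
    Q(r + 1/4), and I_G(r + 1/4) sees only z outside Q(r + 1/2); for a frame the same two quarters
    are lost inwards. The condition 3 rho <= delta separates the boxes, because 8 rho^2 < 9 rho^2.
    In I_G the point inside the square is subtracted from the point outside. For a Riesz sequence
    lambda is inside and z outside, so translating the square to the origin suffices; for a frame
    the roles are exchanged, and the plane is reflected about the centre of the square. The Gaussian
    matters because multiplying it by exp(2ts) only translates and rescales it. A contour integral
    in s thus becomes an integral of V_phi g along the boundary of a square in the time-frequency
    plane. The approximate duals of a frame may be linearly dependent, so eta times the identity is
    added to their Gram matrix; all errors are then tied to one parameter theta, which is sent to
    0. *)

Section L2theory.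
Context d (T : measurableType d) (R : realType) (m : {measure set T -> \bar R}).
Implicit Types u v w : T -> R.

Definition L2 u :=
  measurable_fun setT u /\ (\int[m]_t ((u t) ^+ 2)%:E < +oo)%E.

Definition ip u v : R := (\int[m]_t (u t * v t))%R.

Lemma L2_sqr_integrable u : L2 u ->
  m.-integrable setT (EFin \o (fun t => u t ^+ 2)).
Proof.
move=> [mu iu]; apply/integrableP; split.
  by apply/measurable_EFinP; exact: measurable_funX.
by under eq_integral do rewrite gee0_abs ?lee_fin ?sqr_ge0//.
Qed.

Lemma L2_mul_integrable u v : L2 u -> L2 v ->
  m.-integrable setT (EFin \o (fun t => u t * v t)).
Proof.
move=> uL vL; have := integrableD measurableT (L2_sqr_integrable uL) (L2_sqr_integrable vL).
apply: le_integrable => //.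
  by apply/measurable_EFinP/measurable_funM; [case: uL|case: vL].
move=> t _; rewrite /= lee_fin.
rewrite [leRHS]ger0_norm ?addr_ge0 ?sqr_ge0// normrM.
have := sqr_ge0 (`|u t| - `|v t|); have := real_normK (num_real (u t)).
have := real_normK (num_real (v t)).
have := mulr_ge0 (normr_ge0 (u t)) (normr_ge0 (v t)); nra.
Qed.

Lemma L2D u v : L2 u -> L2 v -> L2 (fun t => u t + v t).
Proof.
move=> uL vL; have [mu _] := uL; have [mv _] := vL.
split; first exact: measurable_funD.
have : m.-integrable setT (EFin \o (fun t => 2 * u t ^+ 2 + 2 * v t ^+ 2)).
  apply: (integrableD measurableT (f := EFin \o (fun t => 2 * u t ^+ 2))
    (g := EFin \o (fun t => 2 * v t ^+ 2))).
    exact: (integrableZl measurableT 2 (L2_sqr_integrable uL)).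
  exact: (integrableZl measurableT 2 (L2_sqr_integrable vL)).
move=> /integrable_lty h; apply: le_lt_trans (h measurableT).
apply: ge0_le_integral => //.
- by move=> t _; rewrite lee_fin sqr_ge0.
- by apply/measurable_EFinP/measurable_funX/measurable_funD.
- apply/measurable_EFinP/measurable_funD; apply/measurable_funM => //;
    exact: measurable_funX.
- by move=> t _; rewrite lee_fin; have := sqr_ge0 (u t - v t); nra.
Qed.

Lemma L2Z a u : L2 u -> L2 (fun t => a * u t).
Proof.
move=> uL; have [mu _] := uL; split; first exact: measurable_funM.
under eq_integral do rewrite exprMn EFinM.
have := integrableZl measurableT (a ^+ 2) (L2_sqr_integrable uL).
by move=> /integrable_lty; exact.
Qed.

Lemma L2N u : L2 u -> L2 (fun t => - u t).
Proof. by move=> /(L2Z (-1)); under eq_fun do rewrite mulN1r. Qed.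

Lemma L2B u v : L2 u -> L2 v -> L2 (fun t => u t - v t).
Proof. by move=> uL vL; apply: L2D => //; exact: L2N. Qed.

Lemma L2_0 : L2 (fun=> 0).
Proof. by split => //; rewrite expr0n/= integral0. Qed.

Lemma L2_le u v : measurable_fun setT u -> L2 v ->
  (forall t, `|u t| <= `|v t|) -> L2 u.
Proof.
move=> mu [mv iv] uv; split=> //; apply: le_lt_trans iv.
apply: ge0_le_integral => //.
- by move=> t _; rewrite lee_fin sqr_ge0.
- by apply/measurable_EFinP/measurable_funX.
- by apply/measurable_EFinP/measurable_funX.
- move=> t _; rewrite lee_fin -real_normK ?num_real// -[leRHS]real_normK ?num_real//.
  by rewrite lerXn2r ?nnegrE.
Qed.

Lemma ipC u v : ip u v = ip v u.
Proof. by apply: eq_Rintegral => t _; rewrite mulrC. Qed.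

Lemma ipDl u v w : L2 u -> L2 v -> L2 w ->
  ip (fun t => u t + v t) w = ip u w + ip v w.
Proof.
move=> uL vL wL; rewrite /ip -RintegralD//; [|exact: L2_mul_integrable..].
by apply: eq_Rintegral => t _; rewrite mulrDl.
Qed.

Lemma ipZl a u w : L2 u -> L2 w -> ip (fun t => a * u t) w = a * ip u w.
Proof.
move=> uL wL; rewrite /ip -RintegralZl//; last exact: L2_mul_integrable.
by apply: eq_Rintegral => t _; rewrite mulrA.
Qed.

Lemma ipNl u w : L2 u -> L2 w -> ip (fun t => - u t) w = - ip u w.
Proof.
by move=> uL wL; rewrite -mulN1r -ipZl//; congr ip; apply/funext => t; rewrite mulN1r.
Qed.

Lemma ip_ge0 u : 0 <= ip u u.
Proof. by apply: Rintegral_ge0 => t _; rewrite -expr2 sqr_ge0. Qed.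

Lemma ip_sqr u : L2 u -> (\int[m]_t ((u t) ^+ 2)%:E)%E = (ip u u)%:E.
Proof.
move=> uL; rewrite /ip /Rintegral fineK; first by under eq_integral do rewrite expr2.
by apply: integrable_fin_num => //; exact: L2_mul_integrable.
Qed.

Lemma EFin_Rintegral f : m.-integrable setT (EFin \o f) ->
  (\int[m]_t (f t)%:E = (\int[m]_t f t)%:E)%E.
Proof. by move=> fi; rewrite /Rintegral fineK//; exact: integrable_fin_num. Qed.

Lemma ip_sqrD u v : L2 u -> L2 v ->
  ip (fun t => u t + v t) (fun t => u t + v t) = ip u u + 2 * ip u v + ip v v.
Proof.
move=> u2 v2; have d2 := L2D u2 v2.
by rewrite ipDl// (ipC u) (ipC v) !ipDl// (ipC v u); ring.
Qed.

Lemma ip_parallelogram u v : L2 u -> L2 v ->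
  ip (fun t => u t + v t) (fun t => u t + v t) +
  ip (fun t => u t - v t) (fun t => u t - v t) = 2 * ip u u + 2 * ip v v.
Proof.
move=> u2 v2; have n2 := L2N v2; rewrite !ip_sqrD// (ipC u (fun t => - v t)).
by rewrite !ipNl// (ipC v (fun t => - v t)) ipNl// (ipC v u); ring.
Qed.

End L2theory.

(** * Translations, reflections and dilations of the Lebesgue integral *)

Section substitution.
Context {R : realType}.
Local Notation mu := (@lebesgue_measure R).
Implicit Type f : R -> \bar R.

Let mtrans (a : R) : measurable_fun [set: measurableTypeR R]
  ((fun x => a + x) : _ -> measurableTypeR R).
Proof. exact: measurable_funD. Qed.

Let mscal (s : R) : measurable_fun [set: measurableTypeR R]
  ((fun x => s * x) : _ -> measurableTypeR R).
Proof. exact: measurable_funM. Qed.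

Let mopp : measurable_fun [set: measurableTypeR R]
  ((fun x => - x) : _ -> measurableTypeR R).
Proof. exact: oppr_measurable. Qed.

(** Uniqueness of Lebesgue measure reduces the claim to half-open intervals. The dilation below is
    treated in the same way, with the pushforward weighted by [s]. *)
Let mu_shift (a : R) A : measurable A ->
  pushforward mu ((fun x => a + x) : _ -> measurableTypeR R) A = mu A.
Proof.
move=> mA.
apply/esym/lebesgue_measure_unique => //= _ [[b c]] _ <-.
rewrite /pushforward /= (_ : (fun x : R => a + x) @^-1` _ = `]b - a, c - a]%classic).
  rewrite !lebesgue_measure_itv/= !lte_fin ltrD2r.
  by case: ifP => // _; rewrite -!EFinB; congr EFin; ring.
by apply/seteqP; split=> x /=; rewrite !in_itv/= => /andP[? ?]; apply/andP; lra.
Qed.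

Let mu_scal (s : R) (s0 : 0 < s) A : measurable A ->
  pushforward (mscale (NngNum (ltW s0)) mu) ((fun x => s * x) : _ -> measurableTypeR R) A = mu A.
Proof.
move=> mA.
apply/esym/lebesgue_measure_unique => //= _ [[b c]] _ <-.
rewrite /pushforward /mscale /=.
rewrite (_ : (fun x : R => s * x) @^-1` _ = `]b / s, c / s]%classic).
  rewrite !lebesgue_measure_itv/= !lte_fin ltr_pM2r ?invr_gt0//.
  case: ifP => _; last by rewrite mule0.
  rewrite -!EFinB -EFinM; congr EFin.
  by field; rewrite gt_eqF.
by apply/seteqP; split=> x /=; rewrite !in_itv/= ltr_pdivrMr// ler_pdivlMr// ![x * s]mulrC.
Qed.

Lemma ge0_int_shift (a : R) f : measurable_fun setT f -> (forall x, (0 <= f x)%E) ->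
  (\int[mu]_x f (a + x)%R = \int[mu]_x f x)%E.
Proof.
move=> mf f0; pose phi : _ -> measurableTypeR R := fun x => a + x.
transitivity (\int[mu]_(x in phi @^-1` setT) (f \o phi) x)%E; first by [].
rewrite -(ge0_integral_pushforward (mtrans a))//.
by apply: eq_measure_integral => A mA _; exact: mu_shift.
Qed.

Lemma ge0_int_opp f : measurable_fun setT f -> (forall x, (0 <= f x)%E) ->
  (\int[mu]_x f (- x)%R = \int[mu]_x f x)%E.
Proof.
move=> mf f0; pose phi : _ -> measurableTypeR R := -%R.
transitivity (\int[mu]_(x in phi @^-1` setT) (f \o phi) x)%E; first by [].
rewrite -(ge0_integral_pushforward mopp)//.
by apply: eq_measure_integral => A mA _; exact: lebesgue_measureN.
Qed.

Lemma ge0_int_scale (s : R) f : 0 < s -> measurable_fun setT f ->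
  (forall x, (0 <= f x)%E) ->
  (s%:E * \int[mu]_x f (s * x)%R = \int[mu]_x f x)%E.
Proof.
move=> s0 mf f0; pose phi : _ -> measurableTypeR R := fun x => s * x.
transitivity (s%:E * \int[mu]_(x in phi @^-1` setT) (f \o phi) x)%E; first by [].
have mphi : measurable_fun setT (f \o phi) by apply: measurableT_comp => //; exact: mscal.
have mD : measurable (phi @^-1` setT) by rewrite preimage_setT.
rewrite -(ge0_integral_mscale mu mD (NngNum (ltW s0)))//.
rewrite -(ge0_integral_pushforward (mscal s) (mscale _ _))//.
  by apply: eq_measure_integral => A mA _; exact: (mu_scal s0).
by move=> x _; exact: f0.
Qed.

Lemma int_shift (a : R) f : measurable_fun setT f ->
  (\int[mu]_x f (a + x)%R = \int[mu]_x f x)%E.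
Proof.
move=> mf; rewrite integralE [RHS]integralE.
rewrite -(ge0_int_shift a (measurable_funepos mf) (funepos_ge0 f)).
rewrite -(ge0_int_shift a (measurable_funeneg mf) (funeneg_ge0 f)).
by congr (_ - _)%E; apply: eq_integral => x _; rewrite ?funeposE ?funenegE.
Qed.

Lemma int_opp f : measurable_fun setT f ->
  (\int[mu]_x f (- x)%R = \int[mu]_x f x)%E.
Proof.
move=> mf; rewrite integralE [RHS]integralE.
rewrite -(ge0_int_opp (measurable_funepos mf) (funepos_ge0 f)).
rewrite -(ge0_int_opp (measurable_funeneg mf) (funeneg_ge0 f)).
by congr (_ - _)%E; apply: eq_integral => x _; rewrite ?funeposE ?funenegE.
Qed.

Lemma Rint_shift (a : R) (f : R -> R) : measurable_fun setT f ->
  \int[mu]_x f (a + x) = \int[mu]_x f x.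
Proof.
by move=> mf; congr fine; apply: (int_shift a (f := EFin \o f)); apply/measurable_EFinP.
Qed.

Lemma Rint_opp (f : R -> R) : measurable_fun setT f ->
  \int[mu]_x f (- x) = \int[mu]_x f x.
Proof.
by move=> mf; congr fine; apply: (int_opp (f := EFin \o f)); apply/measurable_EFinP.
Qed.

End substitution.

(** * Fubini's theorem under a product majorant *)

Section fubini_dominated.
Context d1 d2 (T1 : measurableType d1) (T2 : measurableType d2) (R : realType).
Variables (m1 : {sigma_finite_measure set T1 -> \bar R}).
Variables (m2 : {sigma_finite_measure set T2 -> \bar R}).

(** Positive and negative parts are measurable in [x] by Tonelli, and [fine] of their difference
    stays measurable even where that difference is not finite. *)
Lemma measurable_Rintegral_param (F : T1 * T2 -> R) : measurable_fun setT F ->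
  measurable_fun setT (fun x => \int[m2]_y F (x, y)).
Proof.
move=> mF; rewrite /Rintegral.
apply: (measurableT_comp (fine_measurable measurableT)).
under eq_fun do rewrite integralE.
apply: emeasurable_funB.
- rewrite (_ : (fun x => _) = fubini_F m2 (EFin \o F)^\+%E).
    by apply: measurable_fun_fubini_tonelli_F => //; apply: measurable_funepos; exact/measurable_EFinP.
  by apply/funext => x; apply: eq_integral => y _; rewrite !funeposE.
- rewrite (_ : (fun x => _) = fubini_F m2 (EFin \o F)^\-%E).
    by apply: measurable_fun_fubini_tonelli_F => //; apply: measurable_funeneg; exact/measurable_EFinP.
  by apply/funext => x; apply: eq_integral => y _; rewrite !funenegE.
Qed.

Variables (F : T1 * T2 -> R) (a : T1 -> R) (b : T2 -> R).
Hypothesis mF : measurable_fun setT F.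
Hypothesis ia : m1.-integrable setT (EFin \o a).
Hypothesis ib : m2.-integrable setT (EFin \o b).
Hypothesis Fab : forall x y, `|F (x, y)| <= a x * b y.

Lemma dominated_integrable_prod : (m1 \x m2)%E.-integrable setT (EFin \o F).
Proof.
apply/integrable12ltyP; first exact/measurable_EFinP.
have ia' := integrable_norm ia; have ib' := integrable_norm ib.
apply: (@le_lt_trans _ _ (\int[m1]_x (`|a x|%:E * \int[m2]_y `|b y|%:E))%E).
  apply: ge0_le_integral => //=.
  - by move=> x _; exact: integral_ge0.
  - have mF' : measurable_fun setT (abse \o (EFin \o F)).
      by apply/measurableT_comp => //; exact/measurable_EFinP.
    have := @measurable_fun_fubini_tonelli_F _ _ _ _ _ m2 _ mF' (fun=> abse_ge0 _); exact.
  - apply: emeasurable_funM => //.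
    by case/integrableP : ia'.
  - move=> x _; rewrite -ge0_integralZl//; last by case/integrableP : ib'.
    apply: ge0_le_integral => //=.
    + apply/measurable_EFinP/measurableT_comp => //.
      exact: (measurableT_comp mF (pair1_measurable x)).
    + by apply: measurable_funeM; case/integrableP : ib'.
    + move=> y _; rewrite lee_fin (le_trans (Fab x y))// -normrM.
      exact: ler_norm.
rewrite ge0_integralZr//; last 2 first.
  by case/integrableP : ia'.
  by rewrite integral_ge0.
rewrite lte_mul_pinfty ?integral_ge0//.
- apply: integrable_fin_num => //.
- exact: (integrable_lty measurableT).
Qed.

Lemma dominated_integrable_section x : m2.-integrable setT (EFin \o (fun y => F (x, y))).
Proof.
have := integrableZl measurableT (a x) ib.
apply: le_integrable => //.
  by apply/measurable_EFinP; exact: (measurableT_comp mF (pair1_measurable x)).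
by move=> y _; rewrite /= lee_fin (le_trans (Fab x y))// ler_norm.
Qed.

End fubini_dominated.

(** The product majorant makes every section integrable, not only almost every one. Both inner
    integrals are therefore real numbers everywhere, and the extended-real theorem transfers to
    [Rintegral]. *)
Lemma dominated_fubini d1 d2 (T1 : measurableType d1) (T2 : measurableType d2)
    (R : realType) (m1 : {sigma_finite_measure set T1 -> \bar R})
    (m2 : {sigma_finite_measure set T2 -> \bar R})
    (F : T1 * T2 -> R) (a : T1 -> R) (b : T2 -> R) : measurable_fun setT F ->
  m1.-integrable setT (EFin \o a) -> m2.-integrable setT (EFin \o b) ->
  (forall x y, `|F (x, y)| <= a x * b y) ->
  \int[m1]_x (\int[m2]_y F (x, y)) = \int[m2]_y (\int[m1]_x F (x, y)).
Proof.
move=> mF ia ib Fab.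
have := Fubini (dominated_integrable_prod mF ia ib Fab).
have h1 x : (\int[m2]_y (EFin \o F) (x, y))%E = (\int[m2]_y F (x, y))%:E.
  rewrite /Rintegral fineK//; apply: integrable_fin_num => //.
  exact: (dominated_integrable_section mF ib Fab).
have h2 y : (\int[m1]_x (EFin \o F) (x, y))%E = (\int[m1]_x F (x, y))%:E.
  rewrite /Rintegral fineK//; apply: integrable_fin_num => //.
  apply: (dominated_integrable_section (F := fun p => F (p.2, p.1)) (a := b) _ ia).
    apply: (measurableT_comp mF); apply/measurable_fun_pair.
      exact: measurable_snd.
    exact: measurable_fst.
  by move=> y' x; rewrite mulrC; exact: Fab.
under eq_integral do rewrite h1.
under [in X in _ = X -> _]eq_integral do rewrite h2.
by rewrite /Rintegral => ->.
Qed.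

Section measurable_comp.
Context d (T : measurableType d) (R : realType).
Implicit Types f g : T -> R.

Lemma measurable_cos_comp f : measurable_fun setT f ->
  measurable_fun setT (fun x => cos (f x)).
Proof.
by move=> mf; apply: (measurableT_comp (continuous_measurable_fun (@continuous_cos R))).
Qed.

Lemma measurable_sin_comp f : measurable_fun setT f ->
  measurable_fun setT (fun x => sin (f x)).
Proof.
by move=> mf; apply: (measurableT_comp (continuous_measurable_fun (@continuous_sin R))).
Qed.

Lemma measurable_expR_comp f : measurable_fun setT f ->
  measurable_fun setT (fun x => expR (f x)).
Proof. by move=> mf; apply: (measurableT_comp (@measurable_expR R)). Qed.

Lemma measurable_normr_comp f : measurable_fun setT f ->
  measurable_fun setT (fun x => `|f x|).
Proof. by move=> mf; apply: measurableT_comp. Qed.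

Lemma measurable_inv_sqr_comp (c : R) f : 0 < c -> measurable_fun setT f ->
  measurable_fun setT (fun x => (c + (f x) ^+ 2)^-1).
Proof.
move=> c0 mf; apply: (@measurableT_comp _ _ _ _ _ _ (fun x : R => (c + x ^+ 2)^-1)) => //.
apply: continuous_measurable_fun => x.
apply: cvgV; first by rewrite gt_eqF// ltr_wpDr// sqr_ge0.
by apply: cvgD; [exact: cvg_cst|exact: exprn_continuous].
Qed.

End measurable_comp.

Ltac meas :=
  lazymatch goal with
  | |- measurable_fun _ (fun _ => _ + _) =>
      first [apply: measurable_funD | apply: emeasurable_funD]; meas
  | |- measurable_fun _ (fun _ => - _) => apply: measurable_funN; meas
  | |- measurable_fun _ (fun _ => _ * _) => apply: measurable_funM; meas
  | |- measurable_fun _ (fun _ => _ ^+ _) => apply: measurable_funX; meas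
  | |- measurable_fun _ (fun _ => cos _) => apply: measurable_cos_comp; meas
  | |- measurable_fun _ (fun _ => sin _) => apply: measurable_sin_comp; meas
  | |- measurable_fun _ (fun _ => expR _) => apply: measurable_expR_comp; meas
  | |- measurable_fun _ (fun _ => `|_|) => apply: measurable_normr_comp; meas
  | |- measurable_fun _ (EFin \o _) => apply/measurable_EFinP; meas
  | |- measurable_fun _ (fun _ => _%:E) => apply/measurable_EFinP; meas
  | |- measurable_fun _ (+%R _) => apply: (@measurable_funD _ _ _ _ (cst _) id); meas
  | |- measurable_fun _ ( *%R _) => exact: mulrl_measurable
  | _ => first [ done | exact: measurable_fst | exact: measurable_snd
         | exact: measurable_id | exact: measurable_cst
         | match goal with H : measurable_fun _ ?k |- measurable_fun _ ?k => exact: H end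
         | match goal with H : measurable_fun _ ?k |- measurable_fun _ (fun x => ?k x) => exact: H end
         | match goal with H : forall _, measurable_fun _ _ |- _ => exact: H end
         | match goal with H : measurable_fun _ ?k |- _ =>
             apply: (measurableT_comp H); meas end
         | idtac ]
  end.

(** * Plancherel's identity *)

Section half_line.
Context {R : realType}.
Local Notation mu := (@lebesgue_measure R).

Lemma ge0_even_integral_FTC (f F : R -> R) (l : R) :
  (forall x, 0 <= f x) -> continuous f -> (forall x, f (- x) = f x) ->
  (forall x : R, is_derive x (1 : R) F (f x)) -> F x @[x --> +oo] --> l ->
  (\int[mu]_x (f x)%:E = (2 * (l - F 0))%:E)%E.
Proof.
move=> f0 cf ef dF Fl.
rewrite ge0_symfun_integralT//; last by move=> x /=; rewrite ef.
rewrite (_ : [set x | _] = `[0, +oo[%classic); last first.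
  by apply/seteqP; split => x/=; rewrite in_itv/= andbT.
rewrite (@ge0_continuous_FTC2y R f F 0 l)//.
- exact: continuous_subspaceT.
- by apply: cvg_at_right_filter; apply: differentiable_continuous; apply/derivable1_diffP.
- by move=> x _; rewrite derive1E; exact: derive_val.
Qed.

End half_line.

(** * The Abel factor and the Poisson kernel *)

Section poisson.
Context {R : realType}.
Local Notation mu := (@lebesgue_measure R).

(** Abel's convergence factor; [poisson] is its Fourier transform. As [e] decreases to 0 the factor
    increases to 1, while the kernel is a probability density concentrating at 0. *)
Definition abel (e y : R) : R := expR (- (e * `|y|)).
Definition poisson (e s : R) : R := (2 * e) / (e ^+ 2 + (2 * pi * s) ^+ 2).

Lemma abel_ge0 (e y : R) : 0 <= abel e y. Proof. exact: expR_ge0. Qed.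

Lemma poisson_ge0 (e s : R) : 0 <= e -> 0 <= poisson e s.
Proof. by move=> e0; rewrite divr_ge0// ?mulr_ge0// addr_ge0 ?sqr_ge0. Qed.

Lemma poissonN (e s : R) : poisson e (- s) = poisson e s.
Proof. by rewrite /poisson mulrN sqrrN. Qed.

Lemma expR_cvg0 (e : R) : 0 < e -> expR (- (e * x)) @[x --> +oo] --> (0 : R).
Proof.
move=> e0; apply: (@cvg_comp _ _ _ (fun x : R => e * x) (fun x => expR (- x)) _ +oo).
  exact: gt0_cvgMry.
exact: cvgr_expR.
Qed.

(** A primitive of exp(-e y) (1 + cos(w y)) that vanishes at infinity. The added 1 keeps the
    integrand nonnegative, as the fundamental theorem on a half-line demands; the pure cosine
    integral is recovered later by subtraction. *)
Let F (e w y : R) : R := - expR (- (e * y)) / e +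
  expR (- (e * y)) * (w * sin (w * y) - e * cos (w * y)) / (e ^+ 2 + w ^+ 2).

Let dF (e w x : R) : 0 < e ->
  is_derive x (1 : R) (F e w : R -> R) (expR (- (e * x)) * (1 + cos (w * x))).
Proof.
move=> e0.
have ew : e ^+ 2 + w ^+ 2 != 0 by rewrite gt_eqF// ltr_pwDl// ?exprn_gt0// sqr_ge0.
rewrite /F; apply: is_derive_eq.
rewrite /GRing.scale/=; field; rewrite ew gt_eqF//.
Qed.

Let Foo (e w : R) : 0 < e -> F e w x @[x --> +oo] --> (0 : R).
Proof.
move=> e0; apply/norm_cvg0P.
pose K := e^-1 + (`|w| + e) / (e ^+ 2 + w ^+ 2).
apply: (@squeeze_cvgr _ _ _ _ (cst 0) (fun x => expR (- (e * x)) * K)).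
- apply: nearW => x; rewrite normr_ge0/= /F /K mulNr -mulrN -mulrA -mulrDr normrM ger0_norm ?expR_ge0// ler_wpM2l ?expR_ge0//.
  rewrite (le_trans (ler_normD _ _))// normrN ger0_norm ?invr_ge0 ?(ltW e0)// lerD2l.
  rewrite normrM [`|_^-1|]ger0_norm ?invr_ge0 ?addr_ge0 ?sqr_ge0//.
  rewrite ler_wpM2r ?invr_ge0 ?addr_ge0 ?sqr_ge0//.
  rewrite (le_trans (ler_normB _ _))// !normrM lerD//.
    by rewrite ler_piMr// ler_norml sin_geN1 sin_le1.
  by rewrite gtr0_norm// ler_piMr ?(ltW e0)// ler_norml cos_geN1 cos_le1.
- exact: cvg_cst.
- by rewrite -[X in _ --> X](mul0r K); apply: cvgM; [exact: expR_cvg0|exact: cvg_cst].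
Qed.

Let abel1cos_int (e w : R) : 0 < e ->
  (\int[mu]_y (abel e y * (1 + cos (w * y)))%:E =
   (2 * (e^-1 + e / (e ^+ 2 + w ^+ 2)))%:E)%E.
Proof.
move=> e0.
have f0 y : 0 <= abel e y * (1 + cos (w * y)).
  by rewrite mulr_ge0 ?abel_ge0//; have := cos_geN1 (w * y); lra.
rewrite ge0_symfun_integralT//; first last.
- by move=> x /=; rewrite /abel normrN mulrN cosN.
- move=> x; apply: cvgM.
    apply: continuous_cvg; first exact: continuous_expR.
    by apply: cvgN; apply: cvgM; [exact: cvg_cst|exact: norm_continuous].
  apply: cvgD; first exact: cvg_cst.
  apply: continuous_cvg; first exact: continuous_cos.
  by apply: cvgM; [exact: cvg_cst|exact: cvg_id].
rewrite (_ : [set x | _] = `[0, +oo[%classic); last first.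
  by apply/seteqP; split => x/=; rewrite in_itv/= andbT.
have -> : (\int[mu]_(x in `[0%R, +oo[) (abel e x * (1 + cos (w * x)))%:E =
    \int[mu]_(x in `[0%R, +oo[) (expR (- (e * x)) * (1 + cos (w * x)))%:E)%E.
  by apply: eq_integral => y; rewrite inE/= in_itv/= andbT => y0; rewrite /abel ger0_norm.
rewrite (@ge0_continuous_FTC2y R (fun y => expR (- (e * y)) * (1 + cos (w * y))) (F e w) 0 0).
- rewrite -EFinB -EFinM; congr (_ * _)%:E.
  rewrite /F !mulr0 oppr0 expR0 sin0 cos0; field.
  by apply/andP; split; apply: lt0r_neq0 => //; rewrite ltr_pwDl// ?exprn_gt0// sqr_ge0.
- by move=> x _; rewrite mulr_ge0 ?expR_ge0//; have := cos_geN1 (w * x); lra.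
- apply: continuous_subspaceT => x.
  apply: cvgM.
    apply: continuous_cvg; first exact: continuous_expR.
    by apply: cvgN; apply: cvgM; [exact: cvg_cst|exact: cvg_id].
  apply: cvgD; first exact: cvg_cst.
  apply: continuous_cvg; first exact: continuous_cos.
  by apply: cvgM; [exact: cvg_cst|exact: cvg_id].
- exact: Foo.
- by move=> x _; have [] := @dF e w x e0.
- apply: cvg_at_right_filter; apply: differentiable_continuous; apply/derivable1_diffP.
  by have [] := @dF e w 0 e0.
- by move=> x _; rewrite derive1E; have dx := @dF e w x e0; exact: derive_val.
Qed.

(** The case [w = 0] of the preceding formula, where 1 + cos is the constant 2. *)
Lemma abel_integral (e : R) : 0 < e -> (\int[mu]_y (abel e y)%:E = (2 / e)%:E)%E.
Proof.
move=> e0; have := @abel1cos_int e 0 e0.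
under eq_integral do rewrite mul0r cos0 mulrC EFinM.
rewrite ge0_integralZl//; last 2 first.
- by rewrite /abel; meas.
- by move=> y _; rewrite lee_fin abel_ge0.
move=> /(congr1 (fun z => (2^-1)%:E * z)%E); rewrite muleA -!EFinM.
have -> : 2^-1 * (1 + 1) = 1 :> R by field.
rewrite mul1e => ->; congr EFin; field; rewrite gt_eqF//.
Qed.

Lemma abel_integrable (e : R) : 0 < e -> mu.-integrable setT (EFin \o abel e).
Proof.
move=> e0; apply/integrableP; split; first by rewrite /abel; meas.
under eq_integral do rewrite /= ger0_norm ?abel_ge0//.
by rewrite abel_integral// ltry.
Qed.

Lemma abel_cos_integral (e w : R) : 0 < e ->
  \int[mu]_y (abel e y * cos (w * y)) = 2 * e / (e ^+ 2 + w ^+ 2).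
Proof.
move=> e0; have ia := abel_integrable e0.
have ic : mu.-integrable setT (EFin \o (fun y => abel e y * cos (w * y))).
  apply: le_integrable ia => //; first by rewrite /abel; meas.
  move=> y _; rewrite /= lee_fin normrM ler_piMr// ler_norml cos_geN1 cos_le1//.
have := congr1 fine (@abel1cos_int e w e0); rewrite /= -/(Rintegral _ _ _).
under eq_Rintegral do rewrite mulrDr mulr1.
rewrite RintegralD// {1}/Rintegral abel_integral//= => h.
by apply: (addrI (2 / e)); rewrite h; ring.
Qed.

Lemma abel_cos_poisson (e s : R) : 0 < e ->
  \int[mu]_y (abel e y * cos (2 * pi * s * y)) = poisson e s.
Proof. by move=> e0; rewrite abel_cos_integral. Qed.

Lemma poisson_integral (e : R) : 0 < e -> (\int[mu]_s (poisson e s)%:E = 1)%E.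
Proof.
move=> e0; have pi0 : 0 < pi :> R := pi_gt0 R.
have ne : e != 0 by rewrite gt_eqF.
have np : (pi : R) != 0 by rewrite gt_eqF.
(* The kernel is a Cauchy density, so its primitive is an arctangent, with limit 1/2 at infinity. *)
pose G (s : R) : R := pi^-1 * atan (2 * pi / e * s).
have dG (x : R) : is_derive x (1 : R) G (poisson e x).
  rewrite /G; apply: is_derive_eq.
  rewrite /GRing.scale/= /poisson {G}; move: (@pi R) pi0 np => q q0 nq; field.
  by rewrite ne nq/= andbT !gt_eqF// ltr_pwDl// ?exprn_gt0// sqr_ge0.
rewrite (@ge0_even_integral_FTC R _ G 2^-1)//.
- by rewrite /G mulr0 atan0 mulr0 subr0 divff.
- by move=> x; apply: poisson_ge0; exact: ltW.
- move=> x; apply: cvgM; first exact: cvg_cst.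
  apply: cvgV; first by rewrite gt_eqF// ltr_pwDl// ?exprn_gt0// sqr_ge0.
  apply: cvgD; first exact: cvg_cst.
  have h : continuous (fun y : R => (2 * pi * y) ^+ 2).
    move=> z; apply: (@continuous_comp _ _ _ (fun y : R => 2 * pi * y) (fun y => y ^+ 2)).
      exact: mulrl_continuous.
    exact: exprn_continuous.
  exact: h.
- by move=> x; exact: poissonN.
- rewrite (_ : 2^-1 = pi^-1 * (pi / 2)); last by rewrite mulrA mulVf// mul1r.
  apply: cvgM; first exact: cvg_cst.
  apply: (@cvg_comp _ _ _ (fun x : R => 2 * pi / e * x) atan _ +oo).
    by apply: gt0_cvgMry => //; rewrite divr_gt0// mulr_gt0.
  exact: cvgy_atan.
Qed.

Lemma measurable_poisson (e : R) : 0 < e -> measurable_fun setT (poisson e).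
Proof.
move=> e0; apply: measurable_funM => //.
by apply: measurable_inv_sqr_comp; rewrite ?exprn_gt0//; meas.
Qed.

Lemma poisson_integrable (e : R) : 0 < e -> mu.-integrable setT (EFin \o poisson e).
Proof.
move=> e0; apply/integrableP; split.
  by apply/measurable_EFinP; exact: measurable_poisson.
under eq_integral do rewrite /= ger0_norm ?poisson_ge0 ?(ltW e0)//.
by rewrite poisson_integral// ltry.
Qed.

Lemma poisson_scale (e p : R) : 0 < e -> e * poisson e (e * p) = poisson 1 p.
Proof.
move=> e0; rewrite /poisson; field.
rewrite !gt_eqF//.
- by rewrite ltr_pwDl// ?exprn_gt0// sqr_ge0.
- by rewrite ltr_pwDl// ?exprn_gt0// sqr_ge0.
Qed.

End poisson.

(** * Plancherel as an upper bound, by Abel summation *)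

Section plancherel.
Context {R : realType}.
Local Notation mu := (@lebesgue_measure R).
Implicit Types (k h u v w : R -> R) (e s t y : R).

(** The Fourier transform of a real function is [fcos - i fsin]. Complex functions are split into
    real and imaginary parts, so Plancherel is needed for real functions only. *)
Definition fcos k (y : R) : R := \int[mu]_t (k t * cos (2 * pi * y * t)).
Definition fsin k (y : R) : R := \int[mu]_t (k t * sin (2 * pi * y * t)).

Local Notation L1 k := (mu.-integrable setT (EFin \o k)).

Lemma L1_measurable k : L1 k -> measurable_fun setT k.
Proof. by move=> /measurable_int/measurable_EFinP. Qed.

Lemma L1Z c k : L1 k -> L1 (fun t => c * k t).
Proof. by move=> ik; exact: (integrableZl measurableT c ik). Qed.

Lemma L1D k h : L1 k -> L1 h -> L1 (fun t => k t + h t).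
Proof. by move=> ik ih; exact: (integrableD measurableT ik ih). Qed.

Lemma L1M k h : L1 k -> measurable_fun setT h -> (forall t, `|h t| <= 1) ->
  L1 (fun t => k t * h t).
Proof.
move=> ik mh h1; have mk := L1_measurable ik.
apply: le_integrable ik => //; first by meas.
by move=> t _; rewrite /= lee_fin normrM ler_piMr.
Qed.

Lemma norm_cos_le1 (x : R) : `|cos x| <= 1.
Proof. by rewrite ler_norml cos_geN1 cos_le1. Qed.

Lemma norm_sin_le1 (x : R) : `|sin x| <= 1.
Proof. by rewrite ler_norml sin_geN1 sin_le1. Qed.

Lemma fcos_integrable k y : L1 k -> L1 (fun t => k t * cos (2 * pi * y * t)).
Proof. by move=> ik; apply: L1M => //; [meas|move=> t; exact: norm_cos_le1]. Qed.

Lemma fsin_integrable k y : L1 k -> L1 (fun t => k t * sin (2 * pi * y * t)).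
Proof. by move=> ik; apply: L1M => //; [meas|move=> t; exact: norm_sin_le1]. Qed.

Lemma measurable_fcos k : measurable_fun setT k -> measurable_fun setT (fcos k).
Proof.
move=> mk.
apply: (measurable_Rintegral_param mu (F := fun z => k z.2 * cos (2 * pi * z.1 * z.2))).
by meas.
Qed.

Lemma measurable_fsin k : measurable_fun setT k -> measurable_fun setT (fsin k).
Proof.
move=> mk.
apply: (measurable_Rintegral_param mu (F := fun z => k z.2 * sin (2 * pi * z.1 * z.2))).
by meas.
Qed.

Lemma norm_Rintegral_le1 k h : L1 k -> measurable_fun setT h ->
  (forall t, `|h t| <= 1) -> `|\int[mu]_t (k t * h t)| <= \int[mu]_t `|k t|.
Proof.
move=> ik mh h1; have ikh := L1M ik mh h1.
apply: (le_trans (le_normr_Rintegral measurableT ikh)).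
apply: le_Rintegral => //; [exact: (integrable_norm ikh)|exact: (integrable_norm ik)|].
by move=> t _; rewrite normrM ler_piMr.
Qed.

Lemma fcos_le k y : L1 k -> `|fcos k y| <= \int[mu]_t `|k t|.
Proof. by move=> ik; apply: norm_Rintegral_le1 => //; [meas|move=> t; exact: norm_cos_le1]. Qed.

Lemma fsin_le k y : L1 k -> `|fsin k y| <= \int[mu]_t `|k t|.
Proof. by move=> ik; apply: norm_Rintegral_le1 => //; [meas|move=> t; exact: norm_sin_le1]. Qed.

Definition pois_conv (e : R) k (t : R) : R := \int[mu]_s (k s * poisson e (t - s)).

Lemma poisson_le (e s : R) : 0 < e -> poisson e s <= 2 / e.
Proof.
move=> e0; have p0 : 0 < e ^+ 2 + (2 * pi * s) ^+ 2 by rewrite ltr_pwDl// ?exprn_gt0// sqr_ge0.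
rewrite /poisson ler_pdivrMr// mulrDr (_ : 2 / e * e ^+ 2 = 2 * e) ?lerDl.
  by rewrite mulr_ge0 ?sqr_ge0// divr_ge0// ltW.
by field; exact: lt0r_neq0.
Qed.

Lemma measurable_pois_conv e k : 0 < e -> measurable_fun setT k ->
  measurable_fun setT (pois_conv e k).
Proof.
move=> e0 mk; have mp := measurable_poisson e0.
apply: (measurable_Rintegral_param mu (F := fun z : R * R => k z.2 * poisson e (z.1 - z.2))).
apply: measurable_funM; first exact: (measurableT_comp mk measurable_snd).
by apply: (measurableT_comp mp); meas.
Qed.

Lemma fcos_fsin_at k y t : L1 k ->
  fcos k y * cos (2 * pi * y * t) + fsin k y * sin (2 * pi * y * t) =
  \int[mu]_s (k s * cos (2 * pi * y * (t - s))).
Proof.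
move=> ik; rewrite /fcos /fsin.
rewrite -RintegralZr//; last exact: fcos_integrable.
rewrite -RintegralZr//; last exact: fsin_integrable.
rewrite -RintegralD//.
- apply: eq_Rintegral => s _; rewrite mulrBr cosB; ring.
- by apply: L1M; [exact: fcos_integrable|meas|move=> _; exact: norm_cos_le1].
- by apply: L1M; [exact: fsin_integrable|meas|move=> _; exact: norm_sin_le1].
Qed.

Lemma fcos2_fsin2 k y : L1 k -> fcos k y ^+ 2 + fsin k y ^+ 2 =
  \int[mu]_t (k t * (fcos k y * cos (2 * pi * y * t) + fsin k y * sin (2 * pi * y * t))).
Proof.
move=> ik; have -> : fcos k y ^+ 2 = \int[mu]_t (fcos k y * (k t * cos (2 * pi * y * t))).
  by rewrite RintegralZl//; exact: fcos_integrable.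
have -> : fsin k y ^+ 2 = \int[mu]_t (fsin k y * (k t * sin (2 * pi * y * t))).
  by rewrite RintegralZl//; exact: fsin_integrable.
rewrite -RintegralD//.
- by apply: eq_Rintegral => t _; ring.
- exact: (integrableZl measurableT (fcos k y) (fcos_integrable y ik)).
- exact: (integrableZl measurableT (fsin k y) (fsin_integrable y ik)).
Qed.

(** The squared modulus of the transform is a double integral of k(t) k(s) cos(2 pi y (t - s)). The
    Abel factor supplies integrability in [y], so two applications of Fubini bring the [y]-integral
    inside, where it produces the Poisson kernel at t - s. *)
Lemma abel_plancherel e k : 0 < e -> L1 k ->
  \int[mu]_y (abel e y * (fcos k y ^+ 2 + fsin k y ^+ 2)) =
  \int[mu]_t (k t * pois_conv e k t).
Proof.
move=> e0 ik; have mk := L1_measurable ik.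
have mc := measurable_fcos mk; have ms := measurable_fsin mk.
have ma : measurable_fun setT (abel e) by rewrite /abel; meas.
pose K := \int[mu]_t `|k t|.
have K0 : 0 <= K by apply: Rintegral_ge0.
transitivity (\int[mu]_y \int[mu]_t (abel e y * (k t *
    (fcos k y * cos (2 * pi * y * t) + fsin k y * sin (2 * pi * y * t))))).
  apply: eq_Rintegral => y _; rewrite fcos2_fsin2// RintegralZl//.
  have := L1D (L1Z (fcos k y) (fcos_integrable y ik)) (L1Z (fsin k y) (fsin_integrable y ik)).
  by apply: eq_integrable => // t _; congr EFin; rewrite /=; ring.
rewrite (dominated_fubini (m1 := mu) (m2 := mu) (F := fun z => abel e z.1 * (k z.2 *
    (fcos k z.1 * cos (2 * pi * z.1 * z.2) + fsin k z.1 * sin (2 * pi * z.1 * z.2))))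
    (a := fun y => (2 * K) * abel e y) (b := fun t => `|k t|)); first last.
- move=> y t /=; rewrite normrM ger0_norm ?abel_ge0// [2 * K * _]mulrC -[leRHS]mulrA.
  rewrite ler_wpM2l ?abel_ge0// normrM mulrC ler_wpM2r//.
  rewrite (le_trans (ler_normD _ _))// !normrM.
  have := fcos_le y ik; have := fsin_le y ik; rewrite -/K => h1 h2.
  rewrite (_ : 2 * K = K + K); last by rewrite mulr_natl mulr2n.
  apply: lerD.
    by apply: le_trans h2; rewrite ler_piMr// norm_cos_le1.
  by apply: le_trans h1; rewrite ler_piMr// norm_sin_le1.
- exact: (integrable_norm ik).
- exact: (integrableZl measurableT (2 * K) (abel_integrable e0)).
- have ? : measurable_fun setT (fun z : R * R => fcos k z.1) by exact: measurableT_comp.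
  have ? : measurable_fun setT (fun z : R * R => fsin k z.1) by exact: measurableT_comp.
  have ? : measurable_fun setT (fun z : R * R => abel e z.1) by exact: measurableT_comp.
  by meas.
apply: eq_Rintegral => t _ /=.
transitivity (\int[mu]_y (k t * \int[mu]_s (abel e y * (k s * cos (2 * pi * y * (t - s)))))).
  apply: eq_Rintegral => y _; rewrite fcos_fsin_at// mulrCA; congr (_ * _).
  rewrite RintegralZl//; apply: L1M => //; first by meas.
  by move=> s; exact: norm_cos_le1.
have iF : forall y s, `|abel e y * (k s * cos (2 * pi * y * (t - s)))| <= abel e y * `|k s|.
  move=> y s; rewrite normrM ger0_norm ?abel_ge0// ler_wpM2l ?abel_ge0//.
  by rewrite normrM ler_piMr// norm_cos_le1.
have mF : measurable_fun setT (fun z : R * R => abel e z.1 * (k z.2 * cos (2 * pi * z.1 * (t - z.2)))).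
  have ? : measurable_fun setT (fun z : R * R => abel e z.1) by exact: measurableT_comp.
  by meas.
rewrite RintegralZl//; last first.
  apply: (@le_integrable _ _ _ mu setT measurableT _ (fun y => (K * abel e y)%:E)).
  - apply/measurable_EFinP; exact: (measurable_Rintegral_param mu mF).
  - move=> y _; rewrite /= lee_fin [leRHS]ger0_norm ?mulr_ge0 ?abel_ge0//.
    have iS := @dominated_integrable_section _ _ _ _ R mu (fun z : R * R => abel e z.1 * (k z.2 * cos (2 * pi * z.1 * (t - z.2)))) (abel e) (fun s => `|k s|) mF (integrable_norm ik) iF y.
    apply: (le_trans (le_normr_Rintegral measurableT iS)).
    rewrite /K -RintegralZr//; last exact: (integrable_norm ik).
    apply: le_Rintegral => //; first exact: (integrable_norm iS).
      have := L1Z (abel e y) (integrable_norm ik).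
      by apply: eq_integrable => // s _; rewrite /= mulrC.
    by move=> s _; rewrite [leRHS]mulrC; exact: iF.
  - exact: (integrableZl measurableT K (abel_integrable e0)).
congr (_ * _).
rewrite (@dominated_fubini _ _ _ _ R mu mu (fun z : R * R => abel e z.1 * (k z.2 * cos (2 * pi * z.1 * (t - z.2)))) (abel e) (fun s => `|k s|) mF (abel_integrable e0) (integrable_norm ik) iF) /=.
apply: eq_Rintegral => s _; rewrite -(abel_cos_poisson (t - s) e0) -RintegralZl//.
  by apply: eq_Rintegral => y _; rewrite mulrCA; congr (_ * (_ * cos _)); ring.
apply: L1M; [exact: abel_integrable|meas|by move=> y; exact: norm_cos_le1].
Qed.

Lemma poisson_integral_shift (e t : R) : 0 < e ->
  (\int[mu]_s (poisson e (t - s))%:E = 1)%E.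
Proof.
move=> e0; rewrite -(poisson_integral e0).
have mp := measurable_poisson e0.
rewrite (ge0_int_opp (f := fun s => (poisson e (t + s))%:E)); first last.
- by move=> x; rewrite lee_fin poisson_ge0// ltW.
- by apply/measurable_EFinP; apply: (measurableT_comp mp); meas.
rewrite (ge0_int_shift t (f := fun s => (poisson e s)%:E))//.
- exact/measurable_EFinP.
- by move=> x; rewrite lee_fin poisson_ge0// ltW.
Qed.

Lemma poisson_integral_shiftr (e s : R) : 0 < e ->
  (\int[mu]_t (poisson e (t - s))%:E = 1)%E.
Proof.
move=> e0; rewrite -(poisson_integral_shift s e0).
by apply: eq_integral => t _; rewrite -poissonN opprB.
Qed.

Lemma pois_form_integrand_le e k t s : 0 < e ->
  `|k t * (k s * poisson e (t - s))| <=
  2^-1 * (k t ^+ 2 * poisson e (t - s)) + 2^-1 * (k s ^+ 2 * poisson e (t - s)).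
Proof.
move=> e0; have p0 : 0 <= poisson e (t - s) by apply: poisson_ge0; exact: ltW.
move: (poisson _ _) p0 => p p0.
rewrite (mulrA 2^-1 (k t ^+ 2)) (mulrA 2^-1 (k s ^+ 2)) mulrA normrM [`|p|]ger0_norm// -mulrDl ler_wpM2r//.
rewrite normrM -(real_normK (num_real (k t))) -(real_normK (num_real (k s))).
by have := sqr_ge0 (`|k t| - `|k s|); nra.
Qed.

(** Schur's test: 2 |k(t) k(s)| <= k(t)^2 + k(s)^2, and the Poisson kernel has mass 1 in each of its
    two variables. The bound does not depend on [e]. *)
Lemma pois_form_le e k : 0 < e -> L1 k -> L2 mu k ->
  \int[mu]_t (k t * pois_conv e k t) <= ip mu k k.
Proof.
move=> e0 ik k2; have mk := L1_measurable ik; have mp := measurable_poisson e0.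
have e0' := ltW e0.
have mP : measurable_fun setT (fun z : R * R => poisson e (z.1 - z.2)).
  by apply: (measurableT_comp mp); meas.
have mks : measurable_fun setT (fun z : R * R => k z.2) by exact: measurableT_comp.
have mkt : measurable_fun setT (fun z : R * R => k z.1) by exact: measurableT_comp.
have mpt t : measurable_fun setT (fun s : R => poisson e (t - s)).
  by apply: (measurableT_comp mp); meas.
have bnd t : (`|k t * pois_conv e k t|%:E <= \int[mu]_s
    ((2^-1 * (k t ^+ 2 * poisson e (t - s)))%:E + (2^-1 * (k s ^+ 2 * poisson e (t - s)))%:E))%E.
  have ikp : L1 (fun s => k s * poisson e (t - s)).
    apply: (@le_integrable _ _ _ mu setT measurableT _ (fun s => ((2 / e) * k s)%:E)).
    - by apply/measurable_EFinP/measurable_funM => //; exact: mpt.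
    - move=> s _; rewrite /= lee_fin mulrC [leLHS]normrM [leRHS]normrM ler_wpM2r//.
      have := poisson_le (t - s) e0; have := poisson_ge0 (t - s) e0'.
      by move: (poisson _ _) => p p0 p1; rewrite !ger0_norm// (le_trans p0).
    - exact: (integrableZl measurableT (2 / e) ik).
  rewrite /pois_conv -RintegralZl//.
  rewrite EFin_normr_Rintegral//; last exact: (integrableZl measurableT (k t) ikp).
  apply: le_trans (le_abse_integral _ _ _) _ => //.
    by meas.
  apply: ge0_le_integral => //.
  - by apply: measurableT_comp => //; meas.
  - by meas.
  - by move=> s _; rewrite -EFinD lee_fin; exact: pois_form_integrand_le.
have fin : (\int[mu]_t `|k t * pois_conv e k t|%:E <= (ip mu k k)%:E)%E.
  apply: (@le_trans _ _ (\int[mu]_t \int[mu]_s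
    ((2^-1 * (k t ^+ 2 * poisson e (t - s)))%:E + (2^-1 * (k s ^+ 2 * poisson e (t - s)))%:E)))%E.
    apply: ge0_le_integral => //.
    + have mpk := measurable_pois_conv e0 mk.
      by meas.
    + apply: (measurable_fun_fubini_tonelli_F (m2 := mu) (fun z : R * R => (2^-1 * (k z.1 ^+ 2 * poisson e (z.1 - z.2)))%:E + (2^-1 * (k z.2 ^+ 2 * poisson e (z.1 - z.2)))%:E)%E).
        by meas.
      by move=> z; rewrite adde_ge0// lee_fin mulr_ge0// mulr_ge0 ?sqr_ge0// poisson_ge0.
  have h1 : (\int[mu]_t \int[mu]_s (2^-1 * (k t ^+ 2 * poisson e (t - s)))%:E = (2^-1 * ip mu k k)%:E)%E.
    under eq_integral => t _.
      under eq_integral do rewrite mulrA EFinM.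
      rewrite ge0_integralZl_EFin//; last 3 first.
      - by move=> s _; rewrite lee_fin poisson_ge0.
      - by meas.
      - by rewrite mulr_ge0 ?sqr_ge0.
      rewrite poisson_integral_shift// mule1 EFinM.
      over.
    rewrite ge0_integralZl_EFin//; last 2 first.
    - by move=> s _; rewrite lee_fin sqr_ge0.
    - by meas.
    by rewrite ip_sqr// EFinM.
  have h2 : (\int[mu]_t \int[mu]_s (2^-1 * (k s ^+ 2 * poisson e (t - s)))%:E = (2^-1 * ip mu k k)%:E)%E.
    rewrite (fubini_tonelli (m1 := mu) (m2 := mu) (fun z : R * R => (2^-1 * (k z.2 ^+ 2 * poisson e (z.1 - z.2)))%:E)) /=; last 2 first.
    - by meas.
    - by move=> z; rewrite lee_fin mulr_ge0// mulr_ge0 ?sqr_ge0// poisson_ge0.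
    under eq_integral => s _.
      under eq_integral do rewrite mulrA EFinM.
      rewrite ge0_integralZl_EFin//; last 3 first.
      - by move=> t _; rewrite lee_fin poisson_ge0.
      - by meas.
      - by rewrite mulr_ge0 ?sqr_ge0.
      rewrite poisson_integral_shiftr// mule1 EFinM.
      over.
    rewrite ge0_integralZl_EFin//; last 2 first.
    - by move=> s _; rewrite lee_fin sqr_ge0.
    - by meas.
    by rewrite ip_sqr// EFinM.
  under eq_integral => t _.
    rewrite ge0_integralD//; last 4 first.
    - by move=> s _; rewrite lee_fin mulr_ge0// mulr_ge0 ?sqr_ge0// poisson_ge0.
    - by meas.
    - by move=> s _; rewrite lee_fin mulr_ge0// mulr_ge0 ?sqr_ge0// poisson_ge0.
    - by meas.
    over.
  rewrite ge0_integralD//; last 4 first.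
  - move=> t _; apply: integral_ge0 => s _.
    by rewrite lee_fin mulr_ge0// mulr_ge0 ?sqr_ge0// poisson_ge0.
  - apply: (measurable_fun_fubini_tonelli_F (m2 := mu) (fun z : R * R => (2^-1 * (k z.1 ^+ 2 * poisson e (z.1 - z.2)))%:E)).
      by meas.
    by move=> z; rewrite lee_fin mulr_ge0// mulr_ge0 ?sqr_ge0// poisson_ge0.
  - move=> t _; apply: integral_ge0 => s _.
    by rewrite lee_fin mulr_ge0// mulr_ge0 ?sqr_ge0// poisson_ge0.
  - apply: (measurable_fun_fubini_tonelli_F (m2 := mu) (fun z : R * R => (2^-1 * (k z.2 ^+ 2 * poisson e (z.1 - z.2)))%:E)).
      by meas.
    by move=> z; rewrite lee_fin mulr_ge0// mulr_ge0 ?sqr_ge0// poisson_ge0.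
  by rewrite h1 h2 -EFinD lee_fin -mulrDl (_ : 2^-1 + 2^-1 = 1 :> R) ?mul1r//; field.
have mkp : measurable_fun setT (fun t => k t * pois_conv e k t).
  by apply: measurable_funM => //; exact: measurable_pois_conv.
have ikp : L1 (fun t => k t * pois_conv e k t).
  by apply/integrableP; split; [exact/measurable_EFinP|exact: le_lt_trans fin (ltry _)].
rewrite -lee_fin; apply: le_trans fin; rewrite -EFin_Rintegral//.
apply: le_integral => //; first exact: (integrable_norm ikp).
by move=> t _; rewrite lee_fin ler_norm.
Qed.

(** With e = 1/(n + 1) the Abel factor increases to 1, and monotone convergence carries the uniform
    bound of [pois_form_le] to the limit. In particular the transform is square integrable. *)
Lemma plancherel_le k : L1 k -> L2 mu k ->
  (\int[mu]_y (fcos k y ^+ 2 + fsin k y ^+ 2)%:E <= (ip mu k k)%:E)%E.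
Proof.
move=> ik k2; have mk := L1_measurable ik.
have mc := measurable_fcos mk; have ms := measurable_fsin mk.
pose e (n : nat) : R := n.+1%:R^-1.
have e0 n : 0 < e n by rewrite invr_gt0.
pose X y := fcos k y ^+ 2 + fsin k y ^+ 2.
have X0 y : 0 <= X y by rewrite addr_ge0 ?sqr_ge0.
have mX : measurable_fun setT X by apply: measurable_funD; exact: measurable_funX.
pose K := \int[mu]_t `|k t|.
have K0 : 0 <= K by apply: Rintegral_ge0.
have XK y : X y <= 2 * K ^+ 2.
  rewrite mulr_natl mulr2n lerD//.
    rewrite -[leLHS]real_normK ?num_real// lerXn2r ?nnegrE//.
    exact: fcos_le.
  rewrite -[leLHS]real_normK ?num_real// lerXn2r ?nnegrE//.
  exact: fsin_le.
have ma n : measurable_fun setT (abel (e n)) by rewrite /abel; meas.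
have lim1 y : (abel (e n) y * X y)%:E @[n --> \oo] --> (X y)%:E.
  apply: cvg_EFin; first exact: nearW.
  rewrite -[X in _ --> X]mul1r; apply: cvgM; last exact: cvg_cst.
  rewrite -expR0 /abel; apply: continuous_cvg; first exact: continuous_expR.
  rewrite -oppr0; apply: cvgN; rewrite -(mul0r `|y|).
  by apply: cvgM; [exact: cvg_harmonic|exact: cvg_cst].
have -> : (\int[mu]_y (X y)%:E = \int[mu]_y limn (fun n => (abel (e n) y * X y)%:E))%E.
  by apply: eq_integral => y _; apply/esym/cvg_lim.
rewrite monotone_convergence//; last 3 first.
- by move=> n; apply/measurable_EFinP/measurable_funM; [exact: ma|exact: mX].
- by move=> n y _; rewrite lee_fin mulr_ge0 ?abel_ge0.
- move=> y _ m n mn; rewrite lee_fin ler_wpM2r// ler_expR lerN2 ler_wpM2r//.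
  by rewrite lef_pV2 ?posrE// ler_nat.
have iaX n : L1 (fun y => abel (e n) y * X y).
  apply: (@le_integrable _ _ _ mu setT measurableT _ (fun y => (2 * K ^+ 2 * abel (e n) y)%:E)).
  - by apply/measurable_EFinP/measurable_funM; [exact: ma|exact: mX].
  - move=> y _; rewrite /= lee_fin !ger0_norm ?mulr_ge0 ?abel_ge0 ?sqr_ge0//.
    by rewrite mulrC ler_wpM2r ?abel_ge0.
  - exact: (L1Z (2 * K ^+ 2) (abel_integrable (e0 n))).
apply: lime_le.
  apply: ereal_nondecreasing_is_cvgn => m n mn; apply: ge0_le_integral => //.
  - by move=> y _; rewrite lee_fin mulr_ge0 ?abel_ge0.
  - by apply/measurable_EFinP/measurable_funM; [exact: ma|exact: mX].
  - by apply/measurable_EFinP/measurable_funM; [exact: ma|exact: mX].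
  - move=> y _; rewrite lee_fin ler_wpM2r// ler_expR lerN2 ler_wpM2r//.
    by rewrite lef_pV2 ?posrE// ler_nat.
apply: nearW => n.
have -> : (\int[mu]_y (abel (e n) y * X y)%:E = (\int[mu]_y (abel (e n) y * X y))%:E)%E.
  by rewrite EFin_Rintegral//; exact: iaX.
by rewrite lee_fin abel_plancherel//; exact: pois_form_le.
Qed.

End plancherel.

Section scaling.
Context {R : realType}.
Local Notation mu := (@lebesgue_measure R).

Lemma Rint_scale (s : R) (f : R -> R) : 0 < s -> mu.-integrable setT (EFin \o f) ->
  s * \int[mu]_x f (s * x) = \int[mu]_x f x.
Proof.
move=> s0 fi.
have mf : measurable_fun setT (EFin \o f) by case/integrableP : fi.
have mfp := measurable_funepos mf; have mfn := measurable_funeneg mf.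
have ep := ge0_int_scale s0 mfp (funepos_ge0 _).
have en := ge0_int_scale s0 mfn (funeneg_ge0 _).
have fp := integrable_pos_fin_num measurableT fi.
have fn := integrable_neg_fin_num measurableT fi.
rewrite /Rintegral integralE [in RHS]integralE -ep -en.
have -> : (\int[mu]_x (fun x => (f (s * x))%:E)^\+ x = \int[mu]_x (EFin \o f)^\+ (s * x)%R)%E.
  by apply: eq_integral => x _; rewrite !funeposE.
have -> : (\int[mu]_x (fun x => (f (s * x))%:E)^\- x = \int[mu]_x (EFin \o f)^\- (s * x)%R)%E.
  by apply: eq_integral => x _; rewrite !funenegE.
have finA (A B : \bar R) : (s%:E * A = B)%E -> (0 <= A)%E -> B \is a fin_num -> A \is a fin_num.
  move=> <- A0; move: A0; case: A => [a| |]//= _.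
  by rewrite gt0_muley// lte_fin.
have A1 := finA _ _ ep (integral_ge0 _ (fun x _ => funepos_ge0 _ _)) fp.
have A2 := finA _ _ en (integral_ge0 _ (fun x _ => funeneg_ge0 _ _)) fn.
by rewrite -(fineK A1) -(fineK A2) /= mulrBr.
Qed.

End scaling.

(** * Equality in Plancherel, by approximation *)

Section plancherel_eq.
Context {R : realType}.
Local Notation mu := (@lebesgue_measure R).
Local Notation L1 k := (mu.-integrable setT (EFin \o k)).
Implicit Types (k h u v w : R -> R) (e s t y : R).

(** The substitution s = t - e p moves [e] from the kernel into the argument of [w], so that the
    limit e -> 0 can be taken by dominated convergence under one fixed kernel. *)
Lemma pois_conv_scale e w t : 0 < e -> L1 w ->
  pois_conv e w t = \int[mu]_p (w (t - e * p) * poisson 1 p).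
Proof.
move=> e0 iw; have mw := L1_measurable iw; have mp := measurable_poisson e0.
have ip : L1 (fun s => w (t - s) * poisson e s).
  have iwt : L1 (fun s => w (t - s)).
    apply/integrableP; split; first by meas.
    have /integrableP[_] := iw; rewrite -(ge0_int_shift t); last 2 first.
    - by apply: measurableT_comp => //; exact/measurable_EFinP.
    - by move=> x; exact: abse_ge0.
    rewrite -(ge0_int_opp (f := fun x => `|(w (t + x))%:E|%E))//.
    by apply: measurableT_comp => //; apply/measurable_EFinP; meas.
  apply: (@le_integrable _ _ _ mu setT measurableT _ (fun s => ((2 / e) * w (t - s))%:E)).
  - by meas.
  - move=> s _; rewrite /= lee_fin mulrC [leLHS]normrM [leRHS]normrM ler_wpM2r//.
    have := poisson_le s e0; have := poisson_ge0 s (ltW e0).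
    by move: (poisson _ _) => p p0 p1; rewrite !ger0_norm// (le_trans p0).
  - exact: L1Z.
transitivity (\int[mu]_s (w (t - s) * poisson e s)).
  rewrite -[RHS]Rint_opp; last by meas.
  rewrite -[RHS](Rint_shift (- t)); last by meas.
  rewrite /pois_conv; apply: eq_Rintegral => s _.
  rewrite (_ : t - - (- t + s) = s); last by ring.
  by congr (_ * poisson _ _); ring.
rewrite -(Rint_scale e0 ip) -RintegralZl//.
  apply: eq_Rintegral => p _; rewrite mulrCA poisson_scale//.
apply/integrableP; split; first by meas.
have /integrableP[_] := ip; rewrite -(ge0_int_scale e0); last 2 first.
- by apply: measurableT_comp => //; meas.
- by move=> x; exact: abse_ge0.
case: (\int[mu]_x _)%E => [r| |]; rewrite ?ltry ?ltNyr//.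
by rewrite gt0_muley ?lte_fin.
Qed.

(** Off the null set {a, b} the Poisson averages of [w] converge to [w], boundedly, so their inner
    products with [w] tend to [ip mu w w]. By [abel_plancherel] each of them is an Abel-damped
    integral, hence at most the undamped one. *)
Lemma plancherel_ge_nice w (M a b : R) : measurable_fun setT w ->
  (forall t, `|w t| <= M) -> (forall t, t < a \/ b < t -> w t = 0) ->
  (forall t, t != a -> t != b -> {for t, continuous w}) ->
  ((ip mu w w)%:E <= \int[mu]_y (fcos w y ^+ 2 + fsin w y ^+ 2)%:E)%E.
Proof.
move=> mw wM w0 wc.
have M0 : 0 <= M by apply: le_trans (wM 0).
have iI : L1 (fun t => M * \1_`[a, b] t).
  by apply: L1Z; exact: integrable_indic_itv.
have wI t : `|w t| <= M * \1_`[a, b] t.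
  rewrite indicE; case: (boolP (t \in _)) => [_|]; first by rewrite mulr1.
  rewrite notin_setE /= in_itv/= => /negP; rewrite negb_and -!ltNge => /orP h.
  by rewrite w0 ?normr0 ?mulr0.
have iw : L1 w.
  apply: le_integrable iI => //; first exact/measurable_EFinP.
  move=> t _; rewrite /= lee_fin (le_trans (wI t))// ler_norm//.
have mc := measurable_fcos mw; have ms := measurable_fsin mw.
pose e (n : nat) : R := n.+1%:R^-1.
have e0 n : 0 < e n by rewrite invr_gt0.
have mp := @measurable_poisson R 1 ltr01.
have iabs := L1Z M (@poisson_integrable R 1 ltr01).
have mpc n : measurable_fun setT (pois_conv (e n) w) by exact: measurable_pois_conv.
have lim_in t : t != a -> t != b -> pois_conv (e n) w t @[n --> \oo] --> w t.
  move=> ta tb.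
  have -> : w t = \int[mu]_p (w t * poisson 1 p).
    by rewrite RintegralZl//; [rewrite /Rintegral poisson_integral//= mulr1|exact: poisson_integrable].
  under eq_fun do rewrite pois_conv_scale//.
  have [|||||] := @dominated_convergence _ _ _ mu setT measurableT
     (fun n p => (w (t - e n * p) * poisson 1 p)%:E) (fun p => (w t * poisson 1 p)%:E)
     (fun p => (M * poisson 1 p)%:E).
  - by move=> n; meas.
  - by meas.
  - apply: aeW => p _; apply: cvg_EFin; first exact: nearW.
    apply: cvgM; last exact: cvg_cst.
    apply: continuous_cvg; first exact: wc.
    rewrite -[X in _ --> X]subr0; apply: cvgB; first exact: cvg_cst.
    rewrite -(mul0r p); apply: cvgM; last exact: cvg_cst.
    exact: cvg_harmonic.
  - exact: iabs.
  - apply: aeW => p n _; rewrite /= lee_fin normrM [`|poisson _ _|]ger0_norm ?poisson_ge0//.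
    by rewrite ler_wpM2r ?poisson_ge0.
  by move=> /EFin_Rintegral iF _; rewrite iF => /fine_cvg.
have pcM n t : `|pois_conv (e n) w t| <= M.
  rewrite pois_conv_scale//.
  have iF : L1 (fun p => w (t - e n * p) * poisson 1 p).
    apply: le_integrable iabs => //; first by meas.
    move=> p _; rewrite /= lee_fin normrM [`|poisson _ _|]ger0_norm ?poisson_ge0// [leRHS]ger0_norm ?(mulr_ge0 M0 (poisson_ge0 _ ler01))//.
    by rewrite ler_wpM2r ?poisson_ge0.
  apply: (le_trans (le_normr_Rintegral measurableT iF)).
  have -> : M = \int[mu]_p (M * poisson 1 p).
    by rewrite RintegralZl//; [rewrite /Rintegral poisson_integral//= mulr1|exact: poisson_integrable].
  apply: le_Rintegral => //; first exact: (integrable_norm iF).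
  move=> p _; rewrite normrM [`|poisson _ _|]ger0_norm ?poisson_ge0//.
  by rewrite ler_wpM2r ?poisson_ge0.
have lim_out : (\int[mu]_t (w t * pois_conv (e n) w t)) @[n --> \oo] --> ip mu w w.
  have [|||||] := @dominated_convergence _ _ _ mu setT measurableT
     (fun n t => (w t * pois_conv (e n) w t)%:E) (fun t => (w t * w t)%:E)
     (fun t => (M * (M * \1_`[a, b] t))%:E).
  - by move=> n; meas.
  - by meas.
  - exists ([set a] `|` [set b]); split.
    + by apply: measurableU; exact: measurable_set1.
    + apply/eqP; rewrite eq_le measure_ge0 andbT.
      apply: le_trans (measureU2 _ _ _) _; [exact: measurable_set1|exact: measurable_set1|].
      apply: (@le_trans _ _ (@lebesgue_measure R [set a] + @lebesgue_measure R [set b])%E); first by [].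
      by rewrite !lebesgue_measure_set1 adde0.
    + move=> t /= hn; apply: contrapT => /not_orP[ta tb]; apply: hn => _.
      apply: cvg_EFin; first exact: nearW.
      apply: cvgM; first exact: cvg_cst.
      by apply: lim_in; exact/eqP.
  - exact: (L1Z M iI).
  - apply: aeW => t n _; rewrite /= lee_fin normrM mulrC.
    by apply: ler_pM.
  by move=> /EFin_Rintegral iF _; rewrite iF => /fine_cvg.
pose X y := fcos w y ^+ 2 + fsin w y ^+ 2.
have X0 y : 0 <= X y by rewrite addr_ge0 ?sqr_ge0.
case: (ltP (\int[mu]_y (X y)%:E)%E +oo%E) => [Xoo|]; last first.
  by rewrite leye_eq => /eqP ->; rewrite leey.
have mX : measurable_fun setT X by rewrite /X; meas.
have iX : L1 X.
  by apply/integrableP; split; [meas|under eq_integral do rewrite /= ger0_norm//].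
rewrite EFin_Rintegral// lee_fin.
rewrite -(cvg_lim _ lim_out)//; apply: limr_le; first by apply/cvg_ex; exists (ip mu w w).
apply: nearW => n; rewrite -abel_plancherel//.
apply: le_Rintegral => //.
  apply: le_integrable iX => //.
    by have ? : measurable_fun setT (abel (e n)); [rewrite /abel; meas|meas].
  move=> y _; rewrite /= lee_fin -/(X y) normrM (ger0_norm (abel_ge0 _ _)).
  by rewrite ler_piMl// -expR0 ler_expR oppr_le0 mulr_ge0// ltW.
move=> y _.
by rewrite ler_piMl// ?X0// -expR0 ler_expR oppr_le0 mulr_ge0// ltW.
Qed.

Lemma fcosD k h y : L1 k -> L1 h -> fcos (fun t => k t + h t) y = fcos k y + fcos h y.
Proof.
move=> ik ih; rewrite /fcos -RintegralD//; [|exact: fcos_integrable..].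
by apply: eq_Rintegral => t _; rewrite mulrDl.
Qed.

Lemma fsinD k h y : L1 k -> L1 h -> fsin (fun t => k t + h t) y = fsin k y + fsin h y.
Proof.
move=> ik ih; rewrite /fsin -RintegralD//; [|exact: fsin_integrable..].
by apply: eq_Rintegral => t _; rewrite mulrDl.
Qed.

Lemma L2_fcos k : L1 k -> L2 mu k -> L2 mu (fcos k).
Proof.
move=> ik k2; have mk := L1_measurable ik; split; first exact: measurable_fcos.
apply: le_lt_trans (le_lt_trans (plancherel_le ik k2) (ltry _)).
have ? := measurable_fcos mk; have ? := measurable_fsin mk.
apply: ge0_le_integral => //; [by move=> t _; rewrite lee_fin sqr_ge0|by meas|by meas|].
by move=> t _; rewrite lee_fin lerDl sqr_ge0.
Qed.

Lemma L2_fsin k : L1 k -> L2 mu k -> L2 mu (fsin k).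
Proof.
move=> ik k2; have mk := L1_measurable ik; split; first exact: measurable_fsin.
apply: le_lt_trans (le_lt_trans (plancherel_le ik k2) (ltry _)).
have ? := measurable_fcos mk; have ? := measurable_fsin mk.
apply: ge0_le_integral => //; [by move=> t _; rewrite lee_fin sqr_ge0|by meas|by meas|].
by move=> t _; rewrite lee_fin lerDr sqr_ge0.
Qed.

Lemma int_fcos2_fsin2 k : L1 k -> L2 mu k ->
  (\int[mu]_y (fcos k y ^+ 2 + fsin k y ^+ 2)%:E =
   (ip mu (fcos k) (fcos k) + ip mu (fsin k) (fsin k))%:E)%E.
Proof.
move=> ik k2; have c2 := L2_fcos ik k2; have s2 := L2_fsin ik k2.
under eq_integral do rewrite EFinD.
rewrite ge0_integralD//; last 4 first.
- by move=> t _; rewrite lee_fin sqr_ge0.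
- by case: c2 => ? _; meas.
- by move=> t _; rewrite lee_fin sqr_ge0.
- by case: s2 => ? _; meas.
by rewrite (ip_sqr c2) (ip_sqr s2).
Qed.

(** With v = k - w and z = w - v, the parallelogram law holds for the pair w, v and for their
    transforms. Subtracting the two identities and using the upper bound for z and the assumed lower
    bound for w leaves an error of 2 |v|^2, without any triangle inequality. *)
Lemma plancherel_approx k w : L1 k -> L2 mu k -> L1 w -> L2 mu w ->
  ((ip mu w w)%:E <= \int[mu]_y (fcos w y ^+ 2 + fsin w y ^+ 2)%:E)%E ->
  ip mu k k <= ip mu (fcos k) (fcos k) + ip mu (fsin k) (fsin k) +
    2 * ip mu (fun t => k t - w t) (fun t => k t - w t).
Proof.
move=> ik k2 iw w2; rewrite int_fcos2_fsin2// lee_fin => hw.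
have iNw : L1 (fun t => - w t).
  by have := L1Z (-1) iw; apply: eq_integrable => // t _; rewrite /= mulN1r.
pose v t := k t - w t; have v2 : L2 mu v := L2B k2 w2.
have iv : L1 v := L1D ik iNw.
have inv : L1 (fun t => - v t).
  by have := L1Z (-1) iv; apply: eq_integrable => // t _; rewrite /= mulN1r.
pose z t := w t - v t; have z2 : L2 mu z := L2B w2 v2.
have iz : L1 z := L1D iw inv.
have hz : ip mu (fcos z) (fcos z) + ip mu (fsin z) (fsin z) <= ip mu z z.
  by rewrite -lee_fin -int_fcos2_fsin2//; exact: plancherel_le.
have cz : fcos z = fun y => fcos w y - fcos v y.
  apply/funext => y; rewrite fcosD//; congr (_ + _).
  rewrite /fcos -mulN1r -RintegralZl//; last exact: fcos_integrable.
  by apply: eq_Rintegral => t _; rewrite mulN1r mulNr.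
have sz : fsin z = fun y => fsin w y - fsin v y.
  apply/funext => y; rewrite fsinD//; congr (_ + _).
  rewrite /fsin -mulN1r -RintegralZl//; last exact: fsin_integrable.
  by apply: eq_Rintegral => t _; rewrite mulN1r mulNr.
have kE : k = (fun t => w t + v t) by apply/funext => t; rewrite /v addrC subrK.
have ck : fcos k = fun y => fcos w y + fcos v y by apply/funext => y; rewrite kE fcosD.
have sk : fsin k = fun y => fsin w y + fsin v y by apply/funext => y; rewrite kE fsinD.
have := ip_parallelogram w2 v2; rewrite -kE -/z.
have := ip_parallelogram (L2_fcos iw w2) (L2_fcos iv v2); rewrite -ck -cz.
have := ip_parallelogram (L2_fsin iw w2) (L2_fsin iv v2); rewrite -sk -sz.
have := ip_ge0 mu (fcos v); have := ip_ge0 mu (fsin v).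
rewrite -/v; move: hw hz; move: (ip mu k k) (ip mu z z) (ip mu v v) (ip mu w w).
move: (ip mu (fcos k) _) (ip mu (fsin k) _) (ip mu (fcos z) _) (ip mu (fsin z) _).
move: (ip mu (fcos v) _) (ip mu (fsin v) _) (ip mu (fcos w) _) (ip mu (fsin w) _).
by move=> *; lra.
Qed.

Lemma nice_integrable w (M a b : R) : measurable_fun setT w ->
  (forall t, `|w t| <= M) -> (forall t, t < a \/ b < t -> w t = 0) ->
  L1 w /\ L2 mu w.
Proof.
move=> mw wM w0.
have M0 : 0 <= M by apply: le_trans (wM 0).
have iI : L1 (fun t => M * \1_`[a, b] t) by apply: L1Z; exact: integrable_indic_itv.
have wI t : `|w t| <= M * \1_`[a, b] t.
  rewrite indicE; case: (boolP (t \in _)) => [_|]; first by rewrite mulr1.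
  rewrite notin_setE /= in_itv/= => /negP; rewrite negb_and -!ltNge => /orP h.
  by rewrite w0 ?normr0 ?mulr0.
have iw : L1 w.
  apply: le_integrable iI => //; first exact/measurable_EFinP.
  by move=> t _; rewrite /= lee_fin (le_trans (wI t))// ler_norm.
split=> //; split=> //.
have : L1 (fun t => M * `|w t|) by apply: L1Z; exact: (integrable_norm iw).
move=> /(integrable_lty measurableT); apply: le_lt_trans.
apply: ge0_le_integral => //; [by move=> t _; rewrite lee_fin sqr_ge0|by meas|by meas|].
by move=> t _; rewrite lee_fin -real_normK ?num_real// expr2 ler_wpM2r.
Qed.

Lemma near_eq_continuous (f g : R -> R) t : {for t, continuous f} ->
  (\forall x \near t, g x = f x) -> {for t, continuous g}.
Proof.
move=> cf e; have et := nbhs_singleton e.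
rewrite /prop_for /continuous_at et; apply: cvg_trans cf; apply: near_eq_cvg.
by apply: filterS e => x ->.
Qed.

Definition clip (M x : R) : R := Num.max (- M) (Num.min x M).

Lemma clip_le (M x : R) : 0 <= M -> `|clip M x| <= M.
Proof.
move=> M0; rewrite ler_norml /clip le_max lexx/= ge_max ge_min lexx orbT andbT; lra.
Qed.

Lemma clip_cases (M x : R) : 0 <= M ->
  [\/ clip M x = x /\ - M <= x <= M, clip M x = - M /\ x < - M |
      clip M x = M /\ M < x].
Proof.
move=> M0; rewrite /clip; have [h1|h1] := leP x M.
  by have [h2|h2] := leP (- M) x; [constructor 1; rewrite ?h1|constructor 2].
by constructor 3; rewrite max_r; lra.
Qed.

Lemma clip_le_norm (M x : R) : 0 <= M -> `|x - clip M x| <= `|x|.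
Proof.
move=> M0; have [[-> /andP[? ?]]|[-> ?]|[-> ?]] := clip_cases x M0;
  by rewrite ler_norml; case: (ger0P x) => h; apply/andP; lra.
Qed.

Lemma clip_id (M x : R) : `|x| <= M -> clip M x = x.
Proof.
by rewrite ler_norml /clip => /andP[h1 h2]; rewrite min_l// max_r.
Qed.

Lemma clip_lip (M x y : R) : 0 <= M -> `|clip M x - clip M y| <= `|x - y|.
Proof.
move=> M0; have [[-> /andP[? ?]]|[-> ?]|[-> ?]] := clip_cases x M0;
  have [[-> /andP[? ?]]|[-> ?]|[-> ?]] := clip_cases y M0;
  by rewrite ler_norml; case: (ger0P (x - y)) => h; apply/andP; lra.
Qed.

Lemma measurable_clip (M : R) k : measurable_fun setT k -> measurable_fun setT (fun t => clip M (k t)).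
Proof. by move=> mk; apply: measurable_maxr => //; exact: measurable_minr. Qed.

(** First [k] is truncated in size and support, then the truncation is approximated in L1 by a
    continuous function, which is truncated again. Both functions are now bounded by M, so
    L1-closeness implies L2-closeness. The cut-off to [-M, M] may create jumps at its endpoints,
    which is why two exceptional points are allowed. *)
Lemma L2_approx_nice k (eta : R) : L2 mu k -> 0 < eta ->
  exists w (M a b : R), [/\ measurable_fun setT w, (forall t, `|w t| <= M),
    (forall t, t < a \/ b < t -> w t = 0),
    (forall t, t != a -> t != b -> {for t, continuous w}) &
    ip mu (fun t => k t - w t) (fun t => k t - w t) <= eta].
Proof.
move=> k2 eta0; have [mk _] := k2.
pose E (N : nat) : set R := `[- N.+1%:R, N.+1%:R]%classic.
pose kN (N : nat) t := clip N.+1%:R (k t) * \1_(E N) t.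
have mE N : measurable (E N) by exact: measurable_itv.
have mI N : measurable_fun setT (\1_(E N) : R -> R) by exact: measurable_indic.
have mkN N : measurable_fun setT (kN N).
  by apply: measurable_funM => //; exact: measurable_clip.
have EP N t : \1_(E N) t = ((- N.+1%:R <= t) && (t <= N.+1%:R))%:R :> R.
  rewrite indicE; congr (nat_of_bool _)%:R.
  by apply/idP/idP; rewrite inE /E/= in_itv/=.
have kNb N t : `|kN N t| <= N.+1%:R.
  by rewrite /kN EP; case: (_ && _); rewrite ?mulr1 ?mulr0 ?normr0// clip_le.
have kN0 N t : t < - N.+1%:R \/ N.+1%:R < t -> kN N t = 0.
  rewrite /kN EP; case: (boolP (_ && _)) => [/andP[h1 h2] [] h|]; last by rewrite mulr0.
    by have := le_lt_trans h1 h; rewrite ltxx.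
  by have := le_lt_trans h2 h; rewrite ltxx.
have kNk N t : `|k t - kN N t| <= `|k t|.
  rewrite /kN EP; case: (_ && _); rewrite ?mulr1 ?mulr0 ?subr0//.
  exact: clip_le_norm.
have kN2 N : L2 mu (kN N) by have [] := nice_integrable (mkN N) (kNb N) (kN0 N).
have cvgA : ip mu (fun t => k t - kN n t) (fun t => k t - kN n t) @[n --> \oo] --> 0.
  have -> : 0 = \int[mu]_(t in setT) (0 : R) by rewrite Rintegral_cst// mul0r.
  have [|||||] := @dominated_convergence _ _ _ mu setT measurableT
     (fun n t => ((k t - kN n t) * (k t - kN n t))%:E) (fun t => 0%:E)
     (fun t => (k t ^+ 2)%:E).
  - by move=> n; meas.
  - by meas.
  - apply: aeW => t _; apply: cvg_near_cst.
    have [m hm] : exists m : nat, `|k t| + `|t| <= m%:R.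
      by exists (Num.bound (`|k t| + `|t|)); apply/ltW/archi_boundP; rewrite addr_ge0.
    exists m => // n /= mn; have mn' : m%:R <= n.+1%:R :> R by rewrite ler_nat ltnW.
    have t0 := normr_ge0 t; have k0 := normr_ge0 (k t).
    rewrite /kN EP -ler_norml (le_trans _ (le_trans hm mn')) ?lerDr//= mulr1.
    by rewrite clip_id ?subrr ?mulr0// (le_trans _ (le_trans hm mn')) ?lerDl.
  - exact: L2_sqr_integrable.
  - apply: aeW => t n _; rewrite /= lee_fin normrM -expr2 -[leRHS]real_normK ?num_real//.
    by rewrite lerXn2r ?nnegrE.
  by move=> /EFin_Rintegral iF _; rewrite iF => /fine_cvg.
have eta4 : 0 < eta / 4 by rewrite divr_gt0.
have [N _ /(_ N (leqnn N)) hN] := cvgr_le 0 cvgA _ eta4.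
pose M : R := N.+1%:R; have M0 : 0 < M by [].
have ikE : mu.-integrable (E N) (EFin \o kN N).
  apply: (@integrableS _ _ _ mu setT (E N)) => //; first exact: mE.
  by have [] := nice_integrable (mkN N) (kNb N) (kN0 N).
have muE : (mu (E N) < +oo)%E by rewrite lebesgue_measure_itv/=; case: ifP => // _; rewrite ltry.
have [g [cg ig gcvg]] := approximation_continuous_integrable (mE N) muE ikE.
(* The squared L2 error is at most 2M times the L1 error, that is eta/4. Together with the eta/4 of
   the truncation, the parallelogram law gives 2 (eta/4 + eta/4) = eta. *)
have eta8 : 0 < eta / (8 * M) by rewrite divr_gt0// mulr_gt0.
have [m _ /(_ m (leqnn m)) hm] : \forall n \near \oo,
    (\int[mu]_(z in E N) `|(kN N z - g n z)%:E| <= (eta / (8 * M))%:E)%E.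
  have /fine_cvgP[fin cv] := gcvg.
  have cv' : \forall n \near \oo, fine (\int[mu]_(z in E N) `|(kN N z - g n z)%:E|)%E <= eta / (8 * M).
    exact: (cvgr_le 0 cv _ eta8).
  by apply: filterS2 fin cv' => n fn hn; rewrite -(fineK fn) lee_fin.
pose w t := clip M (g m t) * \1_(E N) t.
have mg : measurable_fun setT (g m) by exact: continuous_measurable_fun.
have mw : measurable_fun setT w.
  by apply: measurable_funM => //; exact: measurable_clip.
have wb t : `|w t| <= M.
  by rewrite /w EP; case: (_ && _); rewrite ?mulr1 ?mulr0 ?normr0 ?clip_le// ltW.
have w0 t : t < - M \/ M < t -> w t = 0.
  rewrite /w EP; case: (boolP (_ && _)) => [/andP[h1 h2] [] h|]; last by rewrite mulr0.
    by have := le_lt_trans h1 h; rewrite ltxx.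
  by have := le_lt_trans h2 h; rewrite ltxx.
have [_ w2] := nice_integrable mw wb w0.
exists w, M, (- M), M; split=> //.
- move=> t tM tM'.
  have [tE|tE] := boolP (- M < t < M).
    have cc : {for t, continuous (fun x => clip M (g m x))}.
      apply: continuous_max; first exact: cvg_cst.
      by apply: continuous_min; [exact: cg|exact: cvg_cst].
    apply: (near_eq_continuous cc).
    have : \forall x \near t, x \in `]- M, M[ by exact: near_in_itvoo.
    apply: filterS => x; rewrite in_itv/= => /andP[x1 x2].
    by rewrite /w EP -/M (ltW x1) (ltW x2) mulr1.
  apply: (@near_eq_continuous (fun=> 0)); first exact: cvg_cst.
  move: tE; rewrite negb_and -!leNgt => /orP[h|h].
    have tl : t < - M by rewrite lt_neqAle tM.
    have : \forall x \near t, x < - M by exact: lt_nbhsl.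
    by apply: filterS => x ?; apply: w0; left.
  have tl : M < t by rewrite lt_neqAle eq_sym tM'.
  have : \forall x \near t, M < x by exact: lt_nbhsr.
  by apply: filterS => x ?; apply: w0; right.
have hB : ip mu (fun t => kN N t - w t) (fun t => kN N t - w t) <= eta / 4.
  have d2 := L2B (kN2 N) w2.
  rewrite -lee_fin -ip_sqr//.
  apply: (@le_trans _ _ (\int[mu]_(t in E N) ((2 * M)%:E * `|(kN N t - g m t)%:E|)))%E.
    rewrite [leRHS]integral_mkcond; apply: ge0_le_integral => //.
    - by move=> t _; rewrite lee_fin sqr_ge0.
    - by case: d2 => ? _; meas.
    - apply/(measurable_restrictT _ (mE N)).
      apply: measurable_funTS; apply: measurable_funeM; apply: measurableT_comp => //.
      by have := mkN N => ?; meas.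
    - move=> t _; rewrite /patch; case: ifPn => tE.
        rewrite -EFinM lee_fin /w /kN indicE tE !mulr1.
        have h1 := clip_lip (k t) (g m t) (ltW M0).
        have h2 := clip_lip (clip M (k t)) (g m t) (ltW M0).
        have h3 := clip_le (k t) (ltW M0); have h4 := clip_le (g m t) (ltW M0).
        rewrite [clip M (clip M _)]clip_id// in h2.
        rewrite -/M -real_normK ?num_real// expr2 ler_pM//.
        by rewrite (le_trans (ler_normB _ _))// (_ : 2 * M = M + M) ?lerD//; ring.
      rewrite /w /kN indicE (negbTE tE) !mulr0 subr0 expr0n//.
  rewrite ge0_integralZl//; last first.
    by rewrite lee_fin mulr_ge0// ltW.
    apply: measurable_funTS; apply: measurableT_comp => //.
    by have := mkN N => ?; meas.
    exact: mE.
  apply: (@le_trans _ _ ((2 * M)%:E * (eta / (8 * M))%:E))%E.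
    by apply: lee_wpmul2l => //; rewrite lee_fin mulr_ge0// ltW.
  rewrite -EFinM lee_fin le_eqVlt; apply/orP; left; apply/eqP; field.
  by rewrite gt_eqF.
have A2 := L2B k2 (kN2 N); have B2 := L2B (kN2 N) w2.
have := ip_parallelogram A2 B2.
have -> : (fun t => k t - kN N t + (kN N t - w t)) = (fun t => k t - w t).
  by apply/funext => t; ring.
move: hN hB (ip_ge0 mu (fun t => k t - kN N t - (kN N t - w t))).
move: (ip _ _ _) (ip _ _ _) (ip _ _ _) (ip _ _ _) => a1 a2 a3 a4; lra.
Qed.

(** The lower bound known for nice functions passes to [k] through [plancherel_approx], with an
    arbitrarily small error. *)
Theorem plancherel k : L1 k -> L2 mu k ->
  (\int[mu]_y (fcos k y ^+ 2 + fsin k y ^+ 2)%:E = (ip mu k k)%:E)%E.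
Proof.
move=> ik k2; apply/eqP; rewrite eq_le plancherel_le//= int_fcos2_fsin2// lee_fin.
apply/ler_addgt0Pr => eta eta0.
have eta2 : 0 < eta / 2 by rewrite divr_gt0.
have [w [M [a [b [mw wM w0 wc hw]]]]] := L2_approx_nice k2 eta2.
have [iw w2] := nice_integrable mw wM w0.
have := plancherel_approx ik k2 iw w2 (plancherel_ge_nice mw wM w0 wc).
move=> /le_trans; apply; rewrite lerD2l; move: hw; move: (ip _ _ _) => x; lra.
Qed.

End plancherel_eq.

(** * The short-time Fourier transform with Gaussian window *)

Section gaussian.
Context {R : realType}.
Local Notation mu := (@lebesgue_measure R).

Lemma gauss_c_ge0 : 0 <= gauss_c R.
Proof. exact: powR_ge0. Qed.

Lemma gauss_ge0 (t : R) : 0 <= gauss t.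
Proof. by rewrite mulr_ge0 ?gauss_c_ge0 ?expR_ge0. Qed.

Lemma gauss_le (t : R) : gauss t <= gauss_c R.
Proof. by rewrite ler_piMr ?gauss_c_ge0// -expR0 ler_expR oppr_le0 sqr_ge0. Qed.

Lemma measurable_gauss : measurable_fun setT (@gauss R).
Proof. by rewrite /gauss; meas. Qed.

Lemma measurable_gauss_comp d (T : measurableType d) (f : T -> R) :
  measurable_fun setT f -> measurable_fun setT (fun x => gauss (f x)).
Proof. by move=> mf; apply: (measurableT_comp measurable_gauss). Qed.

Lemma gauss_c_sqr : gauss_c R ^+ 2 = Num.sqrt 2 / Num.sqrt pi.
Proof.
have p0 : 0 <= 2 / pi :> R by rewrite divr_ge0 ?pi_ge0.
rewrite /gauss_c -powR_mulrn ?powR_ge0// -powRrM.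
rewrite (_ : 4^-1 * 2%:R = 2^-1 :> R); last by field.
by rewrite powR12_sqrt// sqrtrM// sqrtrV// pi_ge0.
Qed.

Lemma gauss_sqr_integral : (\int[mu]_t ((gauss t) ^+ 2)%:E = 1)%E.
Proof.
have s0 : 0 < Num.sqrt 2 :> R by rewrite sqrtr_gt0.
have E t : gauss t ^+ 2 = gauss_c R ^+ 2 * gauss_fun (Num.sqrt 2 * t).
  rewrite /gauss exprMn; congr (_ * _); rewrite /gauss_fun expr2 -expRD exprMn sqr_sqrtr//.
  by congr expR; ring.
under eq_integral do rewrite E EFinM.
have mg : measurable_fun setT (fun t : R => gauss_fun (Num.sqrt 2 * t)) by rewrite /gauss_fun; meas.
rewrite ge0_integralZl_EFin ?sqr_ge0//; last 2 first.
- by move=> t _; rewrite lee_fin gauss_fun_ge0.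
- exact/measurable_EFinP.
have h := @ge0_int_scale R (Num.sqrt 2) (fun t => (gauss_fun t)%:E) s0
  (proj2 (measurable_EFinP _ _) (@measurable_gauss_fun R)) (fun t => gauss_fun_ge0 t).
rewrite integralT_gauss in h.
rewrite gauss_c_sqr mulrC EFinM -muleA h -EFinM mulVf//.
by rewrite gt_eqF// sqrtr_gt0 pi_gt0.
Qed.

Lemma gauss_shift_sqr_integral (x : R) : (\int[mu]_t ((gauss (t - x)) ^+ 2)%:E = 1)%E.
Proof.
rewrite -gauss_sqr_integral -(ge0_int_shift (- x) (f := fun t => (gauss t ^+ 2)%:E)).
- by apply: eq_integral => t _; rewrite addrC.
- by have := measurable_gauss => ?; meas.
- by move=> t; rewrite lee_fin sqr_ge0.
Qed.

Lemma gauss_reflect_sqr_integral (t : R) : (\int[mu]_x ((gauss (t - x)) ^+ 2)%:E = 1)%E.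
Proof.
rewrite -(gauss_shift_sqr_integral t); apply: eq_integral => x _.
by rewrite /gauss -[t - x]opprB sqrrN.
Qed.

Lemma L2_gauss (x : R) : L2 mu (fun t => gauss (t - x)).
Proof.
split; first by apply: measurable_gauss_comp; meas.
by rewrite gauss_shift_sqr_integral ltry.
Qed.

End gaussian.

Section product_substitution.
Context {R : realType}.
Local Notation mu := (@lebesgue_measure R).
Local Notation mu2 := (mu \x mu)%E.
Implicit Type F : R * R -> \bar R.

Lemma int2E F : measurable_fun setT F -> (forall z, (0 <= F z)%E) ->
  (\int[mu2]_z F z = \int[mu]_x \int[mu]_y F (x, y))%E.
Proof. by move=> mF F0; rewrite fubini_tonelli1. Qed.

Lemma ge0_int2_shift (p : R * R) F : measurable_fun setT F -> (forall z, (0 <= F z)%E) ->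
  (\int[mu2]_z F (p.1 + z.1, p.2 + z.2)%R = \int[mu2]_z F z)%E.
Proof.
move=> mF F0.
have m1 : measurable_fun setT (fun z : R * R => (p.1 + z.1, p.2 + z.2)).
  by apply/measurable_fun_pair; meas.
rewrite (int2E (F := fun z : R * R => F (p.1 + z.1, p.2 + z.2)))//; last exact: measurableT_comp.
rewrite int2E// -[RHS](ge0_int_shift p.1).
- apply: eq_integral => x _ /=.
  rewrite -[RHS](ge0_int_shift p.2)//.
  exact: (measurableT_comp mF (pair1_measurable _)).
- exact: measurable_fun_fubini_tonelli_F.
- by move=> x; exact: integral_ge0.
Qed.

Lemma ge0_int2_opp F : measurable_fun setT F -> (forall z, (0 <= F z)%E) ->
  (\int[mu2]_z F (- z.1, - z.2)%R = \int[mu2]_z F z)%E.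
Proof.
move=> mF F0.
have m1 : measurable_fun setT (fun z : R * R => (- z.1, - z.2)).
  by apply/measurable_fun_pair; meas.
rewrite (int2E (F := fun z : R * R => F (- z.1, - z.2)))//; last exact: measurableT_comp.
rewrite int2E// -[RHS]ge0_int_opp.
- apply: eq_integral => x _ /=.
  rewrite -[RHS]ge0_int_opp//.
  exact: (measurableT_comp mF (pair1_measurable _)).
- exact: measurable_fun_fubini_tonelli_F.
- by move=> x; exact: integral_ge0.
Qed.

Lemma ge0_int2_oppr F : measurable_fun setT F -> (forall z, (0 <= F z)%E) ->
  (\int[mu2]_z F (z.1, - z.2)%R = \int[mu2]_z F z)%E.
Proof.
move=> mF F0.
have m1 : measurable_fun setT (fun z : R * R => (z.1, - z.2)).
  by apply/measurable_fun_pair; meas.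
rewrite (int2E (F := fun z : R * R => F (z.1, - z.2)))//; last exact: measurableT_comp.
rewrite int2E//; apply: eq_integral => x _ /=.
rewrite -[RHS]ge0_int_opp//.
exact: (measurableT_comp mF (pair1_measurable _)).
Qed.

Lemma ge0_int2_reflect (p : R * R) F : measurable_fun setT F -> (forall z, (0 <= F z)%E) ->
  (\int[mu2]_z F (p.1 - z.1, p.2 - z.2)%R = \int[mu2]_z F z)%E.
Proof.
move=> mF F0.
rewrite -(ge0_int2_shift p mF F0) -[RHS]ge0_int2_opp//.
apply: measurableT_comp => //.
by apply/measurable_fun_pair; meas.
Qed.

End product_substitution.

(** * Isometry and covariance of the short-time Fourier transform *)

Section stft_theory.
Context {R : realType}.
Local Notation mu := (@lebesgue_measure R).
Local Notation mu2 := (mu \x mu)%E.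
Local Notation Re := complex.Re.
Local Notation Im := complex.Im.
Implicit Types (u v : R -> R) (f g h : R -> R[i]) (x y a b : R).

Lemma inL2P g : inL2 g <-> L2 mu (fun t => Re (g t)) /\ L2 mu (fun t => Im (g t)).
Proof.
split=> [[mr [mi fin]]|[[mr fr] [mi fi]]].
  have mc : measurable_fun setT (fun t => cabs2 (g t)) by rewrite /cabs2; meas.
  split; split=> //; apply: le_lt_trans fin; apply: ge0_le_integral => //.
  - by move=> t _; rewrite lee_fin sqr_ge0.
  - by meas.
  - by meas.
  - by move=> t _; rewrite lee_fin /cabs2 lerDl sqr_ge0.
  - by move=> t _; rewrite lee_fin sqr_ge0.
  - by meas.
  - by meas.
  - by move=> t _; rewrite lee_fin /cabs2 lerDr sqr_ge0.
split=> //; split=> //; rewrite /cabs2.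
under eq_integral do rewrite EFinD.
rewrite ge0_integralD//; last 4 first.
- by move=> t _; rewrite lee_fin sqr_ge0.
- by meas.
- by move=> t _; rewrite lee_fin sqr_ge0.
- by meas.
by rewrite lte_add_pinfty.
Qed.

(** The real part of [l2inner]; its imaginary part reappears below as [rip f (muli h)]. *)
Definition rip f h : R := ip mu (fun t => Re (f t)) (fun t => Re (h t)) +
  ip mu (fun t => Im (f t)) (fun t => Im (h t)).

Lemma l2norm2E g : inL2 g -> l2norm2 g = rip g g.
Proof.
move=> /inL2P[gr gi]; rewrite /l2norm2 /rip /ip /cabs2 RintegralD//.
- exact: L2_sqr_integrable.
- exact: L2_sqr_integrable.
Qed.

Definition windowed u x t := u t * gauss (t - x).

Lemma windowed_integrable u x : L2 mu u -> mu.-integrable setT (EFin \o windowed u x).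
Proof. by move=> u2; apply: L2_mul_integrable => //; exact: L2_gauss. Qed.

Lemma L2_windowed u x : L2 mu u -> L2 mu (windowed u x).
Proof.
move=> u2; have [mu_ _] := u2; apply: (L2_le _ (L2Z (gauss_c R) u2)).
  by apply: measurable_funM => //; apply: measurable_gauss_comp; meas.
move=> t; rewrite /windowed mulrC normrM [leRHS]normrM ler_wpM2r//.
by rewrite !ger0_norm ?gauss_c_ge0 ?gauss_ge0 ?gauss_le.
Qed.

Lemma stftE g x y : inL2 g -> stft g x y =
  Complex (fcos (windowed (fun t => Re (g t)) x) y + fsin (windowed (fun t => Im (g t)) x) y)
          (fcos (windowed (fun t => Im (g t)) x) y - fsin (windowed (fun t => Re (g t)) x) y).
Proof.
move=> /inL2P[gr gi]; rewrite /stft /cinteg; congr Complex.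
- rewrite /fcos /fsin -RintegralD//; last 2 first.
  + exact: fcos_integrable (windowed_integrable _ gr).
  + exact: fsin_integrable (windowed_integrable _ gi).
  apply: eq_Rintegral => t _; rewrite /windowed /cexpi cosN sinN.
  by case: (g t) => p q /=; ring.
- rewrite /fcos /fsin -RintegralB//; last 2 first.
  + exact: fcos_integrable (windowed_integrable _ gi).
  + exact: fsin_integrable (windowed_integrable _ gr).
  apply: eq_Rintegral => t _; rewrite /windowed /cexpi cosN sinN.
  by case: (g t) => p q /=; ring.
Qed.

(** |V_phi u|^2 for a real signal [u]. Realness makes it even in the frequency [y], which fails in
    general for complex signals. *)
Definition spectrogram u x y : R := fcos (windowed u x) y ^+ 2 + fsin (windowed u x) y ^+ 2.

Lemma spectrogram_ge0 u x y : 0 <= spectrogram u x y.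
Proof. by rewrite addr_ge0 ?sqr_ge0. Qed.

Lemma fcosN (k : R -> R) y : fcos k (- y) = fcos k y.
Proof. by apply: eq_Rintegral => t _; rewrite mulrN mulNr cosN. Qed.

Lemma fsinN (k : R -> R) y : mu.-integrable setT (EFin \o k) -> fsin k (- y) = - fsin k y.
Proof.
move=> ik; rewrite -[RHS]mulN1r /fsin -RintegralZl//; last exact: fsin_integrable.
by apply: eq_Rintegral => t _; rewrite mulrN mulNr sinN; ring.
Qed.

Lemma spectrogramN u x y : L2 mu u -> spectrogram u x (- y) = spectrogram u x y.
Proof.
by move=> u2; rewrite /spectrogram fcosN fsinN ?sqrrN//; exact: windowed_integrable.
Qed.

(** The cross terms between the real and the imaginary part of [g] are odd in [y] and cancel in the
    sum over [y] and [- y]. This reduces complex signals to real ones under any weight that is even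
    in [y]. *)
Lemma cabs2_stft_sym g x y : inL2 g ->
  cabs2 (stft g x y) + cabs2 (stft g x (- y)) =
  2 * (spectrogram (fun t => Re (g t)) x y + spectrogram (fun t => Im (g t)) x y).
Proof.
move=> gL; have [gr gi] := (inL2P g).1 gL.
rewrite !stftE// /cabs2 /= !fcosN !fsinN; last 2 first.
- exact: windowed_integrable.
- exact: windowed_integrable.
rewrite /spectrogram; ring.
Qed.

Lemma measurable_fcos_windowed u : measurable_fun setT u ->
  measurable_fun setT (fun z : R * R => fcos (windowed u z.1) z.2).
Proof.
move=> mu_.
apply: (measurable_Rintegral_param mu
  (F := fun w : (R * R) * R => windowed u w.1.1 w.2 * cos (2 * pi * w.1.2 * w.2))).
have m1 : measurable_fun setT (fun w : (R * R) * R => w.1.1).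
  exact: (measurableT_comp measurable_fst measurable_fst).
have m2 : measurable_fun setT (fun w : (R * R) * R => w.1.2).
  exact: (measurableT_comp measurable_snd measurable_fst).
apply: measurable_funM; last by meas.
by apply: measurable_funM; [meas|apply: measurable_gauss_comp; meas].
Qed.

Lemma measurable_fsin_windowed u : measurable_fun setT u ->
  measurable_fun setT (fun z : R * R => fsin (windowed u z.1) z.2).
Proof.
move=> mu_.
apply: (measurable_Rintegral_param mu
  (F := fun w : (R * R) * R => windowed u w.1.1 w.2 * sin (2 * pi * w.1.2 * w.2))).
have m1 : measurable_fun setT (fun w : (R * R) * R => w.1.1).
  exact: (measurableT_comp measurable_fst measurable_fst).
have m2 : measurable_fun setT (fun w : (R * R) * R => w.1.2).
  exact: (measurableT_comp measurable_snd measurable_fst).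
apply: measurable_funM; last by meas.
by apply: measurable_funM; [meas|apply: measurable_gauss_comp; meas].
Qed.

Lemma measurable_spectrogram u : measurable_fun setT u ->
  measurable_fun setT (fun z : R * R => spectrogram u z.1 z.2).
Proof.
move=> mu_; have ? := measurable_fcos_windowed mu_; have ? := measurable_fsin_windowed mu_.
by rewrite /spectrogram; meas.
Qed.

Lemma measurable_Re_stft g : inL2 g -> measurable_fun setT (fun z : R * R => Re (stft g z.1 z.2)).
Proof.
move=> gL; have [[gr _] [gi _]] := (inL2P g).1 gL.
under eq_fun do rewrite stftE//=.
by apply: measurable_funD; [exact: measurable_fcos_windowed|exact: measurable_fsin_windowed].
Qed.

Lemma measurable_Im_stft g : inL2 g -> measurable_fun setT (fun z : R * R => Im (stft g z.1 z.2)).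
Proof.
move=> gL; have [[gr _] [gi _]] := (inL2P g).1 gL.
under eq_fun do rewrite stftE//=.
by apply: measurable_funB; [exact: measurable_fcos_windowed|exact: measurable_fsin_windowed].
Qed.

Lemma measurable_cabs2_stft g : inL2 g ->
  measurable_fun setT (fun z : R * R => cabs2 (stft g z.1 z.2)).
Proof.
move=> gL; have ? := measurable_Re_stft gL; have ? := measurable_Im_stft gL.
by rewrite /cabs2; meas.
Qed.

Lemma cabs2_ge0 (z : R[i]) : 0 <= cabs2 z.
Proof. by rewrite addr_ge0 ?sqr_ge0. Qed.

(** Plancherel in [y] for each window position [x], followed by Tonelli, since the squared window
    has integral 1 in [x]. *)
Lemma spectrogram_integral u : L2 mu u ->
  (\int[mu]_x \int[mu]_y (spectrogram u x y)%:E = (ip mu u u)%:E)%E.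
Proof.
move=> u2; have [mu_ _] := u2.
transitivity (\int[mu]_x \int[mu]_t ((u t * gauss (t - x)) ^+ 2)%:E)%E.
  apply: eq_integral => x _; rewrite plancherel; last 2 first.
  - exact: windowed_integrable.
  - exact: L2_windowed.
  by rewrite -ip_sqr//; exact: L2_windowed.
rewrite (fubini_tonelli (m1 := mu) (m2 := mu) (fun z : R * R => ((u z.2 * gauss (z.2 - z.1)) ^+ 2)%:E)) /=; last 2 first.
- apply/measurable_EFinP/measurable_funX/measurable_funM; first by meas.
  by apply: measurable_gauss_comp; meas.
- by move=> z; rewrite lee_fin sqr_ge0.
rewrite -ip_sqr//; apply: eq_integral => t _.
under eq_integral do rewrite exprMn EFinM.
rewrite ge0_integralZl_EFin ?sqr_ge0//.
- by rewrite gauss_reflect_sqr_integral mule1.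
- by move=> x _; rewrite lee_fin sqr_ge0.
- by apply/measurable_EFinP/measurable_funX/measurable_gauss_comp; meas.
Qed.

Lemma stft_even_integral (w : R * R -> R) g : inL2 g -> measurable_fun setT w ->
  (forall z, 0 <= w z) -> (forall x y, w (x, - y) = w (x, y)) ->
  (\int[mu2]_z (w z * cabs2 (stft g z.1 z.2))%:E =
   \int[mu2]_z (w z * spectrogram (fun t => Re (g t)) z.1 z.2)%:E +
   \int[mu2]_z (w z * spectrogram (fun t => Im (g t)) z.1 z.2)%:E)%E.
Proof.
move=> gL mw w0 we; have [[mr _] [mi _]] := (inL2P g).1 gL.
have mG := measurable_cabs2_stft gL.
have msr := measurable_spectrogram mr; have msi := measurable_spectrogram mi.
have F0 z : (0 <= (w z * cabs2 (stft g z.1 z.2))%:E)%E by rewrite lee_fin mulr_ge0 ?cabs2_ge0.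
have mF : measurable_fun setT (fun z => (w z * cabs2 (stft g z.1 z.2))%:E).
  by apply/measurable_EFinP; exact: measurable_funM.
have mA : measurable_fun setT (fun z => (w z * spectrogram (fun t => Re (g t)) z.1 z.2)%:E).
  by apply/measurable_EFinP; exact: measurable_funM.
have mB : measurable_fun setT (fun z => (w z * spectrogram (fun t => Im (g t)) z.1 z.2)%:E).
  by apply/measurable_EFinP; exact: measurable_funM.
have A0 z : (0 <= (w z * spectrogram (fun t => Re (g t)) z.1 z.2)%:E)%E.
  by rewrite lee_fin mulr_ge0 ?spectrogram_ge0.
have B0 z : (0 <= (w z * spectrogram (fun t => Im (g t)) z.1 z.2)%:E)%E.
  by rewrite lee_fin mulr_ge0 ?spectrogram_ge0.
rewrite -ge0_integralD//.
set I := LHS; set J := RHS.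
(* Either side may be infinite. Hence the symmetrization is stated in doubled form, and the factor 2
   is cancelled case by case. *)
have I2 : (I + I = 2%:E * J)%E.
  rewrite {2}/I -(ge0_int2_oppr mF F0) -ge0_integralD//; last first.
    apply: (measurableT_comp mF); apply/measurable_fun_pair; meas.
  rewrite -ge0_integralZl//; last 2 first.
  - exact: emeasurable_funD.
  - by move=> z _; rewrite adde_ge0.
  apply: eq_integral => z _; rewrite -!EFinD -EFinM; congr EFin => /=.
  rewrite (_ : w (z.1, - z.2) = w z); last by case: z => x y; rewrite we.
  by rewrite -mulrDr cabs2_stft_sym//; ring.
have I0 : (0 <= I)%E by apply: integral_ge0.
have J0 : (0 <= J)%E by apply: integral_ge0 => z _; rewrite adde_ge0.
move: I0 J0 I2; case: I => [i| |]//; case: J => [j| |]//= i0 j0.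
- by rewrite -EFinM => -[ij]; congr EFin; lra.
- by rewrite gt0_muley ?lte_fin.
Qed.

Theorem stft_isometry g : inL2 g ->
  (\int[mu2]_z (cabs2 (stft g z.1 z.2))%:E = (rip g g)%:E)%E.
Proof.
move=> gL; have [gr gi] := (inL2P g).1 gL.
have E u : L2 mu u -> (\int[mu2]_z (1 * spectrogram u z.1 z.2)%:E = (ip mu u u)%:E)%E.
  move=> u2; rewrite -spectrogram_integral//.
  rewrite (int2E (F := fun z : R * R => (1 * spectrogram u z.1 z.2)%:E)).
  - by under eq_integral do under eq_integral do rewrite mul1r.
  - apply/measurable_EFinP/measurable_funM => //; apply: measurable_spectrogram.
    by case: u2.
  - by move=> z; rewrite mul1r lee_fin spectrogram_ge0.
have := @stft_even_integral (fun=> 1) g gL (measurable_cst _) (fun=> ler01) (fun _ _ => erefl).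
rewrite (E _ gr) (E _ gi) -EFinD => <-.
by apply: eq_integral => z _; rewrite mul1r.
Qed.

Lemma stft_isometry_shift g (p : R * R) : inL2 g ->
  (\int[mu2]_z (cabs2 (stft g (p.1 + z.1) (p.2 + z.2)))%:E = (rip g g)%:E)%E.
Proof.
move=> gL; etransitivity; last exact: (stft_isometry gL).
rewrite (ge0_int2_shift p (F := fun z => (cabs2 (stft g z.1 z.2))%:E))//.
- by apply/measurable_EFinP; exact: (measurable_cabs2_stft gL).
- by move=> z; rewrite lee_fin cabs2_ge0.
Qed.

Lemma stft_isometry_reflect g (p : R * R) : inL2 g ->
  (\int[mu2]_z (cabs2 (stft g (p.1 - z.1) (p.2 - z.2)))%:E = (rip g g)%:E)%E.
Proof.
move=> gL; etransitivity; last exact: (stft_isometry gL).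
rewrite (ge0_int2_reflect p (F := fun z => (cabs2 (stft g z.1 z.2))%:E))//.
- by apply/measurable_EFinP; exact: (measurable_cabs2_stft gL).
- by move=> z; rewrite lee_fin cabs2_ge0.
Qed.

Lemma cexpiD (x y : R) : cexpi (x + y) = cexpi x * cexpi y.
Proof.
rewrite /cexpi cosD sinD; apply/eqP; rewrite eq_complex /=.
by apply/andP; split; apply/eqP; ring.
Qed.

Lemma cabs2M (z w : R[i]) : cabs2 (z * w) = cabs2 z * cabs2 w.
Proof. by case: z w => a b [c d]; rewrite /cabs2/=; ring. Qed.

Lemma cabs2_cexpi (x : R) : cabs2 (cexpi x) = 1.
Proof. by rewrite /cabs2/= cos2Dsin2. Qed.

Lemma inL2_unimodular (w : R -> R[i]) g :
  measurable_fun setT (fun t => Re (w t)) -> measurable_fun setT (fun t => Im (w t)) ->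
  (forall t, cabs2 (w t) = 1) -> inL2 g -> inL2 (fun t => w t * g t).
Proof.
move=> mwr mwi w1 [mr [mi fin]].
have ER : (fun t => Re (w t * g t)) = fun t => Re (w t) * Re (g t) - Im (w t) * Im (g t).
  by apply/funext => t; case: (w t) => ? ?; case: (g t).
have EI : (fun t => Im (w t * g t)) = fun t => Re (w t) * Im (g t) + Im (w t) * Re (g t).
  by apply/funext => t; case: (w t) => ? ?; case: (g t) => ? ? /=; ring.
split; first by rewrite ER; meas.
split; first by rewrite EI; meas.
by under eq_integral do rewrite cabs2M w1 mul1r.
Qed.

Lemma inL2_tfshift a b g : inL2 g -> inL2 (tfshift a b g).
Proof.
move=> [mr [mi fin]]; apply: inL2_unimodular.
- by rewrite /=; meas.
- by rewrite /=; meas.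
- by move=> t; exact: cabs2_cexpi.
split; first by apply: (measurableT_comp mr); meas.
split; first by apply: (measurableT_comp mi); meas.
have mg : measurable_fun setT (fun t => cabs2 (g t)) by rewrite /cabs2; meas.
rewrite -(ge0_int_shift (- a)) in fin; last 2 first.
- exact/measurable_EFinP.
- by move=> t; rewrite lee_fin cabs2_ge0.
by apply: le_lt_trans fin; rewrite le_eqVlt; apply/orP; left; apply/eqP;
  apply: eq_integral => t _; rewrite addrC.
Qed.

Lemma cinteg_shift f a : measurable_fun setT (fun t => Re (f t)) ->
  measurable_fun setT (fun t => Im (f t)) -> cinteg (fun t => f (a + t)) = cinteg f.
Proof.
move=> mr mi; rewrite /cinteg; congr Complex.
- exact: (Rint_shift a mr).
- exact: (Rint_shift a mi).
Qed.

Lemma cinteg_mul (c : R[i]) f : mu.-integrable setT (EFin \o (fun t => Re (f t))) ->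
  mu.-integrable setT (EFin \o (fun t => Im (f t))) ->
  cinteg (fun t => c * f t) = c * cinteg f.
Proof.
move=> ir ii; case: c => p q; rewrite /cinteg; congr Complex; rewrite /=.
- rewrite -!RintegralZl// -RintegralB//; [|exact: L1Z|exact: L1Z].
  by apply: eq_Rintegral => t _; case: (f t).
- rewrite -!RintegralZl// -RintegralD//; [|exact: L1Z|exact: L1Z].
  by apply: eq_Rintegral => t _; case: (f t) => ? ? /=; ring.
Qed.

(** Substitute [a + t] for [t] and collect the exponentials; the phase left over has modulus 1 and
    disappears from [cabs2]. *)
Lemma stft_tfshift a b g x y : inL2 g ->
  stft (tfshift a b g) x y = cexpi (2 * pi * (b - y) * a) * stft g (x - a) (y - b).
Proof.
move=> gL; have [gr gi] := (inL2P g).1 gL; have [mr _] := gr; have [mi _] := gi.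
have tL := inL2_tfshift a b gL; have [tmr [tmi _]] := tL.
have mga : measurable_fun setT (fun t : R => gauss (t - x)) by apply: measurable_gauss_comp; meas.
rewrite /stft -cinteg_mul; last 2 first.
- rewrite (_ : (fun t => _) = fun t => windowed (fun t => Re (g t)) (x - a) t * cos (2 * pi * (y - b) * t)
     + windowed (fun t => Im (g t)) (x - a) t * sin (2 * pi * (y - b) * t)).
    by apply: L1D; [exact: fcos_integrable (windowed_integrable _ gr)|exact: fsin_integrable (windowed_integrable _ gi)].
  by apply/funext => t; rewrite /windowed /cexpi cosN sinN; case: (g t) => p q /=; ring.
- rewrite (_ : (fun t => _) = fun t => windowed (fun t => Im (g t)) (x - a) t * cos (2 * pi * (y - b) * t)
     + (-1) * (windowed (fun t => Re (g t)) (x - a) t * sin (2 * pi * (y - b) * t))).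
    apply: L1D; first exact: fcos_integrable (windowed_integrable _ gi).
    by apply: L1Z; exact: fsin_integrable (windowed_integrable _ gr).
  by apply/funext => t; rewrite /windowed /cexpi cosN sinN; case: (g t) => p q /=; ring.
rewrite -(@cinteg_shift _ a).
- congr cinteg; apply/funext => t; rewrite /tfshift.
  rewrite (_ : a + t - a = t); last by ring.
  rewrite (_ : a + t - x = t - (x - a)); last by ring.
  rewrite (_ : 2 * pi * b * (a + t) = 2 * pi * (b - y) * a + (2 * pi * y * (a + t) + - (2 * pi * (y - b) * t))); last by ring.
  rewrite !cexpiD.
  have : cexpi (2 * pi * y * (a + t)) * cexpi (- (2 * pi * y * (a + t))) = 1.
    by rewrite -cexpiD subrr /cexpi cos0 sin0.
  move: (cexpi (2 * pi * (b - y) * a)) (cexpi (2 * pi * y * (a + t)))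
    (cexpi (- (2 * pi * y * (a + t)))) (cexpi (- (2 * pi * (y - b) * t)))
    (g t) (Complex _ 0) => e1 e2 e2' e3 gt P e22.
  have -> : e1 * (e2 * e3) * gt * P * e2' = e1 * (gt * P * e3) * (e2 * e2') by ring.
  by rewrite e22 mulr1.
- rewrite (_ : (fun t => _) = fun t => Re (tfshift a b g t) * gauss (t - x) * cos (2 * pi * y * t)
     + Im (tfshift a b g t) * gauss (t - x) * sin (2 * pi * y * t)); first by meas.
  by apply/funext => t; rewrite /cexpi cosN sinN; case: (tfshift a b g t) => p q /=; ring.
- rewrite (_ : (fun t => _) = fun t => Im (tfshift a b g t) * gauss (t - x) * cos (2 * pi * y * t)
     - Re (tfshift a b g t) * gauss (t - x) * sin (2 * pi * y * t)); first by meas.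
  by apply/funext => t; rewrite /cexpi cosN sinN; case: (tfshift a b g t) => p q /=; ring.
Qed.

Lemma cabs2_stft_tfshift a b g x y : inL2 g ->
  cabs2 (stft (tfshift a b g) x y) = cabs2 (stft g (x - a) (y - b)).
Proof. by move=> gL; rewrite stft_tfshift// cabs2M cabs2_cexpi mul1r. Qed.

End stft_theory.

(** * A local mean value inequality *)

Section cauchy_kernel.
Context {R : realType}.
Local Notation mu := (@lebesgue_measure R).
Local Notation L1 k := (mu.-integrable setT (EFin \o k)).
Implicit Types p w : R.

Definition unit_window w : R := \1_(`[-1, 1] : set R) w.

Lemma unit_windowE w : unit_window w = (-1 <= w <= 1)%R%:R.
Proof.
rewrite /unit_window indicE; congr (nat_of_bool _)%:R.
by apply/idP/idP; rewrite inE /= in_itv.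
Qed.

Lemma measurable_unit_window : measurable_fun setT unit_window.
Proof. by apply: measurable_indic; exact: measurable_itv. Qed.

Lemma unit_window_integrable : L1 unit_window.
Proof. exact: integrable_indic_itv. Qed.

Lemma unit_window_integral : \int[mu]_w unit_window w = 2.
Proof.
rewrite /Rintegral (_ : (\int[mu]_x _)%E = mu (`[-1, 1] : set R)); last first.
  by rewrite /unit_window integral_indic//= setIT.
have h : -1 < 1 :> R by lra.
by rewrite lebesgue_measure_itv/= lte_fin h /=; ring.
Qed.

Variable q : R.
Hypothesis q0 : 0 < q.

(* The parametrized integral of e^(p zeta) d zeta / (i zeta) along the boundary of the rectangle
   with vertices +-1 +- i q: the first two summands are the vertical sides, the third one is
   both horizontal sides.  Its integral over [-1, 1] therefore does not depend on p. *)
Definition cauchy_kernel p w : R :=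
  q * expR p * (cos (q * p * w) + q * w * sin (q * p * w)) * (1 + (q * w) ^+ 2)^-1 +
  q * expR (- p) * (cos (q * p * w) - q * w * sin (q * p * w)) * (1 + (q * w) ^+ 2)^-1 +
  2 * expR (p * w) * (q * cos (q * p) - w * sin (q * p)) * (q ^+ 2 + w ^+ 2)^-1.

(** The derivative in [p] of e^(p zeta) / zeta is e^(p zeta): the denominators disappear, and what
    remains is a contour integral of an entire function. *)
Definition dcauchy_kernel p w : R :=
  q * (expR p - expR (- p)) * cos (q * p * w) - 2 * expR (p * w) * sin (q * p).

Let d1 w : 0 < 1 + (q * w) ^+ 2. Proof. by rewrite ltr_pwDl// sqr_ge0. Qed.
Let d2 w : 0 < q ^+ 2 + w ^+ 2. Proof. by rewrite ltr_pwDl ?exprn_gt0// sqr_ge0. Qed.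

Lemma is_derive_cauchy_kernel p w :
  is_derive p (1 : R) (cauchy_kernel^~ w) (dcauchy_kernel p w).
Proof.
rewrite /cauchy_kernel; apply: is_derive_eq.
rewrite /GRing.scale/= /dcauchy_kernel; field.
by rewrite !gt_eqF ?d1 ?d2.
Qed.

Lemma measurable_cauchy_kernel : measurable_fun setT (fun z : R * R => cauchy_kernel z.1 z.2).
Proof.
have h1 : measurable_fun setT (fun z : R * R => (1 + (q * z.2) ^+ 2)^-1).
  by apply: measurable_inv_sqr_comp => //; meas.
have h2 : measurable_fun setT (fun z : R * R => (q ^+ 2 + z.2 ^+ 2)^-1).
  by apply: measurable_inv_sqr_comp; [exact: exprn_gt0|meas].
rewrite /cauchy_kernel; apply: measurable_funD; first apply: measurable_funD.
- by apply: measurable_funM => //; meas.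
- by apply: measurable_funM => //; meas.
- by apply: measurable_funM => //; meas.
Qed.

Let norm_cos (x : R) : `|cos x| <= 1. Proof. exact: norm_cos_le1. Qed.
Let norm_sin (x : R) : `|sin x| <= 1. Proof. exact: norm_sin_le1. Qed.

Definition kernel_bound := 2 * q * (1 + q) + 2 * (q + 1) * (q ^+ 2)^-1.

Lemma kernel_bound_ge0 : 0 <= kernel_bound.
Proof.
have := ltW q0 => q0'.
by rewrite addr_ge0// !mulr_ge0 ?addr_ge0 ?invr_ge0 ?sqr_ge0.
Qed.

Lemma cauchy_kernel_le p w : -1 <= w <= 1 ->
  `|cauchy_kernel p w| <= kernel_bound * expR `|p|.
Proof.
rewrite -ler_norml => w1; have q0' := ltW q0.
have e1 : expR p <= expR `|p| by rewrite ler_expR ler_norm.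
have e2 : expR (- p) <= expR `|p| by rewrite ler_expR ler_normr lexx orbT.
have e3 : expR (p * w) <= expR `|p|.
  by rewrite ler_expR (le_trans (ler_norm _))// normrM ler_piMr.
have i1 : `|(1 + (q * w) ^+ 2)^-1| <= 1.
  by rewrite ger0_norm ?invr_ge0 ?(ltW (d1 w))// invf_le1 ?d1// lerDl sqr_ge0.
have i2 : `|(q ^+ 2 + w ^+ 2)^-1| <= (q ^+ 2)^-1.
  rewrite ger0_norm ?invr_ge0 ?(ltW (d2 w))//.
  by rewrite lef_pV2 ?posrE ?exprn_gt0 ?d2// lerDl sqr_ge0.
have t1 : `|cos (q * p * w) + q * w * sin (q * p * w)| <= 1 + q.
  rewrite (le_trans (ler_normD _ _))// lerD// !normrM (ger0_norm q0').
  by rewrite -[leRHS]mulr1 -mulrA ler_wpM2l// -[leRHS]mulr1 ler_pM.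
have t2 : `|cos (q * p * w) - q * w * sin (q * p * w)| <= 1 + q.
  rewrite (le_trans (ler_normB _ _))// lerD// !normrM (ger0_norm q0').
  by rewrite -[leRHS]mulr1 -mulrA ler_wpM2l// -[leRHS]mulr1 ler_pM.
have t3 : `|q * cos (q * p) - w * sin (q * p)| <= q + 1.
  rewrite (le_trans (ler_normB _ _))// lerD// normrM ?(ger0_norm q0').
    by rewrite ler_piMr.
  by rewrite -[leRHS]mulr1 ler_pM.
have -> : kernel_bound * expR `|p| = q * expR `|p| * (1 + q) * 1 +
    q * expR `|p| * (1 + q) * 1 + 2 * expR `|p| * (q + 1) * (q ^+ 2)^-1.
  by rewrite /kernel_bound; ring.
have E0 := expR_ge0.
rewrite (le_trans (ler_normD _ _))// lerD//.
  rewrite (le_trans (ler_normD _ _))// lerD//.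
    rewrite !normrM (ger0_norm q0') (ger0_norm (E0 _ _)).
    by rewrite !ler_pM ?mulr_ge0// ?normr_ge0.
  rewrite !normrM (ger0_norm q0') (ger0_norm (E0 _ _)).
  by rewrite !ler_pM ?mulr_ge0// ?normr_ge0.
rewrite !normrM (ger0_norm (E0 _ _)) (ger0_norm (ler0n _ 2)).
by rewrite !ler_pM ?mulr_ge0// ?normr_ge0.
Qed.

Lemma cauchy_kernel_integrable p : L1 (fun w => cauchy_kernel p w * unit_window w).
Proof.
apply: (@le_integrable _ _ _ mu setT measurableT _
  (fun w => (kernel_bound * expR `|p| * unit_window w)%:E)).
- apply/measurable_EFinP/measurable_funM; last exact: measurable_unit_window.
  exact: (measurableT_comp measurable_cauchy_kernel (pair1_measurable p)).
- move=> w _; rewrite /= lee_fin [leRHS]ger0_norm; last first.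
    by rewrite mulr_ge0 ?mulr_ge0 ?kernel_bound_ge0 ?expR_ge0// unit_windowE.
  rewrite unit_windowE; case: (boolP (_ <= _ <= _)) => h; last by rewrite !mulr0 normr0.
  by rewrite !mulr1 cauchy_kernel_le.
- by apply: L1Z; exact: unit_window_integrable.
Qed.

Definition kernel_mass p := \int[mu]_w (cauchy_kernel p w * unit_window w).

(** Cauchy's theorem for e^(p zeta) on the rectangle, checked with an explicit primitive in [w]. The
    primitive divides by [p], so p = 0 is treated apart. *)
Let dcker_int0 p : \int[mu]_w (dcauchy_kernel p w * unit_window w) = 0.
Proof.
have -> : \int[mu]_w (dcauchy_kernel p w * unit_window w) =
    \int[mu]_(w in `[(-1)%R, 1%R]) dcauchy_kernel p w.
  rewrite [RHS]Rintegral_mkcond; apply: eq_Rintegral => w _.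
  by rewrite /patch unit_windowE mem_setE in_itv/=; case: (_ && _); rewrite ?mulr1 ?mulr0.
have [->|p0] := eqVneq p 0.
  transitivity (\int[mu]_(w in `[(-1)%R, 1%R]) (0 : R)); last by rewrite Rintegral_cst ?mul0r.
  apply: eq_Rintegral.
  by move=> w _; rewrite /dcauchy_kernel !mulr0 oppr0 subrr sin0 !mulr0 mul0r subr0.
pose F w := (expR p - expR (- p)) * sin (q * p * w) / p - 2 * expR (p * w) * sin (q * p) / p.
have dF (w : R) : is_derive w (1 : R) F (dcauchy_kernel p w).
  rewrite /F; apply: is_derive_eq; rewrite /GRing.scale/= /dcauchy_kernel; field.
  exact: p0.
have cF : continuous F.
  by move=> w; apply: differentiable_continuous; apply/derivable1_diffP.
rewrite /Rintegral (@continuous_FTC2 R _ F); first last.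
- by move=> w _; rewrite derive1E; exact: derive_val.
- split; first by move=> w _.
  + by apply: cvg_at_right_filter; exact: cF.
  + by apply: cvg_at_left_filter; exact: cF.
- apply: continuous_subspaceT => w.
  have dD : derivable (dcauchy_kernel p) w 1 by rewrite /dcauchy_kernel.
  by apply: differentiable_continuous; apply/derivable1_diffP.
- exact: (lt_trans (ltrN10 R) ltr01).
rewrite /= /F !mulr1 !mulrN1 sinN; field.
exact: p0.
Qed.

(** This replaces Cauchy's formula: instead of a residue, the mass is differentiated in [p] under
    the integral sign, and the derivative vanishes by [dcker_int0]. *)
Lemma kernel_mass_cst p : kernel_mass p = kernel_mass 0.
Proof.
apply: (@is_derive_0_is_cst R kernel_mass) => a.
pose f p w := cauchy_kernel p w * unit_window w.
have fd x w : is_derive x (1 : R) (f^~ w) (dcauchy_kernel x w * unit_window w).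
  have ? := is_derive_cauchy_kernel x w.
  by rewrite /f; apply: is_derive_eq; rewrite /GRing.scale/= mulr0 add0r mulrC.
have fd1 x w : partial1of2 f x w = dcauchy_kernel x w * unit_window w.
  by rewrite partial1of2E; have ? := fd x w; exact: derive_val.
(* For parameters in ]a - 1, a + 1[ every exponent is at most |a| + 1, which makes the majorant of
   the derivative uniform. *)
pose C := q * (expR (`|a| + 1) + expR (`|a| + 1)) + 2 * expR (`|a| + 1).
have q0' := ltW q0.
have C0 : 0 <= C by rewrite addr_ge0// ?mulr_ge0 ?addr_ge0 ?expR_ge0.
have aI : `]a - 1, a + 1[%classic a by rewrite /= in_itv/=; apply/andP; lra.
have G0 w : 0 <= C * unit_window w by rewrite mulr_ge0// unit_windowE.
have iG : L1 (fun w => C * unit_window w) by apply: L1Z; exact: unit_window_integrable.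
have Gub x w : `]a - 1, a + 1[%classic x -> setT w -> `|partial1of2 f x w| <= C * unit_window w.
  rewrite /= in_itv/= => /andP[x1 x2] _; rewrite fd1 unit_windowE.
  case: (boolP (_ <= _ <= _)) => h; last by rewrite !mulr0 normr0.
  rewrite !mulr1 /dcauchy_kernel /C; rewrite -ler_norml in h.
  have xa : `|x| <= `|a| + 1.
    rewrite (_ : x = a + (x - a)); last by ring.
    by rewrite (le_trans (ler_normD _ _))// lerD2l ler_norml; apply/andP; lra.
  have e1 : expR x <= expR (`|a| + 1) by rewrite ler_expR (le_trans (ler_norm _)).
  have e2 : expR (- x) <= expR (`|a| + 1) by rewrite ler_expR (le_trans (ler_norm _))// normrN.
  have e3 : expR (x * w) <= expR (`|a| + 1).
    by rewrite ler_expR (le_trans (ler_norm _))// normrM (le_trans _ xa)// ler_piMr.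
  have E0 := @expR_ge0 R.
  rewrite (le_trans (ler_normB _ _))// lerD//.
    rewrite !normrM (ger0_norm q0') -[leRHS]mulr1 ler_pM ?mulr_ge0//.
    rewrite ler_wpM2l//; apply: (le_trans (ler_normB _ _)); by apply: lerD; rewrite ger0_norm.
  rewrite !normrM (ger0_norm (E0 _)) (ger0_norm (ler0n _ 2)) -[leRHS]mulr1 ler_pM ?mulr_ge0//.
  by rewrite ler_wpM2l.
have der x w : `]a - 1, a + 1[%classic x -> setT w -> derivable (f^~ w) x 1.
  by move=> _ _; have [] := fd x w.
have fi x : `]a - 1, a + 1[%classic x -> L1 (f x) by move=> _; exact: cauchy_kernel_integrable.
have D := derivable_under_integral measurableT aI fi der G0 iG Gub.
have V := differentiation_under_integral measurableT aI fi der G0 iG Gub.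
apply: DeriveDef; first exact: D.
rewrite -derive1E V -[RHS](dcker_int0 a).
by apply: eq_Rintegral => w _; rewrite fd1.
Qed.

(** At p = 0 the kernel is 2q / (1 + (q w)^2) plus a nonnegative term, hence at least 2q / (1 + q^2)
    on [-1, 1]. Only positivity of the mass is used later. *)
Lemma kernel_mass_gt0 : 0 < kernel_mass 0.
Proof.
have q0' := ltW q0.
pose c := 2 * q * (1 + q ^+ 2)^-1.
have c0 : 0 < c by rewrite !mulr_gt0// invr_gt0 ltr_pwDl// sqr_ge0.
apply: (@lt_le_trans _ _ (c * 2)); first by rewrite mulr_gt0.
rewrite -unit_window_integral -RintegralZl//; last exact: unit_window_integrable.
rewrite /kernel_mass; apply: le_Rintegral => //.
- by apply: L1Z; exact: unit_window_integrable.
- exact: (cauchy_kernel_integrable 0).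
move=> w _; rewrite unit_windowE; case: (boolP (_ <= _ <= _)) => h; last by rewrite !mulr0.
rewrite !mulr1 /cauchy_kernel !(mulr0, mul0r, oppr0) expR0 cos0 sin0 !(mulr0, mulr1, mul0r, subr0, addr0).
have w2 : w ^+ 2 <= 1 by rewrite -real_normK ?num_real// expr_le1// ler_norml.
apply: (@le_trans _ _ (q * (1 + (q * w) ^+ 2)^-1 + q * (1 + (q * w) ^+ 2)^-1)); last first.
  by rewrite lerDl !mulr_ge0// invr_ge0 ltW.
have -> : c = q * (1 + q ^+ 2)^-1 + q * (1 + q ^+ 2)^-1 by rewrite /c; ring.
have h1 : (1 + q ^+ 2)^-1 <= (1 + (q * w) ^+ 2)^-1.
  rewrite lef_pV2 ?posrE ?d1//; last by rewrite ltr_pwDl// sqr_ge0.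
  by rewrite lerD2l exprMn ler_piMr ?sqr_ge0.
by rewrite lerD// ler_wpM2l.
Qed.

End cauchy_kernel.

(** * From the boundary of a square to the mean value inequality *)

Section local_estimate.
Context {R : realType}.
Local Notation mu := (@lebesgue_measure R).
Local Notation mu2 := (mu \x mu)%E.
Local Notation L1 k := (mu.-integrable setT (EFin \o k)).
Local Notation Re := complex.Re.
Local Notation Im := complex.Im.
Implicit Types (u : R -> R) (s w x y rho : R).

Local Notation fc u x y := (fcos (windowed u x) y).
Local Notation fs u x y := (fsin (windowed u x) y).

(** Completing the square. This is what turns the exponentials of [cauchy_kernel] into displaced
    windows. *)
Lemma gauss_expR (t s : R) : gauss (t - 0) * expR (2 * t * s) = expR (s ^+ 2) * gauss (t - s).
Proof.
rewrite /gauss subr0 -mulrA -expRD [RHS]mulrCA -expRD; congr (_ * expR _); ring.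
Qed.

Lemma Rint_linD (a : R) (f h : R -> R) : L1 f -> L1 h ->
  \int[mu]_t (a * f t + h t) = a * \int[mu]_t f t + \int[mu]_t h t.
Proof. by move=> fi hi; rewrite RintegralD ?RintegralZl//; exact: L1Z. Qed.

(** The kernel at p = 2ts with q = pi, integrated against the windowed signal. The vertical sides of
    the rectangle become the time-frequency points (s, sw) and (-s, sw), the horizontal sides the
    points (sw, s) and (sw, -s). The choice q = pi matches pi * 2ts * w with 2 pi (sw) t, so that
    these points run through the boundary of a square. *)
Definition kernel_pairing u s w : R :=
  pi * expR (s ^+ 2) * (1 + (pi * w) ^+ 2)^-1 * fc u s (s * w) +
  (pi * expR (s ^+ 2) * (pi * w) * (1 + (pi * w) ^+ 2)^-1 * fs u s (s * w) +
  (pi * expR (s ^+ 2) * (1 + (pi * w) ^+ 2)^-1 * fc u (- s) (s * w) +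
  (- (pi * expR (s ^+ 2) * (pi * w) * (1 + (pi * w) ^+ 2)^-1) * fs u (- s) (s * w) +
  (2 * expR ((s * w) ^+ 2) * pi * (pi ^+ 2 + w ^+ 2)^-1 * fc u (s * w) s +
   - (2 * expR ((s * w) ^+ 2) * w * (pi ^+ 2 + w ^+ 2)^-1) * fs u (s * w) s)))).

Lemma kernel_pairingE u s w : L2 mu u ->
  \int[mu]_t (windowed u 0 t * cauchy_kernel pi (2 * t * s) w) = kernel_pairing u s w.
Proof.
move=> u2.
have Lc x y : L1 (fun t => windowed u x t * cos (2 * pi * y * t)).
  by apply: fcos_integrable; exact: windowed_integrable.
have Ls x y : L1 (fun t => windowed u x t * sin (2 * pi * y * t)).
  by apply: fsin_integrable; exact: windowed_integrable.
rewrite /kernel_pairing /fcos /fsin.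
rewrite -[X in _ + (_ + (_ + (_ + (_ + X))))]RintegralZl//.
rewrite -!Rint_linD//; last first.
- by apply: L1Z.
- by apply: L1D; apply: L1Z.
- by apply: L1D; [apply: L1Z|apply: L1D; apply: L1Z].
- by apply: L1D; [apply: L1Z|apply: L1D; [apply: L1Z|apply: L1D; apply: L1Z]].
- by apply: L1D; [apply: L1Z|apply: L1D; [apply: L1Z|apply: L1D; [apply: L1Z|apply: L1D; apply: L1Z]]].
apply: eq_Rintegral => t _; rewrite /windowed /cauchy_kernel.
have e1 := gauss_expR t s.
have e2 : gauss (t - 0) * expR (- (2 * t * s)) = expR (s ^+ 2) * gauss (t - - s).
  by rewrite -(sqrrN s) -gauss_expR mulrN.
have e3 : gauss (t - 0) * expR (2 * t * s * w) = expR ((s * w) ^+ 2) * gauss (t - s * w).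
  by rewrite -gauss_expR mulrA.
rewrite (_ : 2 * pi * (s * w) * t = pi * (2 * t * s) * w); last by ring.
rewrite (_ : 2 * pi * s * t = pi * (2 * t * s)); last by ring.
move: e1 e2 e3.
move: (gauss (t - 0)) (gauss (t - s)) (gauss (t - - s)) (gauss (t - s * w)).
move: (expR (2 * t * s)) (expR (- (2 * t * s))) (expR (2 * t * s * w)) (expR (s ^+ 2)) (expR ((s * w) ^+ 2)).
move: (cos (pi * (2 * t * s) * w)) (sin (pi * (2 * t * s) * w)) (cos (pi * (2 * t * s))) (sin (pi * (2 * t * s))).
move: (1 + (pi * w) ^+ 2)^-1 (pi ^+ 2 + w ^+ 2)^-1 => i1 i2 c1 s1 c2 s2 E1 E2 E3 F1 F2 G0 G1 G2 G3 e1 e2 e3.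
move: (u t) (@pi R) => ut q.
have -> : ut * G0 * (q * E1 * (c1 + q * w * s1) * i1 + q * E2 * (c1 - q * w * s1) * i1 +
    2 * E3 * (q * c2 - w * s2) * i2) =
  ut * (q * (c1 + q * w * s1) * i1) * (G0 * E1) + ut * (q * (c1 - q * w * s1) * i1) * (G0 * E2) +
  ut * (2 * (q * c2 - w * s2) * i2) * (G0 * E3) by ring.
rewrite e1 e2 e3; ring.
Qed.

Lemma sqr_lin2_le (a b x y M : R) : `|a| <= M -> `|b| <= M ->
  (a * x + b * y) ^+ 2 <= 2 * M ^+ 2 * (x ^+ 2 + y ^+ 2).
Proof.
move=> aM bM; have M0 : 0 <= M by apply: le_trans aM.
have a2 : a ^+ 2 <= M ^+ 2 by rewrite -real_normK ?num_real// lerXn2r ?nnegrE.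
have b2 : b ^+ 2 <= M ^+ 2 by rewrite -real_normK ?num_real// lerXn2r ?nnegrE.
apply: (@le_trans _ _ (2 * ((a * x) ^+ 2 + (b * y) ^+ 2))).
  by have := sqr_ge0 (a * x - b * y); nra.
rewrite -mulrA ler_wpM2l// mulrDr !exprMn lerD// ler_wpM2r// sqr_ge0//.
Qed.

Lemma sqr_sum3_le (a b c : R) : (a + b + c) ^+ 2 <= 3 * (a ^+ 2 + b ^+ 2 + c ^+ 2).
Proof.
by have := sqr_ge0 (a - b); have := sqr_ge0 (b - c); have := sqr_ge0 (a - c); nra.
Qed.

Lemma sqr_lin6_le (a1 a2 a3 a4 a5 a6 M x1 x2 x3 x4 x5 x6 : R) :
  `|a1| <= M -> `|a2| <= M -> `|a3| <= M -> `|a4| <= M -> `|a5| <= M -> `|a6| <= M ->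
  (a1 * x1 + (a2 * x2 + (a3 * x3 + (a4 * x4 + (a5 * x5 + a6 * x6))))) ^+ 2 <=
  6 * M ^+ 2 * (x1 ^+ 2 + x2 ^+ 2 + (x3 ^+ 2 + x4 ^+ 2) + (x5 ^+ 2 + x6 ^+ 2)).
Proof.
move=> h1 h2 h3 h4 h5 h6.
have := sqr_lin2_le x1 x2 h1 h2; have := sqr_lin2_le x3 x4 h3 h4; have := sqr_lin2_le x5 x6 h5 h6.
have := sqr_sum3_le (a1 * x1 + a2 * x2) (a3 * x3 + a4 * x4) (a5 * x5 + a6 * x6).
rewrite !addrA; move: (a1 * x1) (a2 * x2) (a3 * x3) (a4 * x4) (a5 * x5) (a6 * x6).
move: (x1 ^+ 2) (x2 ^+ 2) (x3 ^+ 2) (x4 ^+ 2) (x5 ^+ 2) (x6 ^+ 2) (M ^+ 2) => *.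
lra.
Qed.

Lemma pi_ge1 : 1 <= pi :> R.
Proof. by apply: le_trans (pi_ge2 R); rewrite ler1n. Qed.

(** A common bound for the six coefficients of [kernel_pairing] when 0 <= s <= 1 and |w| <= 1. *)
Definition pairing_bound : R := 2 * pi * expR 1.

Lemma kernel_pairing_sqr_le u s w : 0 <= s <= 1 -> -1 <= w <= 1 ->
  kernel_pairing u s w ^+ 2 <= 6 * pairing_bound ^+ 2 *
    (spectrogram u s (s * w) + spectrogram u (- s) (s * w) + spectrogram u (s * w) s).
Proof.
move=> /andP[s0 s1]; rewrite -ler_norml => w1.
set M := pairing_bound.
have p1 := pi_ge1; have p0 : 0 <= pi :> R by lra.
have E0 := @expR_ge0 R.
have es : expR (s ^+ 2) <= expR 1 by rewrite ler_expR expr_le1.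
have ew : expR ((s * w) ^+ 2) <= expR 1.
  rewrite ler_expR -real_normK ?num_real// expr_le1// normrM (ger0_norm s0).
  by rewrite mulr_ile1.
have d1 : 0 < 1 + (pi * w) ^+ 2 by rewrite ltr_pwDl// sqr_ge0.
have d2 : 0 < pi ^+ 2 + w ^+ 2 by rewrite ltr_pwDl// ?exprn_gt0 ?pi_gt0// sqr_ge0.
have i1 : `|(1 + (pi * w) ^+ 2)^-1| <= 1.
  by rewrite ger0_norm ?invr_ge0 ?(ltW d1)// invf_le1// lerDl sqr_ge0.
have i2 : `|(pi ^+ 2 + w ^+ 2)^-1| <= 1.
  rewrite ger0_norm ?invr_ge0 ?(ltW d2)// invf_le1//.
  by rewrite (le_trans (_ : 1 <= pi ^+ 2)) ?exprn_ege1// lerDl sqr_ge0.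
have i3 : `|pi * w * (1 + (pi * w) ^+ 2)^-1| <= 1.
  rewrite normrM [X in _ * X]ger0_norm ?invr_ge0 ?(ltW d1)// ler_pdivrMr// mul1r.
  rewrite -[(pi * w) ^+ 2]real_normK ?num_real//.
  by have := sqr_ge0 (`|pi * w| - 1); have := normr_ge0 (pi * w); nra.
have pM : pi * expR (s ^+ 2) <= M.
  apply: (@le_trans _ _ (pi * expR 1)); first by rewrite ler_wpM2l.
  rewrite /M /pairing_bound -mulrA.
  by move: (pi * expR 1) (mulr_ge0 p0 (E0 1)) => z; lra.
have A1 : `|pi * expR (s ^+ 2) * (1 + (pi * w) ^+ 2)^-1| <= M.
  by rewrite normrM -[leRHS]mulr1 ler_pM// ger0_norm ?mulr_ge0.
have A2 : `|pi * expR (s ^+ 2) * (pi * w) * (1 + (pi * w) ^+ 2)^-1| <= M.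
  by rewrite -mulrA normrM -[leRHS]mulr1 ler_pM// ger0_norm ?mulr_ge0.
have A3 : `|- (pi * expR (s ^+ 2) * (pi * w) * (1 + (pi * w) ^+ 2)^-1)| <= M by rewrite normrN.
have A4 : `|2 * expR ((s * w) ^+ 2) * pi * (pi ^+ 2 + w ^+ 2)^-1| <= M.
  rewrite normrM -[leRHS]mulr1 ler_pM// ger0_norm ?mulr_ge0// mulrAC.
  by rewrite /M /pairing_bound ler_wpM2l ?mulr_ge0.
have A5 : `|- (2 * expR ((s * w) ^+ 2) * w * (pi ^+ 2 + w ^+ 2)^-1)| <= M.
  rewrite normrN normrM -[leRHS]mulr1 ler_pM// normrM ger0_norm ?mulr_ge0//.
  rewrite mulrAC /M /pairing_bound ler_pM ?mulr_ge0//.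
  by rewrite ler_wpM2l// (le_trans w1).
by rewrite /kernel_pairing /spectrogram; exact: (sqr_lin6_le _ _ _ _ _ _ A1 A2 A1 A3 A4 A5).
Qed.

(** The mass of the kernel is the same for every parameter 2ts, hence for every [t]; integrating
    against the window at the origin gives the left side, and Fubini gives the boundary integral. *)
Lemma kernel_reproducing u s : L2 mu u ->
  kernel_mass pi 0 * fc u 0 0 = \int[mu]_w (kernel_pairing u s w * unit_window w).
Proof.
move=> u2; have p0 := pi_gt0 R.
have i0 := windowed_integrable 0 u2.
have mk0 : measurable_fun setT (windowed u 0) := L1_measurable i0.
have mck := measurable_cauchy_kernel p0.
have mcw := @measurable_unit_window R.
(* The growth of the kernel in [t]. According to the sign of ts this is the window displaced to [s]
   or to [- s], up to the factor exp(s^2), so the sum of the two displaced windows is an integrable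
   majorant. *)
pose a t := windowed u 0 t * expR `|2 * t * s|.
have ma : measurable_fun setT a by rewrite /a; meas.
have ia : L1 (fun t => `|a t|).
  have h1 := integrable_norm (L1Z (expR (s ^+ 2)) (windowed_integrable s u2)).
  have h2 := integrable_norm (L1Z (expR (s ^+ 2)) (windowed_integrable (- s) u2)).
  apply: le_integrable (L1D h1 h2) => //; first by meas.
  move=> t _; rewrite /= lee_fin normr_id [leRHS]ger0_norm ?addr_ge0//.
  have [st|st] := leP 0 (2 * t * s).
    apply: (@le_trans _ _ `|expR (s ^+ 2) * windowed u s t|); last by rewrite lerDl.
    have Ea : expR `|2 * t * s| = expR (2 * t * s) by rewrite ger0_norm.
    by rewrite /a Ea /windowed -mulrA gauss_expR mulrCA.
  apply: (@le_trans _ _ `|expR (s ^+ 2) * windowed u (- s) t|); last by rewrite lerDr.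
  have Ea : expR `|2 * t * s| = expR (2 * t * - s) by rewrite ltr0_norm// mulrN.
  by rewrite /a Ea /windowed -mulrA gauss_expR sqrrN mulrCA.
transitivity (\int[mu]_t \int[mu]_w (windowed u 0 t * (cauchy_kernel pi (2 * t * s) w * unit_window w))).
  rewrite [fc u 0 0](_ : _ = \int[mu]_t windowed u 0 t); last first.
    by apply: eq_Rintegral => t _; rewrite mulr0 mul0r cos0 mulr1.
  rewrite mulrC -RintegralZr//; apply: eq_Rintegral => t _.
  rewrite RintegralZl//; first by rewrite -/(kernel_mass pi (2 * t * s)) kernel_mass_cst.
  exact: cauchy_kernel_integrable.
rewrite (dominated_fubini (m1 := mu) (m2 := mu)
  (F := fun z : R * R => windowed u 0 z.1 * (cauchy_kernel pi (2 * z.1 * s) z.2 * unit_window z.2))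
  (a := fun t => `|a t|) (b := fun w => kernel_bound pi * unit_window w)); first last.
- move=> t w /=; rewrite unit_windowE; case: (boolP (_ <= _ <= _)) => h; last first.
    by rewrite !mulr0 normr0.
  rewrite !mulr1 normrM /a (normrM (windowed u 0 t) (expR _)) -[leRHS]mulrA; apply: ler_wpM2l => //.
  rewrite [leRHS]mulrC [`|expR _|]ger0_norm ?expR_ge0//; exact: cauchy_kernel_le.
- by apply: L1Z; exact: unit_window_integrable.
- exact: ia.
- apply: measurable_funM; first exact: (measurableT_comp mk0 measurable_fst).
  apply: measurable_funM; last exact: (measurableT_comp mcw measurable_snd).
  have mq : measurable_fun setT (fun z : R * R => (2 * z.1 * s, z.2)).
    by apply/measurable_fun_pair; meas.
  exact: (measurableT_comp mck mq).
apply: eq_Rintegral => w _ /=; rewrite -kernel_pairingE//.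
rewrite unit_windowE; case: (boolP (_ <= _ <= _)) => h; last first.
  rewrite mulr0 -[RHS](mul0r (fine (mu setT))) -(Rintegral_cst mu measurableT).
  by apply: eq_Rintegral => t _; rewrite !mulr0.
rewrite mulr1; apply: eq_Rintegral => t _; rewrite mulr1//.
Qed.

Lemma fcos_windowed_bounded u : L2 mu u ->
  exists K : R, forall x y, `|fc u x y| <= K /\ `|fs u x y| <= K.
Proof.
move=> u2; exists (ip mu u u + 1) => x y.
have iw := windowed_integrable x u2.
have b : \int[mu]_t `|windowed u x t| <= ip mu u u + 1.
  rewrite -lee_fin -EFin_Rintegral; last exact: (integrable_norm iw).
  have [mu_ _] := u2.
  have mg : measurable_fun setT (fun t : R => gauss (t - x)) by apply: measurable_gauss_comp; meas.
  apply: (@le_trans _ _ (\int[mu]_t ((u t ^+ 2)%:E + (gauss (t - x) ^+ 2)%:E))%E).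
    apply: ge0_le_integral => //.
    - by rewrite /windowed; meas.
    - by meas.
    - move=> t _; rewrite -EFinD lee_fin /windowed normrM.
      rewrite -(real_normK (num_real (u t))) -(real_normK (num_real (gauss _))).
      have := sqr_ge0 (`|u t| - `|gauss (t - x)|); have := normr_ge0 (u t).
      by have := normr_ge0 (gauss (t - x)); move: `|u t| `|gauss _| => p q; nra.
  rewrite ge0_integralD//; last 4 first.
  - by move=> t _; rewrite lee_fin sqr_ge0.
  - by meas.
  - by move=> t _; rewrite lee_fin sqr_ge0.
  - by meas.
  by rewrite gauss_shift_sqr_integral (ip_sqr u2) EFinD.
by split; apply: le_trans b; [exact: fcos_le|exact: fsin_le].
Qed.

Lemma measurable_kernel_pairing u s : measurable_fun setT u ->
  measurable_fun setT (kernel_pairing u s).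
Proof.
move=> mu_; have p0 := pi_gt0 R.
have h1 : measurable_fun setT (fun w : R => (1 + (pi * w) ^+ 2)^-1).
  by apply: measurable_inv_sqr_comp => //; meas.
have h2 : measurable_fun setT (fun w : R => (pi ^+ 2 + w ^+ 2)^-1).
  by apply: measurable_inv_sqr_comp; [exact: exprn_gt0|meas].
have mc := measurable_fcos_windowed mu_; have ms := measurable_fsin_windowed mu_.
have p1 (a : R) : measurable_fun setT (fun w : R => (a, s * w)) by apply/measurable_fun_pair; meas.
have p2 : measurable_fun setT (fun w : R => (s * w, s)) by apply/measurable_fun_pair; meas.
have c1 a : measurable_fun setT (fun w : R => fc u a (s * w)) := measurableT_comp mc (p1 a).
have s1 a : measurable_fun setT (fun w : R => fs u a (s * w)) := measurableT_comp ms (p1 a).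
have c2 : measurable_fun setT (fun w : R => fc u (s * w) s) := measurableT_comp mc p2.
have s2 : measurable_fun setT (fun w : R => fs u (s * w) s) := measurableT_comp ms p2.
by rewrite /kernel_pairing; meas.
Qed.

(** Cauchy-Schwarz against a function of squared norm 2, from the square of [X + l * J] at the
    optimal [l]. It is meant for the indicator of [-1, 1]. *)
Lemma ip_halfsqr d (T : measurableType d) (m : {measure set T -> \bar R}) (X J : T -> R) :
  L2 m X -> L2 m J -> ip m J J = 2 -> ip m X J ^+ 2 <= 2 * ip m X X.
Proof.
move=> X2 J2 J22; pose l := - (ip m X J / 2).
have lJ := L2Z l J2.
have := ip_ge0 m (fun t => X t + l * J t).
rewrite ip_sqrD// (ipC m X) !ipZl// (ipC m J (fun t => l * J t)) ipZl// J22 (ipC m J X) /l.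
by move: (ip m X J) (ip m X X) => p q; nra.
Qed.

(** Cauchy-Schwarz on [-1, 1] applied to [kernel_reproducing]: the constant 12 is the squared norm 2
    times the 6 of [kernel_pairing_sqr_le]. *)
Lemma kernel_square_bound u s : L2 mu u -> 0 <= s <= 1 ->
  (((kernel_mass pi 0 * fc u 0 0) ^+ 2)%:E <=
  (12 * pairing_bound ^+ 2)%:E * \int[mu]_w ((spectrogram u s (s * w) +
    spectrogram u (- s) (s * w) + spectrogram u (s * w) s) * unit_window w)%:E)%E.
Proof.
move=> u2 s01; have [mu_ _] := u2; have [/andP[s0 s1]] := s01.
have mkp := measurable_kernel_pairing s mu_.
have mcw := @measurable_unit_window R.
have [K hK] := fcos_windowed_bounded u2.
have K0 : 0 <= K by apply: le_trans (hK 0 0).1.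
have sK x y : spectrogram u x y <= 2 * K ^+ 2.
  rewrite /spectrogram -[fc u x y ^+ 2]real_normK ?num_real// -[fs u x y ^+ 2]real_normK ?num_real//.
  have [h1 h2] := hK x y; rewrite mulr_natl mulr2n; apply: lerD; rewrite lerXn2r ?nnegrE//.
pose X w := kernel_pairing u s w * unit_window w.
(* A crude bound whose only purpose is to place [X] in L2; the added 1 lets |X| <= L follow from X^2
   <= L. *)
pose L := 1 + 6 * pairing_bound ^+ 2 * (2 * K ^+ 2 + 2 * K ^+ 2 + 2 * K ^+ 2).
have mX : measurable_fun setT X by apply: measurable_funM.
have L0 : 1 <= L by rewrite /L lerDl; apply: mulr_ge0; [rewrite mulr_ge0 ?sqr_ge0|rewrite !addr_ge0// mulr_ge0// sqr_ge0].
have XL w : `|X w| <= L.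
  rewrite /X unit_windowE; case: (boolP (_ <= _ <= _)) => h; last first.
    by rewrite mulr0 normr0; lra.
  rewrite mulr1; have h2 := kernel_pairing_sqr_le u s01 h.
  have h3 : kernel_pairing u s w ^+ 2 <= L.
    apply: (le_trans h2); apply: (@le_trans _ _ (6 * pairing_bound ^+ 2 * (2 * K ^+ 2 + 2 * K ^+ 2 + 2 * K ^+ 2))); last by rewrite lerDr.
    by apply: ler_wpM2l; [rewrite mulr_ge0 ?sqr_ge0|rewrite !lerD].
  rewrite -real_normK ?num_real// in h3.
  have [z1|z1] := leP `|kernel_pairing u s w| 1; first exact: le_trans L0.
  by apply: le_trans h3; rewrite expr2 ler_peMl// ltW.
have X0 w : w < -1 \/ 1 < w -> X w = 0.
  rewrite /X unit_windowE; case: (boolP (_ <= _ <= _)) => [/andP[h1 h2] h|]; last by rewrite mulr0.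
  by exfalso; case: h; lra.
have [_ X2] := nice_integrable mX XL X0.
have J1 w : `|@unit_window R w| <= 1 by rewrite unit_windowE; case: (_ <= _ <= _); rewrite ?normr1 ?normr0.
have J0 w : w < -1 \/ 1 < w -> @unit_window R w = 0.
  rewrite unit_windowE; case: (boolP (_ <= _ <= _)) => [/andP[h1 h2] h|//].
  by exfalso; case: h; lra.
have [_ J2] := nice_integrable mcw J1 J0.
have JJ w : @unit_window R w * unit_window w = unit_window w.
  by rewrite unit_windowE; case: (_ <= _ <= _); rewrite ?mulr1 ?mulr0.
have J22 : ip mu (@unit_window R) (@unit_window R) = 2.
  by rewrite -(@unit_window_integral R); apply: eq_Rintegral => w _; exact: JJ.
have XJ : ip mu X (@unit_window R) = kernel_mass pi 0 * fc u 0 0.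
  by rewrite (kernel_reproducing s)//; apply: eq_Rintegral => w _; rewrite /X -mulrA JJ.
have := ip_halfsqr X2 J2 J22; rewrite XJ => h.
apply: (@le_trans _ _ ((2 * ip mu X X)%:E)); first by rewrite lee_fin.
have msp := measurable_spectrogram mu_.
have p1 (a : R) : measurable_fun setT (fun w : R => (a, s * w)) by apply/measurable_fun_pair; meas.
have p2 : measurable_fun setT (fun w : R => (s * w, s)) by apply/measurable_fun_pair; meas.
have c1 a : measurable_fun setT (fun w : R => spectrogram u a (s * w)) := measurableT_comp msp (p1 a).
have c2 : measurable_fun setT (fun w : R => spectrogram u (s * w) s) := measurableT_comp msp p2.
have P0 w : 0 <= (spectrogram u s (s * w) + spectrogram u (- s) (s * w) + spectrogram u (s * w) s) * unit_window w.
  by rewrite unit_windowE mulr_ge0// addr_ge0 ?spectrogram_ge0// addr_ge0 ?spectrogram_ge0.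
rewrite (_ : 12 * pairing_bound ^+ 2 = 2 * (6 * pairing_bound ^+ 2)); last by ring.
rewrite EFinM EFinM -muleA; apply: lee_wpmul2l => //.
rewrite -(ip_sqr X2) -ge0_integralZl//; last 3 first.
- by apply/measurable_EFinP; meas.
- by move=> w _; rewrite lee_fin.
- by rewrite lee_fin mulr_ge0// sqr_ge0.
apply: ge0_le_integral => //.
- by move=> w _; rewrite lee_fin sqr_ge0.
- by meas.
- by apply: measurable_funeM; apply/measurable_EFinP; meas.
move=> w _; rewrite -EFinM lee_fin /X unit_windowE; case: (boolP (_ <= _ <= _)) => h'; last first.
  by rewrite !mulr0 expr0n.
by rewrite !mulr1 kernel_pairing_sqr_le.
Qed.

Definition box rho x : R := (- rho <= x <= rho)%R%:R.

Lemma box_ge0 rho x : 0 <= box rho x. Proof. by rewrite /box. Qed.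

Lemma boxN rho x : box rho (- x) = box rho x.
Proof. by rewrite /box lerN2 lerNl andbC. Qed.

Lemma measurable_box rho : measurable_fun setT (box rho).
Proof.
rewrite (_ : box rho = \1_`[- rho, rho]); first by apply: measurable_indic; exact: measurable_itv.
by apply/funext => x; rewrite indicE /box mem_setE /= in_itv.
Qed.

Definition box2 rho (z : R * R) : R := box rho z.1 * box rho z.2.

Lemma box2_ge0 rho z : 0 <= box2 rho z. Proof. by rewrite mulr_ge0 ?box_ge0. Qed.

Lemma measurable_box2 rho : measurable_fun setT (box2 rho).
Proof.
have h := measurable_box rho.
by apply: measurable_funM; apply: (measurableT_comp h); [exact: measurable_fst|exact: measurable_snd].
Qed.

(** The substitution y = s w accounts for the factor [s]. The three terms are the right, left and
    upper sides of the square of half-side [s]; the lower side has already been merged with the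
    upper one in the kernel. *)
Lemma spectrogram_line_le u rho s : L2 mu u -> rho <= 1 -> 0 < s <= rho ->
  ((s * (kernel_mass pi 0 * fc u 0 0) ^+ 2)%:E <= (12 * pairing_bound ^+ 2)%:E *
   \int[mu]_y (box rho y * (spectrogram u s y + spectrogram u (- s) y + spectrogram u y s))%:E)%E.
Proof.
move=> u2 r1 /andP[s0 sr]; have [mu_ _] := u2.
have msp := measurable_spectrogram mu_.
have mb := measurable_box rho; have mw := @measurable_unit_window R.
have p1 (a : R) : measurable_fun setT (fun y : R => (a, y)) by apply/measurable_fun_pair; meas.
have p2 : measurable_fun setT (fun y : R => (y, s)) by apply/measurable_fun_pair; meas.
have c1 (a : R) : measurable_fun setT (fun y : R => spectrogram u a y) := measurableT_comp msp (p1 a).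
have c2 : measurable_fun setT (fun y : R => spectrogram u y s) := measurableT_comp msp p2.
pose f y := spectrogram u s y + spectrogram u (- s) y + spectrogram u y s.
have mf : measurable_fun setT f by rewrite /f; meas.
have f0 y : 0 <= f y by rewrite /f addr_ge0 ?spectrogram_ge0// addr_ge0 ?spectrogram_ge0.
have ms : measurable_fun setT (fun w : R => s * w) by meas.
have c1s (a : R) : measurable_fun setT (fun w : R => spectrogram u a (s * w)) := measurableT_comp (c1 a) ms.
have c2s : measurable_fun setT (fun w : R => spectrogram u (s * w) s) := measurableT_comp c2 ms.
have mbs : measurable_fun setT (fun w : R => box rho (s * w)) := measurableT_comp mb ms.
have := @ge0_int_scale R s (fun y => (box rho y * f y)%:E) s0.
move=> <-; last 2 first.
- by apply/measurable_EFinP; apply: measurable_funM.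
- by move=> y; rewrite lee_fin mulr_ge0 ?box_ge0.
rewrite EFinM muleCA; apply: lee_wpmul2l; first by rewrite lee_fin ltW.
apply: le_trans (kernel_square_bound u2 (_ : 0 <= s <= 1)) _; first by rewrite (ltW s0) (le_trans sr).
apply: lee_wpmul2l; first by rewrite lee_fin mulr_ge0 ?sqr_ge0.
apply: ge0_le_integral => //.
- by move=> w _; rewrite lee_fin unit_windowE mulr_ge0// addr_ge0 ?spectrogram_ge0// addr_ge0 ?spectrogram_ge0.
- by apply/measurable_EFinP; meas.
- by apply/measurable_EFinP; rewrite /f; meas.
move=> w _; rewrite lee_fin unit_windowE mulrC; apply: ler_wpM2r.
  by rewrite addr_ge0 ?spectrogram_ge0// addr_ge0 ?spectrogram_ge0.
case: (boolP (-1 <= w <= 1)) => // /andP[w1 w2].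
have -> : box rho (s * w) = 1 by rewrite /box; case: (boolP (_ <= _ <= _)) => //; nra.
by [].
Qed.

Lemma ge0_int2_swap (F : R * R -> \bar R) : measurable_fun setT F -> (forall z, (0 <= F z)%E) ->
  (\int[mu2]_z F (z.2, z.1) = \int[mu2]_z F z)%E.
Proof.
move=> mF F0.
have mS : measurable_fun setT (fun z : R * R => (z.2, z.1)).
  by apply/measurable_fun_pair; meas.
have mFS : measurable_fun setT (fun z : R * R => F (z.2, z.1)) := measurableT_comp mF mS.
rewrite (int2E mFS (fun z => F0 _)) (int2E mF F0).
exact: (@fubini_tonelli _ _ _ _ R mu mu (fun z : R * R => F (z.2, z.1)) mFS (fun z => F0 _)).
Qed.

(** Central reflection and exchange of the coordinates preserve planar measure, so each of the three
    sides, swept over all [x], contributes one full integral of [F]. *)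
Lemma int2_sym3 (F : R * R -> \bar R) : measurable_fun setT F -> (forall z, (0 <= F z)%E) ->
  measurable_fun setT (fun x : R => \int[mu]_y (F (x, y) + (F (- x, - y)%R + F (y, x))))%E /\
  (\int[mu]_x \int[mu]_y (F (x, y) + (F (- x, - y)%R + F (y, x))) = 3%:E * \int[mu2]_z F z)%E.
Proof.
move=> mF F0.
have mN : measurable_fun setT (fun z : R * R => (- z.1, - z.2)).
  by apply/measurable_fun_pair; meas.
have mS : measurable_fun setT (fun z : R * R => (z.2, z.1)).
  by apply/measurable_fun_pair; meas.
have mFN : measurable_fun setT (fun z : R * R => F (- z.1, - z.2)) := measurableT_comp mF mN.
have mFS : measurable_fun setT (fun z : R * R => F (z.2, z.1)) := measurableT_comp mF mS.
pose G (z : R * R) := (F (- z.1, - z.2)%R + F (z.2, z.1))%E.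
have mG : measurable_fun setT G by exact: emeasurable_funD.
have G0 z : (0 <= G z)%E by rewrite adde_ge0.
pose H (z : R * R) := (F z + G z)%E.
have mH : measurable_fun setT H by exact: emeasurable_funD.
have H0 z : (0 <= H z)%E by rewrite adde_ge0.
split; first exact: (@measurable_fun_fubini_tonelli_F _ _ _ _ R mu H mH H0).
transitivity (\int[mu2]_z H z)%E; first by rewrite (int2E mH H0).
rewrite (ge0_integralD mu2 measurableT (fun z _ => F0 z) mF (fun z _ => G0 z) mG).
rewrite (ge0_integralD mu2 measurableT (fun z _ => F0 _) mFN (fun z _ => F0 _) mFS).
rewrite (ge0_int2_opp mF F0) (ge0_int2_swap mF F0).
have : (0 <= \int[mu2]_z F z)%E by apply: integral_ge0.
move: (\int[mu2]_z F z)%E => [x _| _|//]; first by rewrite -!EFinD -EFinM; congr EFin; ring.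
by rewrite !addye// gt0_muley.
Qed.

Lemma ge0_integral_itv_ge (H : R -> \bar R) (a b c : R) : a <= b -> 0 <= c ->
  measurable_fun setT H -> (forall x, (0 <= H x)%E) ->
  (forall x, a <= x <= b -> (c%:E <= H x)%E) -> (((b - a) * c)%:E <= \int[mu]_x H x)%E.
Proof.
move=> ab c0 mH H0 cH.
have E : (\int[mu]_(x in `[a, b]) c%:E = ((b - a) * c)%:E)%E.
  rewrite integral_cst//= lebesgue_measure_itv/= lte_fin.
  have [ab'|ab'] := ltP a b; first by rewrite -EFinB -EFinM mulrC.
  by rewrite mule0 (_ : b = a) ?subrr ?mul0r//; apply/eqP; rewrite eq_le ab'.
rewrite -E.
have h1 : (\int[mu]_(x in `[a, b]) c%:E <= \int[mu]_(x in `[a, b]) H x)%E.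
  by apply: ge0_le_integral => //; exact: measurable_funTS.
have h2 : (\int[mu]_(x in `[a, b]) H x <= \int[mu]_x H x)%E.
  by apply: ge0_subset_integral.
exact: le_trans h1 h2.
Qed.

(** The boundary estimate is integrated over half-sides in [rho/2, rho]. There the weight is at
    least rho/2 on an interval of length rho/2, whence (rho/2)^2; the constant is 36 = 12 * 3. All
    the squares lie in the box of radius [rho]. *)
Lemma spectrogram_center_le u rho : L2 mu u -> 0 < rho <= 1 ->
  (((rho / 2) ^+ 2 * (kernel_mass pi 0 * fc u 0 0) ^+ 2)%:E <= (36 * pairing_bound ^+ 2)%:E *
   \int[mu2]_z (box2 rho z * spectrogram u z.1 z.2)%:E)%E.
Proof.
move=> u2 /andP[r0 r1]; have [mu_ _] := u2.
have msp := measurable_spectrogram mu_.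
have mb2 := measurable_box2 rho.
set K := (kernel_mass pi 0 * _) ^+ 2.
have K0 : 0 <= K by exact: sqr_ge0.
have P0 : 0 <= 12 * pairing_bound ^+ 2 by rewrite mulr_ge0 ?sqr_ge0.
have mF : measurable_fun setT (fun z : R * R => (box2 rho z * spectrogram u z.1 z.2)%:E).
  by apply/measurable_EFinP; apply: measurable_funM.
have F0 z : (0 <= (box2 rho z * spectrogram u z.1 z.2)%:E)%E.
  by rewrite lee_fin mulr_ge0 ?box2_ge0 ?spectrogram_ge0.
pose H (x : R) : \bar R := (\int[mu]_y ((box2 rho (x, y) * spectrogram u x y)%:E +
       ((box2 rho (- x, - y) * spectrogram u (- x) (- y))%:E +
        (box2 rho (y, x) * spectrogram u y x)%:E)))%E.
have FE (x : R) : rho / 2 <= x <= rho -> ((x * K)%:E <= (12 * pairing_bound ^+ 2)%:E * H x)%E.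
  move=> /andP[x1 x2]; have x0 : 0 < x by lra.
  apply: le_trans (spectrogram_line_le u2 r1 (_ : 0 < x <= rho)) _; first by rewrite x0.
  apply: lee_wpmul2l; first by rewrite lee_fin.
  rewrite le_eqVlt; apply/orP; left; apply/eqP; apply: eq_integral => t _.
  have bx : box rho x = 1.
    by rewrite /box x2 andbT (_ : - rho <= x) ?mulr1n//; lra.
  rewrite /box2 /= !boxN bx spectrogramN// mul1r mulr1 -!EFinD -!mulrDr.
  by congr (_ * _)%:E; exact: (esym (addrA _ _ _)).
have [mH E3] : measurable_fun setT H /\
    (\int[mu]_x H x = 3%:E * \int[mu2]_z (box2 rho z * spectrogram u z.1 z.2)%:E)%E.
  exact: int2_sym3 mF F0.
have H0 x : (0 <= H x)%E.
  by apply: integral_ge0 => y _; rewrite !adde_ge0 ?(F0 (x, y)) ?(F0 (- x, - y)) ?(F0 (y, x)).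
rewrite (_ : 36 * pairing_bound ^+ 2 = 12 * pairing_bound ^+ 2 * 3); last by ring.
rewrite [(_ * 3)%:E]EFinM -muleA -E3.
rewrite -(ge0_integralZl mu measurableT mH (fun x _ => H0 x)); last by rewrite lee_fin.
have -> : (rho / 2) ^+ 2 * K = (rho - rho / 2) * (rho / 2 * K) by field.
apply: ge0_integral_itv_ge.
- by lra.
- by rewrite mulr_ge0// divr_ge0// ltW.
- exact: measurable_funeM.
- by move=> x; rewrite mule_ge0// lee_fin.
move=> x xr; apply: le_trans (FE x xr); rewrite lee_fin ler_wpM2r//.
by case/andP: xr.
Qed.

Definition local_const rho : R :=
  36 * pairing_bound ^+ 2 / ((rho / 2) ^+ 2 * kernel_mass pi 0 ^+ 2).

Lemma local_const_gt0 rho : 0 < rho -> 0 < local_const rho.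
Proof.
move=> r0; have k0 := kernel_mass_gt0 (pi_gt0 R).
have pb0 : 0 < pairing_bound by rewrite /pairing_bound !mulr_gt0 ?pi_gt0 ?expR_gt0.
apply: divr_gt0; first by apply: mulr_gt0 => //; exact: exprn_gt0.
by apply: mulr_gt0; apply: exprn_gt0 => //; exact: divr_gt0.
Qed.

Lemma spectrogram_local_le u rho : L2 mu u -> 0 < rho <= 1 ->
  ((spectrogram u 0 0)%:E <= (local_const rho)%:E *
   \int[mu2]_z (box2 rho z * spectrogram u z.1 z.2)%:E)%E.
Proof.
move=> u2 rr; have /andP[r0 r1] := rr; have k0 := kernel_mass_gt0 (pi_gt0 R).
have -> : spectrogram u 0 0 = fc u 0 0 ^+ 2.
  rewrite /spectrogram [fs u 0 0](_ : _ = 0) ?expr0n ?addr0// /fsin.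
  rewrite -[RHS](mul0r (fine (mu setT))) -(Rintegral_cst mu measurableT).
  by apply: eq_Rintegral => t _; rewrite mulr0 mul0r sin0 mulr0.
have := spectrogram_center_le u2 rr; rewrite [(kernel_mass pi 0 * _) ^+ 2]exprMn.
set d := (rho / 2) ^+ 2; set k := kernel_mass pi 0 ^+ 2; set X := (\int[mu2]_z _)%E.
have d0 : 0 < d * k by rewrite mulr_gt0// exprn_gt0// divr_gt0.
rewrite mulrA => h; rewrite /local_const -/d -/k.
have -> : fc u 0 0 ^+ 2 = (d * k)^-1 * (d * k * fc u 0 0 ^+ 2) by rewrite mulKf ?gt_eqF.
rewrite [_ / (d * k)]mulrC [X in (X <= _)%E]EFinM [X in (_ <= X * _)%E]EFinM -muleA.
by apply: lee_wpmul2l => //; rewrite lee_fin invr_ge0 ltW.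
Qed.

(** The box is even in the frequency variable, so [stft_even_integral] splits the right side into
    the real and the imaginary part of [g]. *)
Lemma stft_center_le g rho : inL2 g -> 0 < rho <= 1 ->
  ((cabs2 (stft g 0 0))%:E <= (local_const rho)%:E *
   \int[mu2]_z (box2 rho z * cabs2 (stft g z.1 z.2))%:E)%E.
Proof.
move=> gL rr; have [gr gi] := (inL2P g).1 gL; have /andP[r0 r1] := rr.
have E : cabs2 (stft g 0 0) = spectrogram (fun t => Re (g t)) 0 0 + spectrogram (fun t => Im (g t)) 0 0.
  by have := cabs2_stft_sym 0 0 gL; rewrite oppr0; lra.
rewrite E stft_even_integral//; last 3 first.
- exact: measurable_box2.
- by move=> z; exact: box2_ge0.
- by move=> x y; rewrite /box2 /= boxN.
rewrite ge0_muleDr ?integral_ge0//; last 2 first.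
- by move=> z _; rewrite lee_fin mulr_ge0 ?box2_ge0 ?spectrogram_ge0.
- by move=> z _; rewrite lee_fin mulr_ge0 ?box2_ge0 ?spectrogram_ge0.
by rewrite EFinD; apply: leeD; exact: spectrogram_local_le.
Qed.

Lemma stft_shift_le g rho (q : R * R) : inL2 g -> 0 < rho <= 1 ->
  ((cabs2 (stft g q.1 q.2))%:E <= (local_const rho)%:E *
   \int[mu2]_z (box2 rho z * cabs2 (stft g (q.1 + z.1) (q.2 + z.2)))%:E)%E.
Proof.
move=> gL rr.
have E x y : cabs2 (stft (tfshift (- q.1) (- q.2) g) x y) = cabs2 (stft g (q.1 + x) (q.2 + y)).
  by rewrite cabs2_stft_tfshift// !opprK addrC [y + _]addrC.
have EI : (fun z : R * R => (box2 rho z * cabs2 (stft (tfshift (- q.1) (- q.2) g) z.1 z.2))%:E) =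
    (fun z : R * R => (box2 rho z * cabs2 (stft g (q.1 + z.1) (q.2 + z.2)))%:E).
  by apply/funext => z; rewrite E.
by have := stft_center_le (inL2_tfshift (- q.1) (- q.2) gL) rr; rewrite EI E !addr0.
Qed.

Lemma measurable_box_stft g rho (q : R * R) : inL2 g ->
  measurable_fun setT (fun z : R * R => (box2 rho z * cabs2 (stft g (q.1 + z.1) (q.2 + z.2)))%:E).
Proof.
move=> gL; apply/measurable_EFinP; apply: measurable_funM; first exact: measurable_box2.
have mq : measurable_fun setT (fun z : R * R => (q.1 + z.1, q.2 + z.2)).
  by apply/measurable_fun_pair; meas.
exact: (measurableT_comp (measurable_cabs2_stft gL) mq).
Qed.

Lemma stft_local_plus g rho (z l : R * R) : inL2 g -> 0 < rho <= 1 ->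
  ((cabs2 (stft g (l.1 - z.1) (l.2 - z.2)))%:E <= (local_const rho)%:E *
   \int[mu2]_w (box2 rho (w.1 - l.1, w.2 - l.2) * cabs2 (stft g (w.1 - z.1) (w.2 - z.2)))%:E)%E.
Proof.
move=> gL rr; pose q := (l.1 - z.1, l.2 - z.2).
have mF := measurable_box_stft rho q gL.
have F0 (w : R * R) : (0 <= (box2 rho w * cabs2 (stft g (q.1 + w.1) (q.2 + w.2)))%:E)%E.
  by rewrite lee_fin mulr_ge0 ?box2_ge0 ?cabs2_ge0.
have E := ge0_int2_shift (- l.1, - l.2) mF F0.
have -> : (\int[mu2]_w (box2 rho (w.1 - l.1, w.2 - l.2) * cabs2 (stft g (w.1 - z.1) (w.2 - z.2)))%:E =
    \int[mu2]_w (box2 rho w * cabs2 (stft g (q.1 + w.1) (q.2 + w.2)))%:E)%E.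
  rewrite -E; apply: eq_integral => w _ /=.
  congr (box2 _ (_, _) * cabs2 (stft g _ _))%:E; ring.
exact: (stft_shift_le q gL rr).
Qed.

(** Same estimate with the discrete point subtracted instead of added: the box is symmetric, so a
    reflection about [l] puts it in the required form. This version serves Riesz sequences,
    [stft_local_plus] serves frames. *)
Lemma stft_local_minus g rho (z l : R * R) : inL2 g -> 0 < rho <= 1 ->
  ((cabs2 (stft g (z.1 - l.1) (z.2 - l.2)))%:E <= (local_const rho)%:E *
   \int[mu2]_w (box2 rho (w.1 - l.1, w.2 - l.2) * cabs2 (stft g (z.1 - w.1) (z.2 - w.2)))%:E)%E.
Proof.
move=> gL rr; pose q := (z.1 - l.1, z.2 - l.2).
have mF := measurable_box_stft rho q gL.
have F0 (w : R * R) : (0 <= (box2 rho w * cabs2 (stft g (q.1 + w.1) (q.2 + w.2)))%:E)%E.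
  by rewrite lee_fin mulr_ge0 ?box2_ge0 ?cabs2_ge0.
have E := ge0_int2_reflect (l.1, l.2) mF F0.
have -> : (\int[mu2]_w (box2 rho (w.1 - l.1, w.2 - l.2) * cabs2 (stft g (z.1 - w.1) (z.2 - w.2)))%:E =
    \int[mu2]_w (box2 rho w * cabs2 (stft g (q.1 + w.1) (q.2 + w.2)))%:E)%E.
  rewrite -E; apply: eq_integral => w _; rewrite /q /=.
  have e (a b c : R) : a - b + (b - c) = a - c by rewrite addrA subrK.
  by rewrite !e /box2 /= -(boxN _ (w.1 - _)) -(boxN _ (w.2 - _)) !opprB.
exact: (stft_shift_le q gL rr).
Qed.

End local_estimate.

(** * Gram matrices and square-summable families *)

Section coercive_gram.
Context {R : realType} (m : nat).
Variables (G : 'M[R]_m) (A : R).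
Hypothesis A0 : 0 < A.
Hypothesis Gsym : forall i j, G i j = G j i.
Implicit Types (v c : 'I_m -> R).

Definition qform (M : 'M[R]_m) c : R := \sum_i \sum_j M i j * c i * c j.

Hypothesis Gcoer : forall c, A * (\sum_i c i ^+ 2) <= qform G c.

Definition dot v c : R := \sum_i v i * c i.

Lemma qformE (M : 'M[R]_m) c : qform M c = dot c (fun i => \sum_j M i j * c j).
Proof.
apply: eq_bigr => i _; rewrite mulr_sumr; apply: eq_bigr => j _; ring.
Qed.

(** On a vector of the kernel the quadratic form vanishes, and coercivity forces that vector to be
    0. *)
Lemma coercive_unit : G \in unitmx.
Proof.
rewrite -unitmx_tr -row_free_unit -kermx_eq0; apply/eqP/row_matrixP => k.
rewrite row0; apply/rowP => l; rewrite mxE.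
set r := row k (kermx G^T).
have r0 : r *m G^T = 0 by rewrite /r -row_mul mulmx_ker row0.
pose c i := r 0 i.
have q0 : qform G c = 0.
  rewrite qformE /dot big1// => i _.
  have := congr1 (fun M : 'rV_m => M 0 i) r0; rewrite !mxE => h.
  have -> : \sum_j G i j * c j = 0.
    by rewrite -[RHS]h; apply: eq_bigr => j _; rewrite [G^T _ _]mxE mulrC.
  by rewrite mulr0.
have := Gcoer c; rewrite q0 => h.
have s0 : \sum_i c i ^+ 2 <= 0 by rewrite -(pmulr_rle0 _ A0).
have {}s0 : \sum_i c i ^+ 2 = 0.
  by apply/eqP; rewrite eq_le s0 sumr_ge0// => i _; exact: sqr_ge0.
have := psumr_eq0P (fun i _ => sqr_ge0 (c i)) s0 => /(_ l isT)/eqP.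
by rewrite sqrf_eq0 /c /r mxE => /eqP ->; rewrite mxE.
Qed.

Definition gram_solve v : 'I_m -> R := fun i => \sum_j invmx G i j * v j.

Lemma gram_solveK v i : \sum_j G i j * gram_solve v j = v i.
Proof.
transitivity ((G *m invmx G *m \col_j v j) i 0).
  rewrite -mulmxA mxE; apply: eq_bigr => j _; congr (_ * _).
  by rewrite mxE; apply: eq_bigr => l _; rewrite mxE.
by rewrite mulmxV ?coercive_unit// mul1mx mxE.
Qed.

(** If [G] is the Gram matrix of a family and [v] lists the inner products of h with it, this is the
    squared norm of the orthogonal projection of h onto the span. *)
Definition gram_form v : R := qform (invmx G) v.

Lemma gram_formE v : gram_form v = dot v (gram_solve v).
Proof. by rewrite /gram_form qformE. Qed.

Lemma qform_solve v : qform G (gram_solve v) = gram_form v.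
Proof.
rewrite gram_formE qformE; apply: eq_bigr => i _; rewrite gram_solveK mulrC//.
Qed.

(** Completing the square about [gram_solve v]: the difference of the two sides is the quadratic
    form at [c - gram_solve v]. For frames this allows comparison with coefficients other than the
    optimal ones. *)
Lemma gram_form_max v c : 2 * dot v c - qform G c <= gram_form v.
Proof.
pose e := gram_solve v.
have ge0 : 0 <= qform G (fun i => c i - e i).
  by apply: le_trans (Gcoer _); rewrite mulr_ge0 ?(ltW A0)// sumr_ge0// => i _; exact: sqr_ge0.
have E : qform G (fun i => c i - e i) = qform G c - 2 * dot c (fun i => \sum_j G i j * e j) + qform G e.
  have X : \sum_i \sum_j G i j * e i * c j = dot c (fun i => \sum_j G i j * e j).
    rewrite exchange_big; apply: eq_bigr => i _; rewrite mulr_sumr.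
    by apply: eq_bigr => j _; rewrite Gsym; ring.
  have Y : \sum_i \sum_j G i j * c i * e j = dot c (fun i => \sum_j G i j * e j).
    by apply: eq_bigr => i _; rewrite mulr_sumr; apply: eq_bigr => j _; ring.
  rewrite (_ : qform G (fun i => c i - e i) = qform G c - (\sum_i \sum_j G i j * c i * e j)
     - (\sum_i \sum_j G i j * e i * c j) + qform G e); first by rewrite X Y; ring.
  rewrite /qform -!sumrB -big_split; apply: eq_bigr => i _ /=.
  by rewrite -!sumrB -big_split; apply: eq_bigr => j _ /=; ring.
have D : dot c (fun i => \sum_j G i j * e j) = dot v c.
  by apply: eq_bigr => i _; rewrite gram_solveK mulrC.
by move: ge0; rewrite E D qform_solve; lra.
Qed.

Lemma gram_form_ge0 v : 0 <= gram_form v.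
Proof.
have := gram_form_max v (fun=> 0); rewrite /qform /dot big1 => [|i _]; last by rewrite mulr0.
by rewrite big1 ?mulr0 ?subr0// => i _; rewrite big1// => j _; rewrite !mulr0.
Qed.

(** Let e solve G e = v. Expanding |v - A e|^2 >= 0 and inserting A |e|^2 <= e.Ge = v.e gives A v.e
    <= |v|^2. *)
Lemma gram_form_le v : gram_form v <= A^-1 * \sum_i v i ^+ 2.
Proof.
pose e := gram_solve v.
have h : 0 <= \sum_i (v i - A * e i) ^+ 2 by apply: sumr_ge0 => i _; exact: sqr_ge0.
have E : \sum_i (v i - A * e i) ^+ 2 = \sum_i v i ^+ 2 - 2 * A * dot v e + A ^+ 2 * \sum_i e i ^+ 2.
  rewrite /dot !mulr_sumr -sumrB -big_split; apply: eq_bigr => i _ /=; ring.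
have c := Gcoer e; rewrite qform_solve in c.
have D := gram_formE v; rewrite -/e in D.
rewrite ler_pdivlMl//; move: h; rewrite E -D.
have := ler_wpM2l (ltW A0) c.
move: (\sum_i v i ^+ 2) (\sum_i e i ^+ 2) (gram_form v) => x y z; rewrite mulrA -expr2; lra.
Qed.

Lemma trace_gram_inv : \sum_i \sum_j invmx G i j * G i j = m%:R.
Proof.
transitivity (\tr (invmx G *m G)).
  by rewrite /mxtrace; apply: eq_bigr => i _; rewrite mxE; apply: eq_bigr => j _; rewrite Gsym.
by rewrite mulVmx ?coercive_unit// mxtrace1.
Qed.

Lemma inv_diag_ge0 i : 0 <= invmx G i i.
Proof.
have := gram_form_ge0 (fun j => (j == i)%:R).
rewrite /gram_form /qform (bigD1 i)//= [X in _ + X]big1 ?addr0; last first.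
  by move=> j ji; rewrite big1// => l _; rewrite (negbTE ji) mulr0 mul0r.
rewrite (bigD1 i)//= [X in _ + X]big1 ?addr0 ?eqxx ?mulr1//.
by move=> j ji; rewrite (negbTE ji) mulr0.
Qed.

End coercive_gram.

(* [l2pair] is defined by polarization, so that only sums of nonnegative terms over the index set occur. *)
Section l2_index.
Context {R : realType} {I : choiceType} (S : set I).
Implicit Types a b c : I -> R.

Definition l2e a : \bar R := (\esum_(k in S) (a k ^+ 2)%:E)%E.
Definition l2sum a : R := fine (l2e a).
Definition l2fin a : Prop := (l2e a < +oo)%E.
Definition l2pair a b : R := (l2sum (fun k => a k + b k)%R - l2sum a - l2sum b) / 2.

Let sq0 a k : (0 <= (a k ^+ 2)%:E)%E. Proof. by rewrite lee_fin sqr_ge0. Qed.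

Lemma l2e_ge0 a : (0 <= l2e a)%E. Proof. exact: esum_ge0. Qed.

Lemma l2sum_ge0 a : 0 <= l2sum a. Proof. by rewrite fine_ge0// l2e_ge0. Qed.

Lemma l2sumE a : l2fin a -> (l2sum a)%:E = l2e a.
Proof. by move=> fa; rewrite /l2sum fineK// ge0_fin_numE// l2e_ge0. Qed.

Lemma esumZ (t : R) (f : I -> \bar R) : 0 <= t -> (forall k, (0 <= f k)%E) ->
  (\esum_(k in S) (t%:E * f k) = t%:E * \esum_(k in S) f k)%E.
Proof.
move=> t0 f0; rewrite /esum -ereal_supZl//; last first.
  by apply/set0P; exists (\sum_(k \in set0) f k)%E; exists set0 => //; exact: fsets_set0.
congr ereal_sup; apply/seteqP; split=> x /=.
- move=> [F [fF FS] <-]; exists (\sum_(k \in F) f k)%E; first by exists F.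
  by rewrite !fsbig_finite//= ge0_sume_distrr.
- move=> [y [F [fF FS] <-] <-]; exists F => //.
  by rewrite !fsbig_finite//= ge0_sume_distrr.
Qed.

Lemma l2eZ t a : l2e (fun k => t * a k) = ((t ^+ 2)%:E * l2e a)%E.
Proof.
rewrite /l2e -esumZ ?sqr_ge0//; apply: eq_esum => k _.
by rewrite exprMn EFinM.
Qed.

Lemma l2finZ t a : l2fin a -> l2fin (fun k => t * a k).
Proof. by move=> fa; rewrite /l2fin l2eZ -l2sumE// -EFinM ltry. Qed.

Lemma l2finD a b : l2fin a -> l2fin b -> l2fin (fun k => a k + b k).
Proof.
move=> fa fb; rewrite /l2fin; apply: (@le_lt_trans _ _ (2%:E * l2e a + 2%:E * l2e b)%E).
  rewrite /l2e -!esumZ// -esumD//; last 2 first.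
  - by move=> k _; rewrite mule_ge0.
  - by move=> k _; rewrite mule_ge0.
  apply: le_esum => k _; rewrite -!EFinM -EFinD lee_fin.
  by have := sqr_ge0 (a k - b k); nra.
by rewrite -!l2sumE// -!EFinM -EFinD ltry.
Qed.

Lemma l2sumZ t a : l2fin a -> l2sum (fun k => t * a k) = t ^+ 2 * l2sum a.
Proof. by move=> fa; rewrite /l2sum l2eZ -l2sumE. Qed.

Lemma l2pairC a b : l2pair a b = l2pair b a.
Proof.
rewrite /l2pair (_ : (fun k => a k + b k) = (fun k => b k + a k)); first by ring.
by apply/funext => k; rewrite addrC.
Qed.

(** Sum over the index set of (a+b+c)^2 + a^2 + b^2 + c^2 = (a+b)^2 + (a+c)^2 + (b+c)^2, an identity
    between sums of nonnegative terms. *)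
Lemma l2pairD a b c : l2fin a -> l2fin b -> l2fin c ->
  l2pair (fun k => a k + b k) c = l2pair a c + l2pair b c.
Proof.
move=> fa fb fc.
have fab := l2finD fa fb; have fac := l2finD fa fc; have fbc := l2finD fb fc.
have fabc := l2finD fab fc.
have E : l2sum (fun k => a k + b k + c k) + (l2sum a + (l2sum b + l2sum c)) =
    l2sum (fun k => a k + b k) + (l2sum (fun k => a k + c k) + l2sum (fun k => b k + c k)).
  apply: EFin_inj; rewrite !EFinD !l2sumE// /l2e -!esumD//; last first.
  all: try by move=> k _; rewrite -?EFinD lee_fin ?addr_ge0 ?sqr_ge0.
  by apply: eq_esum => k _; rewrite -!EFinD; congr EFin; ring.
rewrite /l2pair; move: E.
move: (l2sum _) (l2sum _) (l2sum _) (l2sum _) (l2sum _) (l2sum _) (l2sum _) => *; lra.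
Qed.

(** For t >= 0 homogeneity can again be written with nonnegative terms on both sides; negative
    scalars are reached afterwards through additivity. *)
Lemma l2pairZ_ge0 (t : R) a b : 0 <= t -> l2fin a -> l2fin b ->
  l2pair (fun k => t * a k) b = t * l2pair a b.
Proof.
move=> t0 fa fb; have fta := l2finZ t fa; have ftab := l2finD fta fb; have fab := l2finD fa fb.
have E : l2sum (fun k => t * a k + b k) + (t * l2sum a + t * l2sum b) =
    t * l2sum (fun k => a k + b k) + (t ^+ 2 * l2sum a + l2sum b).
  have : (l2e (fun k => (t * a k + b k)%R) + (t%:E * l2e a + t%:E * l2e b) =
      t%:E * l2e (fun k => (a k + b k)%R) + ((t ^+ 2)%:E * l2e a + l2e b))%E.
    have D (f h : I -> R) : (forall k, 0 <= f k) -> (forall k, 0 <= h k) ->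
        (\esum_(k in S) (f k)%:E + \esum_(k in S) (h k)%:E = \esum_(k in S) (f k + h k)%:E)%E.
      by move=> f0 h0; rewrite -esumD// => k _; rewrite lee_fin.
    have Z c (x : R) : 0 <= x -> (x%:E * l2e c = \esum_(k in S) (x * c k ^+ 2)%:E)%E.
      by move=> x0; rewrite /l2e -esumZ.
    rewrite !Z ?sqr_ge0// /l2e.
    have ta0 c k : 0 <= t * c k ^+ 2 by rewrite mulr_ge0 ?sqr_ge0.
    have tta0 c k : 0 <= t ^+ 2 * c k ^+ 2 by rewrite mulr_ge0 ?sqr_ge0.
    have s0 c k : 0 <= c k ^+ 2 :> R by exact: sqr_ge0.
    have tab0 k : 0 <= t * a k ^+ 2 + t * b k ^+ 2 by rewrite addr_ge0.
    have ttab0 k : 0 <= t ^+ 2 * a k ^+ 2 + b k ^+ 2 by rewrite addr_ge0.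
    rewrite (D _ _ (ta0 a) (ta0 b)) (D _ _ (tta0 a) (s0 b)) (D _ _ (s0 _) tab0) (D _ _ (ta0 _) ttab0).
    by apply: eq_esum => k _; congr EFin; ring.
  by rewrite -!l2sumE// -!EFinM -!EFinD => -[].
rewrite /l2pair l2sumZ//; move: E.
move: (l2sum _) (l2sum _) (l2sum _) (l2sum _) => w z y x E.
apply: (mulfI (_ : 2 != 0 :> R)) => //.
have -> : 2 * ((x - t ^+ 2 * y - z) / 2) = x - t ^+ 2 * y - z by field.
have -> : 2 * (t * ((w - y - z) / 2)) = t * (w - y - z) by field.
by rewrite (_ : x = t * w + (t ^+ 2 * y + z) - (t * y + t * z)); [ring|rewrite -E; ring].
Qed.

Lemma l2pairN a b : l2fin a -> l2fin b -> l2pair (fun k => - a k) b = - l2pair a b.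
Proof.
move=> fa fb.
have NE : (fun k => - a k) = (fun k => -1 * a k) by apply/funext => k; rewrite mulN1r.
have fna : l2fin (fun k => - a k) by rewrite NE; exact: l2finZ.
have := l2pairD fa fna fb.
rewrite (_ : (fun k => a k - a k) = (fun k => 0 * a k)); last by apply/funext => k; rewrite mul0r subrr.
by rewrite l2pairZ_ge0// mul0r => /esym/eqP; rewrite addrC addr_eq0 => /eqP.
Qed.

Lemma l2pairZ (t : R) a b : l2fin a -> l2fin b -> l2pair (fun k => t * a k) b = t * l2pair a b.
Proof.
move=> fa fb; have [t0|t0] := leP 0 t; first exact: l2pairZ_ge0.
have nt0 : 0 <= - t by lra.
have -> : (fun k => t * a k) = (fun k => - (- t * a k)).
  by apply/funext => k; rewrite mulNr opprK.
by rewrite l2pairN ?l2pairZ_ge0//; [rewrite mulNr opprK|exact: l2finZ].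
Qed.

Lemma l2pair_sqr a : l2fin a -> l2pair a a = l2sum a.
Proof.
move=> fa; rewrite /l2pair (_ : (fun k => a k + a k) = (fun k => 2 * a k)).
  by rewrite l2sumZ//; field.
by apply/funext => k; rewrite mulr_natl mulr2n.
Qed.

Lemma l2sumD a b : l2fin a -> l2fin b ->
  l2sum (fun k => a k + b k) = l2sum a + 2 * l2pair a b + l2sum b.
Proof. by move=> fa fb; rewrite /l2pair; field. Qed.

Lemma l2pair_le a b : l2fin a -> l2fin b -> 2 * l2pair a b <= l2sum a + l2sum b.
Proof.
move=> fa fb.
have fnb : l2fin (fun k => -1 * b k) by exact: l2finZ.
have := l2sum_ge0 (fun k => a k + -1 * b k); rewrite l2sumD// l2pairC l2pairZ// l2sumZ// l2pairC.
move: (l2pair _ _) (l2sum _) (l2sum _) => *; lra.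
Qed.

End l2_index.

Lemma l2pair_split (R : realType) (I : choiceType) (S : set I) (s : seq I) (a b : I -> R) :
  uniq s -> (forall k, k \in s -> S k) -> l2fin S a -> l2fin S b ->
  l2pair S a b = l2pair (S `\` [set` s]) a b + \sum_(k <- s) a k * b k.
Proof.
move=> us sS fa fb.
have E (c : I -> R) : l2fin S c -> l2fin (S `\` [set` s]) c /\
    l2sum S c = l2sum (S `\` [set` s]) c + \sum_(k <- s) c k ^+ 2.
  move=> fc.
  have sq0 k : (0 <= (c k ^+ 2)%:E)%E by rewrite lee_fin sqr_ge0.
  have h : l2e S c = (l2e (S `\` [set` s]) c + (\sum_(k <- s) c k ^+ 2)%:E)%E.
    rewrite /l2e (esumID [set` s]); last by move=> k _; exact: sq0.
    rewrite addeC; congr (_ + _)%E.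
    rewrite (_ : S `&` [set` s] = [set` s]); last first.
      by apply/seteqP; split=> k /=; [case|move=> ks; split=> //; exact: sS].
    rewrite esum_fset; [|exact: finite_seq|by move=> k _; exact: sq0].
    by rewrite -sumEFin; exact/esym/fsbig_seq.
  have f' : l2fin (S `\` [set` s]) c.
    by apply: le_lt_trans fc; rewrite h leeDl// lee_fin sumr_ge0// => k _; exact: sqr_ge0.
  by split=> //; apply: EFin_inj; rewrite EFinD !l2sumE.
have [fa' Ea] := E _ fa; have [fb' Eb] := E _ fb; have [_ Eab] := E _ (l2finD fa fb).
rewrite /l2pair Eab Ea Eb.
have -> : \sum_(k <- s) (a k + b k) ^+ 2 = \sum_(k <- s) a k ^+ 2 + 2 * (\sum_(k <- s) a k * b k) + \sum_(k <- s) b k ^+ 2.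
  rewrite mulr_sumr -!big_split; apply: eq_bigr => k _ /=; ring.
by field.
Qed.

(** * Real inner products and the trace formula *)

Section real_inner_product.
Context {R : realType}.
Local Notation mu := (@lebesgue_measure R).
Local Notation mu2 := (mu \x mu)%E.
Local Notation Re := complex.Re.
Local Notation Im := complex.Im.
Implicit Types (f g h : R -> R[i]).

Definition rscale (a : R) f : R -> R[i] := fun t => Complex (a * Re (f t)) (a * Im (f t)).
Definition muli f : R -> R[i] := fun t => Complex (- Im (f t)) (Re (f t)).
Definition sumf f g : R -> R[i] := fun t => f t + g t.

Lemma ReD (z w : R[i]) : Re (z + w) = Re z + Re w. Proof. by case: z; case: w. Qed.
Lemma ImD (z w : R[i]) : Im (z + w) = Im z + Im w. Proof. by case: z; case: w. Qed.

Lemma inL2_rscale a f : inL2 f -> inL2 (rscale a f).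
Proof. by move=> /inL2P[fr fi]; apply/inL2P; split; exact: L2Z. Qed.

Lemma inL2_muli f : inL2 f -> inL2 (muli f).
Proof. by move=> /inL2P[fr fi]; apply/inL2P; split => //; exact: L2N. Qed.

Lemma inL2_sumf f g : inL2 f -> inL2 g -> inL2 (sumf f g).
Proof.
move=> /inL2P[fr fi] /inL2P[gr gi]; apply/inL2P; rewrite /sumf; split.
- by under eq_fun do rewrite ReD; exact: L2D.
- by under eq_fun do rewrite ImD; exact: L2D.
Qed.

Lemma inL2_0 : inL2 (fun=> 0 : R[i]).
Proof. by apply/inL2P; split; exact: L2_0. Qed.

Lemma ripC f g : rip f g = rip g f.
Proof. by rewrite /rip ipC [X in _ + X]ipC. Qed.

Lemma ripDl f g h : inL2 f -> inL2 g -> inL2 h -> rip (sumf f g) h = rip f h + rip g h.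
Proof.
move=> /inL2P[fr fi] /inL2P[gr gi] /inL2P[hr hi]; rewrite /rip /sumf.
under eq_fun do rewrite ReD; under [X in _ + ip _ X _]eq_fun do rewrite ImD.
by rewrite !ipDl// addrACA.
Qed.

Lemma ripZl a f h : inL2 f -> inL2 h -> rip (rscale a f) h = a * rip f h.
Proof.
by move=> /inL2P[fr fi] /inL2P[hr hi]; rewrite /rip /rscale /= !ipZl// mulrDr.
Qed.

Lemma rip_muli f g : inL2 f -> inL2 g -> rip (muli f) (muli g) = rip f g.
Proof.
move=> /inL2P[fr fi] /inL2P[gr gi]; rewrite /rip /muli /= ipNl//; last exact: L2N.
by rewrite ipC ipNl// opprK ipC addrC.
Qed.

Lemma rip_ge0 f : 0 <= rip f f.
Proof. by rewrite addr_ge0// ip_ge0. Qed.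

Lemma rip0l h : inL2 h -> rip (fun=> 0) h = 0.
Proof.
move=> hL; rewrite (_ : (fun=> 0) = rscale 0 h); last first.
  by apply/funext => t; rewrite /rscale !mul0r.
by rewrite ripZl// mul0r.
Qed.

Lemma rip_sqrD f g : inL2 f -> inL2 g ->
  rip (sumf f g) (sumf f g) = rip f f + 2 * rip f g + rip g g.
Proof.
move=> fL gL; have dL := inL2_sumf fL gL.
by rewrite ripDl// (ripC f (sumf _ _)) (ripC g (sumf _ _)) !ripDl// (ripC g f); ring.
Qed.

Lemma rip_rscale a f : inL2 f -> rip (rscale a f) (rscale a f) = a ^+ 2 * rip f f.
Proof.
by move=> fL; have sL := inL2_rscale a fL; rewrite ripZl// ripC ripZl// mulrA.
Qed.

Lemma rip_le f h : inL2 f -> inL2 h -> 2 * `|rip f h| <= rip f f + rip h h.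
Proof.
have aux g k : inL2 g -> inL2 k -> 2 * rip g k <= rip g g + rip k k.
  move=> gL kL; have nk := inL2_rscale (-1) kL; have gk := inL2_sumf gL nk.
  have := rip_ge0 (sumf g (rscale (-1) k)).
  rewrite rip_sqrD// rip_rscale// (ripC g (rscale _ _)) ripZl// (ripC k g).
  by move: (rip g g) (rip g k) (rip k k) => x y z; lra.
move=> fL hL; have [_|_] := ger0P (rip f h); first exact: aux.
have := aux _ _ (inL2_rscale (-1) fL) hL; have nf := inL2_rscale (-1) fL.
by rewrite !ripZl// (ripC f (rscale _ _)) ripZl// !mulN1r opprK.
Qed.

Lemma l2innerE h f : inL2 h -> inL2 f -> l2inner h f = Complex (rip h f) (rip h (muli f)).
Proof.
move=> /inL2P[hr hi] /inL2P[fr fi]; rewrite /l2inner /cinteg; congr Complex.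
- rewrite /rip /ip -RintegralD//; last 2 first.
  + exact: L2_mul_integrable.
  + exact: L2_mul_integrable.
  by apply: eq_Rintegral => t _; rewrite /muli; case: (h t) => a b; case: (f t) => c d /=; ring.
- rewrite /rip /ip -RintegralD//; last 2 first.
  + by apply: L2_mul_integrable => //; exact: L2N.
  + exact: L2_mul_integrable.
  by apply: eq_Rintegral => t _; rewrite /muli; case: (h t) => a b; case: (f t) => c d /=; ring.
Qed.

Definition gauss_atom x y : R -> R[i] := tfshift x y (fun t => Complex (gauss t) 0).

Lemma inL2_gauss_atom x y : inL2 (gauss_atom x y).
Proof.
apply: inL2_tfshift; apply/inL2P; split => /=; last exact: L2_0.
by have := L2_gauss (0 : R); under eq_fun do rewrite subr0.
Qed.

Lemma rip_gauss_atom x y : rip (gauss_atom x y) (gauss_atom x y) = 1.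
Proof.
have L := inL2_gauss_atom x y.
rewrite -l2norm2E//; apply: EFin_inj; rewrite /l2norm2 -EFin_Rintegral.
  rewrite -[RHS](gauss_shift_sqr_integral x); apply: eq_integral => t _.
  by rewrite /gauss_atom /tfshift cabs2M cabs2_cexpi mul1r /cabs2 /= expr0n addr0.
have /inL2P[Lr Li] := L.
by apply: L1D; exact: L2_sqr_integrable.
Qed.

Lemma stft_atomE g x y : stft g x y = l2inner g (gauss_atom x y).
Proof.
rewrite /stft /l2inner; congr cinteg; apply/funext => t.
rewrite /gauss_atom /tfshift /cexpi cosN sinN; case: (g t) => a b.
by apply/eqP; rewrite eq_complex /=; apply/andP; split; apply/eqP; ring.
Qed.

Lemma Re_stft g x y : inL2 g -> Re (stft g x y) = rip g (gauss_atom x y).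
Proof. by move=> gL; rewrite stft_atomE l2innerE//; exact: inL2_gauss_atom. Qed.

Lemma Im_stft g x y : inL2 g -> Im (stft g x y) = rip g (muli (gauss_atom x y)).
Proof. by move=> gL; rewrite stft_atomE l2innerE//; exact: inL2_gauss_atom. Qed.

Lemma rip_mulil f h : inL2 f -> inL2 h -> rip (muli f) h = - rip f (muli h).
Proof.
move=> fL hL; have fi := inL2_muli fL; have hi := inL2_muli hL.
rewrite -rip_muli// (_ : muli (muli f) = rscale (-1) f); first by rewrite ripZl// mulN1r.
by apply/funext => t; rewrite /muli /rscale !mulN1r.
Qed.

Lemma cabs2_l2innerC f h : inL2 f -> inL2 h -> cabs2 (l2inner f h) = cabs2 (l2inner h f).
Proof.
move=> fL hL; rewrite !l2innerE// /cabs2 /= (ripC f h); congr (_ + _).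
by rewrite ripC rip_mulil// sqrrN.
Qed.

Definition rlin m (e : 'I_m -> R) (F : 'I_m -> R -> R[i]) : R -> R[i] :=
  fun t => \sum_i rscale (e i) (F i) t.

Lemma rlin_closed m (e : 'I_m -> R) (F : 'I_m -> R -> R[i]) :
  (forall i, inL2 (F i)) ->
  inL2 (rlin e F) /\ (forall h, inL2 h -> rip (rlin e F) h = \sum_i e i * rip (F i) h).
Proof.
move=> FL.
suff H (s : seq 'I_m) : inL2 (fun t => \sum_(i <- s) rscale (e i) (F i) t) /\
    (forall h, inL2 h -> rip (fun t => \sum_(i <- s) rscale (e i) (F i) t) h =
      \sum_(i <- s) e i * rip (F i) h) by exact: H.
elim: s => [|i s [IL IE]].
  rewrite (_ : (fun t => \sum_(i <- [::]) rscale (e i) (F i) t) = (fun=> 0)); last first.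
    by apply/funext => t; rewrite big_nil.
  by split => [|h hL]; [exact: inL2_0|rewrite rip0l// big_nil].
rewrite (_ : (fun t => \sum_(j <- i :: s) rscale (e j) (F j) t) =
  sumf (rscale (e i) (F i)) (fun t => \sum_(j <- s) rscale (e j) (F j) t)); last first.
  by apply/funext => t; rewrite big_cons.
have sL := inL2_rscale (e i) (FL i).
split => [|h hL]; first exact: inL2_sumf.
by rewrite ripDl// ripZl// IE// big_cons.
Qed.

Lemma inL2_rlin m (e : 'I_m -> R) (F : 'I_m -> R -> R[i]) :
  (forall i, inL2 (F i)) -> inL2 (rlin e F).
Proof. by move=> FL; have [] := rlin_closed e FL. Qed.

Lemma rip_rlin m (e : 'I_m -> R) (F : 'I_m -> R -> R[i]) h :
  (forall i, inL2 (F i)) -> inL2 h -> rip (rlin e F) h = \sum_i e i * rip (F i) h.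
Proof. by move=> FL hL; have [_] := rlin_closed e FL; exact. Qed.

Definition gram m (F : 'I_m -> R -> R[i]) : 'M[R]_m := \matrix_(i, j) rip (F i) (F j).

Lemma gram_sym m (F : 'I_m -> R -> R[i]) i j : gram F i j = gram F j i.
Proof. by rewrite !mxE ripC. Qed.

Lemma rip_rlin_sqr m (e : 'I_m -> R) (F : 'I_m -> R -> R[i]) :
  (forall i, inL2 (F i)) -> rip (rlin e F) (rlin e F) = qform (gram F) e.
Proof.
move=> FL; rewrite rip_rlin//; last exact: inL2_rlin.
apply: eq_bigr => i _; rewrite ripC rip_rlin// mulr_sumr; apply: eq_bigr => j _.
by rewrite mxE (ripC (F j)); ring.
Qed.

Lemma rip_sub_rlin m (e : 'I_m -> R) (F : 'I_m -> R -> R[i]) h :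
  (forall i, inL2 (F i)) -> inL2 h ->
  rip (sumf h (rscale (-1) (rlin e F))) (sumf h (rscale (-1) (rlin e F))) =
  rip h h - 2 * (\sum_i rip (F i) h * e i) + qform (gram F) e.
Proof.
move=> FL hL; have lL := inL2_rlin e FL; have nl := inL2_rscale (-1) lL.
rewrite rip_sqrD// rip_rscale// (ripC h (rscale _ _)) ripZl// rip_rlin_sqr//.
rewrite rip_rlin// (eq_bigr (fun i => rip (F i) h * e i)) => [|i _]; last by rewrite mulrC.
ring.
Qed.

End real_inner_product.

(** * Exchanging two planar integrals *)

Section tonelli_square.
Context d (T : measurableType d) (R : realType) (m : {sigma_finite_measure set T -> \bar R}).
Local Notation m2 := (m \x m)%E.
Local Open Scope ereal_scope.

Lemma product_integralE (H : T * T -> \bar R) : measurable_fun setT H -> (forall z, 0 <= H z) ->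
  \int[m2]_z H z = \int[m]_x \int[m]_y H (x, y).
Proof. by move=> mH H0; rewrite fubini_tonelli1. Qed.

Lemma measurable_prod_integral d' (S : measurableType d') (G : S * (T * T) -> \bar R) :
  measurable_fun setT G -> (forall q, 0 <= G q) ->
  measurable_fun setT (fun s => \int[m2]_z G (s, z)).
Proof.
move=> mG G0.
have mq : measurable_fun setT (fun q : (S * T) * T => (q.1.1, (q.1.2, q.2))).
  have m11 : measurable_fun setT (fun q : (S * T) * T => q.1.1) := measurableT_comp measurable_fst measurable_fst.
  have m12 : measurable_fun setT (fun q : (S * T) * T => q.1.2) := measurableT_comp measurable_snd measurable_fst.
  apply/measurable_fun_pair => //; apply/measurable_fun_pair => //.
have mG' := measurableT_comp mG mq.
have h1 := measurable_fun_fubini_tonelli_F (m2 := m) _ mG' (fun q => G0 _).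
have h10 (q : S * T) : 0 <= \int[m]_y G (q.1, (q.2, y)) by apply: integral_ge0.
have h2 := measurable_fun_fubini_tonelli_F (m2 := m) (fun q : S * T => \int[m]_y G (q.1, (q.2, y))) h1 h10.
suff -> : (fun s => \int[m2]_z G (s, z)) = fun s => \int[m]_x \int[m]_y G (s, (x, y)) by exact: h2.
apply/funext => s; apply: product_integralE => //.
by apply: measurableT_comp => //; exact: measurable_pair1.
Qed.

Lemma tonelli_mixed (G : T * (T * T) -> \bar R) :
  measurable_fun setT G -> (forall q, 0 <= G q) ->
  \int[m]_x \int[m2]_z G (x, z) = \int[m2]_z \int[m]_x G (x, z).
Proof.
move=> mG G0.
have mG1 := measurable_fun_fubini_tonelli_G (m1 := m) _ mG G0.
have mq : measurable_fun setT (fun q : (T * T) * T => (q.1.1, (q.1.2, q.2))).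
  have m11 : measurable_fun setT (fun q : (T * T) * T => q.1.1) := measurableT_comp measurable_fst measurable_fst.
  have m12 : measurable_fun setT (fun q : (T * T) * T => q.1.2) := measurableT_comp measurable_snd measurable_fst.
  apply/measurable_fun_pair => //; apply/measurable_fun_pair => //.
have mG' := measurableT_comp mG mq.
have h1 := measurable_fun_fubini_tonelli_F (m2 := m) _ mG' (fun q => G0 _).
have h10 (q : T * T) : 0 <= \int[m]_y G (q.1, (q.2, y)) by apply: integral_ge0.
transitivity (\int[m]_x \int[m]_y \int[m]_t G (x, (y, t))).
  apply: eq_integral => x _; apply: product_integralE => //.
  by apply: measurableT_comp => //; exact: measurable_pair1.
rewrite (fubini_tonelli (m1 := m) (m2 := m) (fun q : T * T => \int[m]_y G (q.1, (q.2, y))) h1 h10).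
have h20 (z : T * T) : 0 <= \int[m]_x G (x, z) by apply: integral_ge0.
transitivity (\int[m]_y \int[m]_t \int[m]_x G (x, (y, t))); last first.
  exact: esym (product_integralE (H := fun z => \int[m]_x G (x, z)) mG1 h20).
apply: eq_integral => y _.
have mq2 : measurable_fun setT (fun q : T * T => (q.1, (y, q.2))).
  by apply/measurable_fun_pair => //; apply/measurable_fun_pair.
exact: (fubini_tonelli (m1 := m) (m2 := m) (fun q : T * T => G (q.1, (y, q.2))) (measurableT_comp mG mq2) (fun q => G0 _)).
Qed.

Variable F : (T * T) * (T * T) -> \bar R.
Hypotheses (mF : measurable_fun setT F) (F0 : forall q, 0 <= F q).

(** The pair of variables in [w] is moved past [z] one coordinate at a time, each move being an
    instance of [tonelli_mixed]. *)
Lemma tonelli_square :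
  \int[m2]_w \int[m2]_z F (w, z) = \int[m2]_z \int[m2]_w F (w, z).
Proof.
have I0 w : 0 <= \int[m2]_z F (w, z) by apply: integral_ge0.
rewrite (product_integralE (measurable_prod_integral mF F0) I0).
have mq (x : T) : measurable_fun setT (fun q : T * (T * T) => ((x, q.1), q.2)).
  by apply/measurable_fun_pair => //; apply/measurable_fun_pair.
transitivity (\int[m]_x \int[m2]_z \int[m]_y F ((x, y), z)).
  apply: eq_integral => x _.
  exact: (tonelli_mixed (measurableT_comp mF (mq x)) (fun q => F0 _)).
have mp : measurable_fun setT (fun q : (T * (T * T)) * T => ((q.1.1, q.2), q.1.2)).
  have m11 : measurable_fun setT (fun q : (T * (T * T)) * T => q.1.1) := measurableT_comp measurable_fst measurable_fst.
  have m12 : measurable_fun setT (fun q : (T * (T * T)) * T => q.1.2) := measurableT_comp measurable_snd measurable_fst.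
  by apply/measurable_fun_pair => //; apply/measurable_fun_pair.
have h := measurable_fun_fubini_tonelli_F (m2 := m) _ (measurableT_comp mF mp) (fun q => F0 _).
have h0 (q : T * (T * T)) : 0 <= \int[m]_y F ((q.1, y), q.2) by apply: integral_ge0.
rewrite (tonelli_mixed (G := fun q => \int[m]_y F ((q.1, y), q.2)) h h0).
apply: eq_integral => z _.
have mFz : measurable_fun setT (fun w => F (w, z)).
  by apply: measurableT_comp => //; exact: measurable_pair2.
exact: esym (product_integralE (H := fun w => F (w, z)) mFz (fun w => F0 _)).
Qed.

End tonelli_square.

Section has_integral.
Context d (T : measurableType d) (R : realType) (m : {measure set T -> \bar R}).
Implicit Types (F G : T -> R) (x y : R).

(** Integrability is bundled with the value, so that both pass through finite sums in a single
    induction. *)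
Definition hasint F x := m.-integrable setT (EFin \o F) /\ (\int[m]_t F t)%R = x.

Lemma hasintD F G x y : hasint F x -> hasint G y -> hasint (fun t => F t + G t) (x + y).
Proof.
move=> [iF <-] [iG <-]; split; last by rewrite RintegralD.
by have := integrableD measurableT iF iG; apply: eq_integrable => // t _ /=; rewrite EFinD.
Qed.

Lemma hasintZ a F x : hasint F x -> hasint (fun t => a * F t) (a * x).
Proof.
move=> [iF <-]; split; last by rewrite RintegralZl.
by have := integrableZl measurableT a iF; apply: eq_integrable => // t _ /=; rewrite EFinM.
Qed.

Lemma hasint_sum (J : Type) (s : seq J) (F : J -> T -> R) (x : J -> R) :
  (forall j, hasint (F j) (x j)) -> hasint (fun t => \sum_(j <- s) F j t) (\sum_(j <- s) x j).
Proof.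
move=> H; elim: s => [|j s IH].
  rewrite big_nil (_ : (fun _ => _) = fun=> 0); last by apply/funext => t; rewrite big_nil.
  split; first exact: integrable0.
  by rewrite /Rintegral integral0.
rewrite big_cons (_ : (fun _ => _) = fun t => F j t + \sum_(j <- s) F j t).
  exact: hasintD.
by apply/funext => t; rewrite big_cons.
Qed.

Lemma hasint_mul F G : L2 m F -> L2 m G -> hasint (fun t => F t * G t) (ip m F G).
Proof. by move=> fL gL; split=> //; exact: L2_mul_integrable. Qed.

End has_integral.

(** * Integrated quadratic forms of time-frequency coefficients; [T] will be a translation or a
    point reflection of the plane *)

Section trace_formula.
Context {R : realType}.
Local Notation mu := (@lebesgue_measure R).
Local Notation mu2 := (mu \x mu)%E.
Variable T : R * R -> R * R.
Hypothesis mT : measurable_fun setT T.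
Hypothesis T_isometry : forall g : R -> R[i], inL2 g ->
  (\int[mu2]_z (cabs2 (stft g (T z).1 (T z).2))%:E = (rip g g)%:E)%E.
Implicit Types (f g : R -> R[i]).

Definition coefr (F : R -> R[i]) (z : R * R) : R := rip F (gauss_atom z.1 z.2).
Definition coefi (F : R -> R[i]) (z : R * R) : R := rip F (muli (gauss_atom z.1 z.2)).

Lemma cabs2_stftE g z : inL2 g -> cabs2 (stft g z.1 z.2) = coefr g z ^+ 2 + coefi g z ^+ 2.
Proof. by move=> gL; rewrite /cabs2 Re_stft// Im_stft. Qed.

Lemma measurable_coefr g : inL2 g -> measurable_fun setT (fun z => coefr g (T z)).
Proof.
move=> gL; have h := measurableT_comp (measurable_Re_stft gL) mT.
suff -> : (fun z : R * R => coefr g (T z)) = (fun z : R * R => complex.Re (stft g z.1 z.2)) \o T by [].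
by apply/funext => z; rewrite /coefr -Re_stft.
Qed.

Lemma measurable_coefi g : inL2 g -> measurable_fun setT (fun z => coefi g (T z)).
Proof.
move=> gL; have h := measurableT_comp (measurable_Im_stft gL) mT.
suff -> : (fun z : R * R => coefi g (T z)) = (fun z : R * R => complex.Im (stft g z.1 z.2)) \o T by [].
by apply/funext => z; rewrite /coefi -Im_stft.
Qed.

Lemma L2_coef g : inL2 g -> L2 mu2 (fun z => coefr g (T z)) /\ L2 mu2 (fun z => coefi g (T z)).
Proof.
move=> gL; have mr := measurable_coefr gL; have mi := measurable_coefi gL.
have fin : (\int[mu2]_z (coefr g (T z) ^+ 2 + coefi g (T z) ^+ 2)%:E < +oo)%E.
  under eq_integral do rewrite -cabs2_stftE//.
  by rewrite T_isometry// ltry.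
split; split=> //; apply: le_lt_trans fin; apply: ge0_le_integral => //.
- by move=> z _; rewrite lee_fin sqr_ge0.
- by meas.
- by meas.
- by move=> z _; rewrite lee_fin lerDl sqr_ge0.
- by move=> z _; rewrite lee_fin sqr_ge0.
- by meas.
- by meas.
- by move=> z _; rewrite lee_fin lerDr sqr_ge0.
Qed.

Lemma ip_coef g : inL2 g ->
  ip mu2 (fun z => coefr g (T z)) (fun z => coefr g (T z)) +
  ip mu2 (fun z => coefi g (T z)) (fun z => coefi g (T z)) = rip g g.
Proof.
move=> gL; have [rL iL] := L2_coef gL; have [[mr _] [mi _]] := (rL, iL).
apply: EFin_inj; rewrite -(T_isometry gL) EFinD.
have e1 := esym (ip_sqr rL); have e2 := esym (ip_sqr iL).
apply: etrans (f_equal2 (fun x y => (x + y)%E) e1 e2) _; clear e1 e2.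
rewrite -ge0_integralD//; last 4 first.
- by move=> z _; rewrite lee_fin sqr_ge0.
- by meas.
- by move=> z _; rewrite lee_fin sqr_ge0.
- by meas.
by apply: eq_integral => z _; rewrite cabs2_stftE.
Qed.

Lemma ip_coef_polar f g : inL2 f -> inL2 g ->
  ip mu2 (fun z => coefr f (T z)) (fun z => coefr g (T z)) +
  ip mu2 (fun z => coefi f (T z)) (fun z => coefi g (T z)) = rip f g.
Proof.
move=> fL gL; have [fr fi] := L2_coef fL; have [gr gi] := L2_coef gL.
have := ip_coef (inL2_sumf fL gL).
have Er : (fun z : R * R => coefr (sumf f g) (T z)) = (fun z : R * R => coefr f (T z) + coefr g (T z)).
  by apply/funext => z; rewrite /coefr ripDl//; exact: inL2_gauss_atom.
have Ei : (fun z : R * R => coefi (sumf f g) (T z)) = (fun z : R * R => coefi f (T z) + coefi g (T z)).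
  by apply/funext => z; rewrite /coefi ripDl//; apply: inL2_muli; exact: inL2_gauss_atom.
rewrite Er Ei (ip_sqrD fr gr) (ip_sqrD fi gi) rip_sqrD// -(ip_coef fL) -(ip_coef gL).
move: (ip _ _ _) (ip _ _ _) (ip _ _ _) (ip _ _ _) (ip _ _ _) (ip _ _ _) (rip f g) => *; lra.
Qed.

(** By the polarized isometry each product of coefficients integrates to a Gram entry. When [M] is
    the inverse Gram matrix the value is the trace of the identity. *)
Lemma qform_coef_integral m (F : 'I_m -> R -> R[i]) (M : 'M[R]_m) : (forall i, inL2 (F i)) ->
  hasint mu2 (fun z => qform M (fun i => coefr (F i) (T z)) + qform M (fun i => coefi (F i) (T z)))
    (\sum_i \sum_j M i j * gram F i j).
Proof.
move=> FL.
have H (c : (R -> R[i]) -> R * R -> R) : (forall i, L2 mu2 (fun z => c (F i) (T z))) ->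
    hasint mu2 (fun z => qform M (fun i => c (F i) (T z)))
      (\sum_i \sum_j M i j * ip mu2 (fun z => c (F i) (T z)) (fun z => c (F j) (T z))).
  move=> cL; apply: hasint_sum => i; apply: hasint_sum => j.
  rewrite (_ : (fun _ => _) = fun z => M i j * (c (F i) (T z) * c (F j) (T z))).
    by apply: hasintZ; exact: hasint_mul.
  by apply/funext => z; rewrite mulrA.
have := hasintD (H coefr (fun i => (L2_coef (FL i)).1)) (H coefi (fun i => (L2_coef (FL i)).2)).
congr hasint; rewrite -big_split; apply: eq_bigr => i _ /=.
by rewrite -big_split; apply: eq_bigr => j _ /=; rewrite -mulrDr ip_coef_polar// mxE.
Qed.

End trace_formula.

(** * Sums over separated sets and the leakage integral *)

Section discrete_sums.
Context {R : realType} (N : nat).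
Local Notation mu := (@lebesgue_measure R).
Local Notation mu2 := (mu \x mu)%E.
Local Notation key := ('I_N * (R * R))%type.

(** Here x^2 + y^2 <= 8 rho^2 < 9 rho^2 <= delta^2; the factor 3 is an integer above the square root
    of 8. *)
Lemma close_not_separated (rho delta x y : R) : 0 < rho -> 3 * rho <= delta ->
  `|x| <= 2 * rho -> `|y| <= 2 * rho -> delta < Num.sqrt (x ^+ 2 + y ^+ 2) -> False.
Proof.
move=> r0 rd x2 y2 h.
have d0 : 0 < delta by lra.
have s0 : 0 <= x ^+ 2 + y ^+ 2 by rewrite addr_ge0 ?sqr_ge0.
have h2 : delta ^+ 2 < x ^+ 2 + y ^+ 2.
  by rewrite -(sqr_sqrtr s0) ltrXn2r// ltW.
have X : x ^+ 2 <= (2 * rho) ^+ 2 by rewrite -real_normK ?num_real// lerXn2r ?nnegrE//; lra.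
have Y : y ^+ 2 <= (2 * rho) ^+ 2 by rewrite -real_normK ?num_real// lerXn2r ?nnegrE//; lra.
have D : (3 * rho) ^+ 2 <= delta ^+ 2 by rewrite lerXn2r ?nnegrE//; lra.
by have := sqr_ge0 rho; move: h2 X Y D; rewrite !exprMn; lra.
Qed.

Lemma box2_neq0 rho (z : R * R) : box2 rho z != 0 -> `|z.1| <= rho /\ `|z.2| <= rho.
Proof.
rewrite /box2 /box mulf_eq0 negb_or !ler_norml.
by case: (- rho <= z.1 <= rho); case: (- rho <= z.2 <= rho); rewrite /= ?eqxx ?andbF.
Qed.

Lemma box2_le1 rho (z : R * R) : box2 rho z <= 1.
Proof.
rewrite /box2 /box; case: (_ <= _ <= _); case: (_ <= _ <= _); by rewrite ?mulr1 ?mulr0 ?mul0r.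
Qed.

Lemma box2_1 rho (z : R * R) : `|z.1| <= rho -> `|z.2| <= rho -> box2 rho z = 1.
Proof. by rewrite /box2 /box !ler_norml => -> ->; rewrite mulr1. Qed.

(** Boxes about separated centres are disjoint, so at most one term of the sum is nonzero at [w]. *)
Lemma packing_le (t : seq key) (c : key -> R * R) (n : 'I_N) (rho delta W : R) (w : R * R) :
  uniq t -> 0 < rho -> 3 * rho <= delta -> 0 <= W ->
  (forall k l, k \in t -> l \in t -> k.1 = n -> l.1 = n -> k <> l ->
    delta < Num.sqrt (((c k).1 - (c l).1) ^+ 2 + ((c k).2 - (c l).2) ^+ 2)) ->
  (forall k, k \in t -> box2 rho (w.1 - (c k).1, w.2 - (c k).2) <= W) ->
  \sum_(k <- t | k.1 == n) box2 rho (w.1 - (c k).1, w.2 - (c k).2) <= W.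
Proof.
move=> ut r0 rd W0 sep bW.
pose b k := box2 rho (w.1 - (c k).1, w.2 - (c k).2).
have [/hasP[k kt /andP[/eqP kn bk]]|] := boolP (has (fun k => (k.1 == n) && (b k != 0)) t); last first.
  rewrite -all_predC => /allP h; rewrite big_seq_cond big1// => k /andP[kt kn].
  by have := h _ kt; rewrite /= kn /= negbK => /eqP.
rewrite -big_filter (bigD1_seq k) ?filter_uniq// ?mem_filter ?kn ?eqxx//=.
rewrite big_seq_cond big1 ?addr0; first exact: bW.
move=> l /andP[]; rewrite mem_filter => /andP[/eqP ln lt] lk; apply/eqP; apply: contraT => bl; exfalso.
have [/= k1 k2] := box2_neq0 bk; have [/= l1 l2] := box2_neq0 bl.
have := sep k l kt lt kn ln; move: lk => /eqP lk /(_ (fun e => lk (esym e))).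
apply: (close_not_separated r0 rd).
- rewrite (_ : (c k).1 - (c l).1 = (w.1 - (c l).1) - (w.1 - (c k).1)); last by ring.
  by apply: le_trans (ler_normB _ _) _; lra.
- rewrite (_ : (c k).2 - (c l).2 = (w.2 - (c l).2) - (w.2 - (c k).2)); last by ring.
  by apply: le_trans (ler_normB _ _) _; lra.
Qed.

(** Each term is replaced by its mean value integral, and within one family the boxes add up to at
    most [W]. The terms are grouped by [n] first, because points of different families may be
    arbitrarily close or coincide. [W] will be the indicator of the inner square for Riesz
    sequences, and of the complement of the outer square for frames. *)
Lemma discrete_sum_le (t : seq key) (c : key -> R * R) (rho C0 : R) (delta : 'I_N -> R)
    (K : 'I_N -> R * R -> R) (W : R * R -> R) :
  uniq t -> 0 < rho -> (forall n, 3 * rho <= delta n) -> 0 <= C0 ->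
  (forall k l, k \in t -> l \in t -> k.1 = l.1 -> k <> l ->
    delta k.1 < Num.sqrt (((c k).1 - (c l).1) ^+ 2 + ((c k).2 - (c l).2) ^+ 2)) ->
  measurable_fun setT W -> (forall w, 0 <= W w) ->
  (forall k w, k \in t -> box2 rho (w.1 - (c k).1, w.2 - (c k).2) <= W w) ->
  (forall n, measurable_fun setT (K n)) -> (forall n w, 0 <= K n w) ->
  (forall n (l : R * R), ((K n l)%:E <= C0%:E *
     \int[mu2]_w (box2 rho (w.1 - l.1, w.2 - l.2) * K n w)%:E)%E) ->
  ((\sum_(k <- t) K k.1 (c k))%:E <= C0%:E * \sum_n \int[mu2]_w (W w * K n w)%:E)%E.
Proof.
move=> ut r0 rd C00 sep mW W0 bW mK K0 loc.
have mb (l : R * R) : measurable_fun setT (fun w : R * R => box2 rho (w.1 - l.1, w.2 - l.2)).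
  have mq : measurable_fun setT (fun w : R * R => (w.1 - l.1, w.2 - l.2)).
    by apply/measurable_fun_pair; meas.
  exact: (measurableT_comp (measurable_box2 rho) mq).
rewrite -sumEFin; apply: (@le_trans _ _ (\sum_(k <- t) (C0%:E *
     \int[mu2]_w (box2 rho (w.1 - (c k).1, w.2 - (c k).2) * K k.1 w)%:E))%E).
  by apply: lee_sum => k _; exact: loc.
rewrite -ge0_sume_distrr; last first.
  by move=> k _; apply: integral_ge0 => w _; rewrite lee_fin mulr_ge0 ?box2_ge0.
apply: lee_wpmul2l; first by rewrite lee_fin.
rewrite (partition_big (fun k : key => k.1) xpredT)//=.
apply: lee_sum => n _.
rewrite (eq_bigr (fun k : key => \int[mu2]_w (box2 rho (w.1 - (c k).1, w.2 - (c k).2) * K n w)%:E)%E); last first.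
  by move=> k /eqP ->.
rewrite -big_filter -ge0_integral_sum//; last 2 first.
- by move=> k; apply/measurable_EFinP; exact: measurable_funM (mb _) (mK n).
- by move=> k w _; rewrite lee_fin mulr_ge0 ?box2_ge0.
apply: ge0_le_integral => //.
- by move=> w _; apply: sume_ge0 => k _; rewrite lee_fin mulr_ge0 ?box2_ge0.
- by apply: emeasurable_sum => k; apply/measurable_EFinP; exact: measurable_funM (mb _) (mK n).
- by apply/measurable_EFinP; exact: measurable_funM mW (mK n).
move=> w _; rewrite big_filter sumEFin lee_fin -mulr_suml ler_wpM2r//.
apply: (packing_le (delta := delta n)) => // [k l kt lt kn ln kl|k kt]; last exact: bW.
by have := sep k l kt lt; rewrite kn ln => /(_ erefl kl).
Qed.

End discrete_sums.

(** * I_G as a double integral over the whole plane *)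

Section leakage.
Context {R : realType}.
Local Notation mu := (@lebesgue_measure R).
Local Notation mu2 := (mu \x mu)%E.
Implicit Types (g : R -> R[i]) (r : R) (w z : R * R).

(** The first point is the one subtracted, that is, the one inside the square in I_G. *)
Definition gap g w z : R := cabs2 (stft g (z.1 - w.1) (z.2 - w.2)).

Lemma gap_ge0 g w z : 0 <= gap g w z. Proof. exact: cabs2_ge0. Qed.

Lemma measurable_gap g : inL2 g ->
  measurable_fun setT (fun q : (R * R) * (R * R) => gap g q.1 q.2).
Proof.
move=> gL.
have mq : measurable_fun setT (fun q : (R * R) * (R * R) => (q.2.1 - q.1.1, q.2.2 - q.1.2)).
  have m11 : measurable_fun setT (fun q : (R * R) * (R * R) => q.1.1) := measurableT_comp measurable_fst measurable_fst.
  have m12 : measurable_fun setT (fun q : (R * R) * (R * R) => q.1.2) := measurableT_comp measurable_snd measurable_fst.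
  have m21 : measurable_fun setT (fun q : (R * R) * (R * R) => q.2.1) := measurableT_comp measurable_fst measurable_snd.
  have m22 : measurable_fun setT (fun q : (R * R) * (R * R) => q.2.2) := measurableT_comp measurable_snd measurable_snd.
  by apply/measurable_fun_pair; apply: measurable_funB.
exact: (measurableT_comp (measurable_cabs2_stft gL) mq).
Qed.

(** The domain of I_G is encoded by factors with values 0 and 1, so that all integrals run over the
    full plane and can be exchanged by [tonelli_square]. *)
Definition leak_density g r (q : (R * R) * (R * R)) : R :=
  box2 r q.1 * (1 - box2 (r + 4^-1) q.2) * gap g q.1 q.2.

Lemma leak_density_ge0 g r q : 0 <= leak_density g r q.
Proof. by rewrite !mulr_ge0 ?box2_ge0 ?gap_ge0// subr_ge0 box2_le1. Qed.

Lemma measurable_leak_density g r : inL2 g -> measurable_fun setT (EFin \o leak_density g r).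
Proof.
move=> gL; have mb := @measurable_box2 R; apply/measurable_EFinP.
apply: measurable_funM; last exact: measurable_gap.
apply: measurable_funM; first exact: (measurableT_comp (mb r) measurable_fst).
apply: measurable_funB; first exact: measurable_cst.
exact: (measurableT_comp (mb (r + 4^-1)) measurable_snd).
Qed.

Definition leak g r : \bar R := (\int[mu2]_w \int[mu2]_z (leak_density g r (w, z))%:E)%E.

Lemma leak_swap g r : inL2 g ->
  leak g r = (\int[mu2]_z \int[mu2]_w (leak_density g r (w, z))%:E)%E.
Proof.
move=> gL; have m := measurable_leak_density r gL.
have D0 q : (0 <= (EFin \o leak_density g r) q)%E by rewrite lee_fin leak_density_ge0.
exact: (@tonelli_square _ _ R mu _ m D0).
Qed.

Lemma integral_boole (b : bool) d (T : measurableType d) (m : {measure set T -> \bar R})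
    (H : T -> \bar R) : ((b%:R)%:E * \int[m]_x H x = \int[m]_x ((b%:R)%:E * H x))%E.
Proof.
case: b; first by rewrite mul1e; apply: eq_integral => x _; rewrite mul1e.
by rewrite mul0e; under eq_integral do rewrite mul0e; rewrite integral0.
Qed.

Lemma integral_restrict (b : R -> bool) (D : set R) (H : R -> \bar R) :
  (forall x, D x <-> b x) ->
  (\int[mu]_(x in D) H x = \int[mu]_x (((b x)%:R)%:E * H x))%E.
Proof.
move=> Db; rewrite integral_mkcond; apply: eq_integral => x _; rewrite patchE.
case: ifPn => [|]; first by rewrite inE => /Db ->; rewrite mul1e.
by rewrite notin_setE => nD; case: (boolP (b x)) => [/Db//|_]; rewrite mul0e.
Qed.

Lemma IG_leak g r : inL2 g -> IG (stft g) r = leak g r.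
Proof.
move=> gL; have mD := measurable_leak_density r gL.
have D0 q : (0 <= (leak_density g r q)%:E)%E by rewrite lee_fin leak_density_ge0.
have mF : measurable_fun setT (fun w : R * R => \int[mu2]_z (leak_density g r (w, z))%:E)%E.
  exact: (@measurable_prod_integral _ _ R mu _ _ _ mD D0).
have F0 w : (0 <= \int[mu2]_z (leak_density g r (w, z))%:E)%E by apply: integral_ge0 => z _; exact: D0.
rewrite /leak (int2E mF F0).
rewrite /IG (integral_restrict (b := fun x => - r <= x <= r)); last by move=> x; rewrite /= in_itv.
apply: eq_integral => x _.
rewrite (integral_restrict (b := fun y => - r <= y <= r)); last by move=> y; rewrite /= in_itv.
rewrite integral_boole; apply: eq_integral => y _.
have mp : measurable_fun setT (fun z : R * R => ((x, y), z)) by exact: measurable_fun_pair.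
rewrite (int2E (measurableT_comp mD mp) (fun z => D0 ((x, y), z))).
rewrite !integral_boole; apply: eq_integral => t _.
rewrite (integral_restrict (b := fun s => ~~ ((- (r + 4^-1) <= t <= r + 4^-1) && (- (r + 4^-1) <= s <= r + 4^-1)))); last first.
  move=> s; rewrite /Qsq /= !subr0 !ler_norml.
  by split; [move=> h; apply/negP => /andP|move=> /negP h [h1 h2]; apply: h; rewrite h1].
rewrite !integral_boole; apply: eq_integral => s _.
rewrite -!EFinM; congr EFin; rewrite /leak_density /gap /= !mulrA; congr (_ * _); congr (_ * _ * _).
by rewrite /box2 /box /=; case: (_ <= _ <= _); case: (_ <= _ <= _); rewrite /= ?mulr1 ?mulr0 ?mul0r ?subrr ?subr0.
Qed.

End leakage.

Section real_family.
Context {R : realType}.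
Local Notation mu := (@lebesgue_measure R).
Local Notation mu2 := (mu \x mu)%E.

Definition real_family n (F : 'I_n -> R -> R[i]) (j : 'I_(n + n)) : R -> R[i] :=
  match fintype.split j with inl i => F i | inr i => muli (F i) end.

Lemma real_familyl n (F : 'I_n -> R -> R[i]) i : real_family F (lshift n i) = F i.
Proof. by rewrite /real_family (unsplitK (inl _ i)). Qed.

Lemma real_familyr n (F : 'I_n -> R -> R[i]) i : real_family F (rshift n i) = muli (F i).
Proof. by rewrite /real_family (unsplitK (inr _ i)). Qed.

Lemma inL2_real_family n (F : 'I_n -> R -> R[i]) :
  (forall i, inL2 (F i)) -> forall j, inL2 (real_family F j).
Proof. by move=> FL j; rewrite /real_family; case: (fintype.split j) => i //; exact: inL2_muli. Qed.

(** Real coefficients on the doubled family are the real and imaginary parts of complex coefficients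
    on the original one, so the lower Riesz bound is coercivity of the real Gram form. *)
Lemma riesz_coercive (I : eqType) (S : set I) (f : I -> R -> R[i]) (A B : R) (s : seq I) :
  is_riesz_seq S f A B -> (forall k, S k -> inL2 (f k)) -> uniq s -> (forall k, k \in s -> S k) ->
  forall e, A * (\sum_j e j ^+ 2) <=
    qform (gram (real_family (fun i => f (tnth (in_tuple s) i)))) e.
Proof.
move=> rs fL us sS e; set F := fun i => f (tnth (in_tuple s) i).
have FL i : inL2 (F i) by apply/fL/sS; rewrite mem_tnth.
have GL := inL2_real_family FL.
pose e' i := Complex (e (lshift _ i)) (e (rshift _ i)).
(* The Riesz condition wants coefficients indexed by keys, not by positions; as [s] has no
   repetitions, the sum has a single term at every key of [s]. *)
pose c k := \sum_(i | tnth (in_tuple s) i == k) e' i.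
have cE i : c (tnth (in_tuple s) i) = e' i.
  rewrite /c (big_pred1 i)// => j; apply/eqP/eqP => [|->//].
  by have /tuple_uniqP inj : uniq (in_tuple s) := us; exact: inj.
rewrite -rip_rlin_sqr// -l2norm2E; last exact: inL2_rlin.
have [+ _] := andP (rs s c us sS).
congr (_ * _ <= _).
  rewrite big_tnth [RHS]big_split_ord -[RHS]big_split; apply: eq_bigr => i _ /=.
  by rewrite cE /cabs2 /e'.
congr l2norm2; apply/funext => t; rewrite /rlin big_tnth [RHS]big_split_ord -[RHS]big_split.
apply: eq_bigr => i _ /=; rewrite cE /e' real_familyl real_familyr /rscale /muli -/(F i).
case: (F i t) => x y; apply/eqP; rewrite eq_complex /=; apply/andP; split; apply/eqP; ring.
Qed.

(** A projection does not increase the norm: the squared distance from [h] to its projection is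
    nonnegative. *)
Lemma gram_form_le1 m (F : 'I_m -> R -> R[i]) (A : R) h : 0 < A -> (forall i, inL2 (F i)) ->
  (forall e, A * (\sum_j e j ^+ 2) <= qform (gram F) e) -> inL2 h ->
  gram_form (gram F) (fun i => rip (F i) h) <= rip h h.
Proof.
move=> A0 FL coer hL.
have := rip_ge0 (sumf h (rscale (-1) (rlin (gram_solve (gram F) (fun i => rip (F i) h)) F))).
rewrite rip_sub_rlin// (qform_solve A0 coer).
by rewrite gram_formE /dot; lra.
Qed.

Lemma integral_box2 r : 0 <= r -> (\int[mu2]_z (box2 r z)%:E = ((2 * r) ^+ 2)%:E)%E.
Proof.
move=> r0; have mb := @measurable_box2 R r.
have I1 : (\int[mu]_x (box r x)%:E = (2 * r)%:E)%E.
  transitivity (\int[mu]_(x in `[(- r)%R, r]) 1%:E)%E.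
    rewrite [RHS](integral_restrict (b := fun x => - r <= x <= r)); last by move=> x; rewrite /= in_itv.
    by apply: eq_integral => x _; rewrite mule1.
  rewrite integral_cst//= lebesgue_measure_itv/= lte_fin mul1e.
  case: ltP => h; first by rewrite -EFinB; congr EFin; ring.
  by congr EFin; lra.
rewrite int2E; last 2 first.
- exact/measurable_EFinP.
- by move=> z; rewrite lee_fin box2_ge0.
transitivity (\int[mu]_x ((2 * r)%:E * (box r x)%:E))%E.
  apply: eq_integral => x _; rewrite -I1 muleC [in RHS]/box integral_boole; apply: eq_integral => y _.
  by rewrite -EFinM.
rewrite ge0_integralZl//; last 3 first.
- by apply/measurable_EFinP; exact: measurable_box.
- by move=> x _; rewrite lee_fin box_ge0.
- by rewrite lee_fin mulr_ge0.
by rewrite I1 -EFinM expr2.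
Qed.

End real_family.

(** * Riesz sequences *)

Section riesz_count.
Context {R : realType} (N : nat).
Local Notation mu := (@lebesgue_measure R).
Local Notation mu2 := (mu \x mu)%E.
Local Notation key := ('I_N * (R * R))%type.
Variables (g : 'I_N -> R -> R[i]) (Lam : 'I_N -> set (R * R)) (delta : 'I_N -> R) (rho : R).
Hypothesis gL : forall n, inL2 (g n).
Hypothesis sepL : forall n, dsep (delta n) (Lam n).
Hypotheses (rho0 : 0 < rho) (rho4 : rho <= 4^-1) (rho_delta : forall n, 3 * rho <= delta n).

Lemma separated_keys (k l : key) : gab_index Lam k -> gab_index Lam l -> k.1 = l.1 -> k <> l ->
  delta k.1 < Num.sqrt ((k.2.1 - l.2.1) ^+ 2 + (k.2.2 - l.2.2) ^+ 2).
Proof.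
case: k l => [n p] [n' q]; rewrite /gab_index /= => Lp Lq e; subst n' => ne.
by apply: sepL => // pq; apply: ne; rewrite pq.
Qed.

Lemma inL2_gab_atom (k : key) : inL2 (gab_atom g k).
Proof. exact: inL2_tfshift. Qed.

Lemma rho_le1 : 0 < rho <= 1.
Proof. by rewrite rho0/=; apply: le_trans rho4 _; rewrite invf_le1// ler1n. Qed.

Lemma measurable_gapl n (z : R * R) : measurable_fun setT (fun w : R * R => gap (g n) w z).
Proof.
have mq : measurable_fun setT (fun w : R * R => (w, z)) by exact: measurable_fun_pair.
exact: (measurableT_comp (measurable_gap (gL n)) mq).
Qed.

Lemma measurable_gapr n (w : R * R) : measurable_fun setT (fun z : R * R => gap (g n) w z).
Proof.
have mq : measurable_fun setT (fun z : R * R => (w, z)) by exact: measurable_fun_pair.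
exact: (measurableT_comp (measurable_gap (gL n)) mq).
Qed.

(** The leakage integral sliced by its outer point [z], the order in which the pointwise bounds for
    a Riesz sequence produce it. *)
Definition leak_at r (z : R * R) : \bar R :=
  (\sum_n \int[mu2]_w (leak_density (g n) r (w, z))%:E)%E.

Lemma leak_at_integral r : [/\ measurable_fun setT (leak_at r), (forall z, (0 <= leak_at r z)%E) &
  (\int[mu2]_z leak_at r z = \sum_n leak (g n) r)%E].
Proof.
have D0 n q : (0 <= (leak_density (g n) r q)%:E)%E by rewrite lee_fin leak_density_ge0.
have mL n : measurable_fun setT (fun z : R * R => \int[mu2]_w (leak_density (g n) r (w, z))%:E)%E.
  have mq : measurable_fun setT (fun q : (R * R) * (R * R) => (q.2, q.1)) by exact: measurable_fun_pair.
  have mD := measurableT_comp (measurable_leak_density r (gL n)) mq.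
  exact: (@measurable_prod_integral _ _ R mu _ _ _ mD (fun q => D0 n _)).
have L0 n z : (0 <= \int[mu2]_w (leak_density (g n) r (w, z))%:E)%E by apply: integral_ge0.
split.
- by apply: emeasurable_sum => n; exact: mL.
- by move=> z; apply: sume_ge0.
- rewrite /leak_at (ge0_integral_sum mu2 measurableT (fun n => mL n) (fun n z _ => L0 n z)).
  by apply: eq_bigr => n _; rewrite leak_swap.
Qed.

Lemma riesz_count_le (A B a b r : R) (s : seq key) : 0 < A -> 0 < r ->
  is_riesz_seq (gab_index Lam) (gab_atom g) A B ->
  uniq s -> (forall k, k \in s -> gab_index Lam k /\ Qsq a b r k.2) ->
  ((size s)%:R%:E <= ((2 * r + 1) ^+ 2)%:E +
    (local_const rho / A)%:E * \sum_n leak (g n) (r + 4^-1))%E.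
Proof.
move=> A0 r0 rs us sS.
have sL k : k \in s -> gab_index Lam k by move=> /sS[].
pose F i := gab_atom g (tnth (in_tuple s) i).
pose G := real_family F.
have GL : forall j, inL2 (G j) by apply: inL2_real_family => i; exact: inL2_gab_atom.
have coer := riesz_coercive rs (fun k _ => inL2_gab_atom k) us sL.
rewrite -/F -/G in coer.
pose T (z : R * R) := (a + z.1, b + z.2).
have mT : measurable_fun setT T by apply/measurable_fun_pair; meas.
have TI g' : inL2 g' -> (\int[mu2]_z (cabs2 (stft g' (T z).1 (T z).2))%:E = (rip g' g')%:E)%E.
  by move=> g'L; exact: (stft_isometry_shift (a, b)).
pose M := invmx (gram G).
pose Phi z := qform M (fun i => coefr (G i) (T z)) + qform M (fun i => coefi (G i) (T z)).
(* The doubled family has twice as many members as [s]. All bounds below carry the same factor 2,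
   which is cancelled at the end. *)
have [iPhi EPhi] : hasint mu2 Phi (size s + size s)%:R.
  have := qform_coef_integral mT TI M GL.
  by rewrite (trace_gram_inv A0 (gram_sym G) coer).
have Phi0 z : 0 <= Phi z.
  by rewrite addr_ge0//; exact: (gram_form_ge0 A0 (gram_sym G) coer).
have Phi2 z : Phi z <= 2.
  have aL := inL2_gauss_atom (T z).1 (T z).2.
  have h1 := gram_form_le1 A0 GL coer aL.
  have h2 := gram_form_le1 A0 GL coer (inL2_muli aL).
  by rewrite rip_muli// rip_gauss_atom in h1 h2; exact: lerD h1 h2.
(* The factor 2 appears because an atom and its multiple by i have the same squared coefficient. *)
have PhiA z : Phi z <= (2 / A) * \sum_(k <- s) gap (g k.1) (k.2.1 - a, k.2.2 - b) z.
  have h1 := gram_form_le A0 coer (fun i => coefr (G i) (T z)).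
  have h2 := gram_form_le A0 coer (fun i => coefi (G i) (T z)).
  apply: le_trans (lerD h1 h2) _; rewrite -mulrDr -big_split /=.
  rewrite (eq_bigr (fun j => cabs2 (stft (G j) (T z).1 (T z).2))); last first.
    by move=> j _; rewrite -cabs2_stftE.
  rewrite big_split_ord [2 / A]mulrC -mulrA ler_wpM2l ?invr_ge0 ?(ltW A0)//.
  rewrite [in leRHS]big_tnth mulrDl mul1r le_eqVlt; apply/orP; left; apply/eqP.
  have E i : cabs2 (stft (F i) (T z).1 (T z).2) = gap (g (tnth (in_tuple s) i).1)
      ((tnth (in_tuple s) i).2.1 - a, (tnth (in_tuple s) i).2.2 - b) z.
    rewrite /F /gab_atom (cabs2_stft_tfshift _ _ _ _ (gL _)) /gap /T.
    have e3 (x y t : R) : x + y - t = y - (t - x) by ring.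
    by rewrite !e3.
  congr (_ + _); apply: eq_bigr => i _; rewrite /G ?real_familyl ?real_familyr -E//.
  have FL := inL2_gab_atom (tnth (in_tuple s) i).
  rewrite -/(F i) in FL; have mFL := inL2_muli FL.
  have aL := inL2_gauss_atom (T z).1 (T z).2.
  rewrite !cabs2_stftE// /coefr /coefi rip_muli// rip_mulil//.
  by rewrite sqrrN addrC.
have [mL L0 IL] := leak_at_integral (r + 4^-1).
pose L := leak_at (r + 4^-1).
(* The first quarter holds the boxes of radius rho about points of Q(r), the second is the gap in
   I_G. On the square of half-side [r'] the bound [Phi2] is used, outside it [PhiA]. *)
pose r' := r + 4^-1 + 4^-1.
have C0 := ltW (local_const_gt0 rho0).
have PhiL z : (((1 - box2 r' z) * Phi z)%:E <= (2 / A * local_const rho)%:E * L z)%E.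
  have K0 : 0 <= 2 / A * local_const rho by rewrite mulr_ge0// divr_ge0// ltW.
  have [e|e] : box2 r' z = 1 \/ box2 r' z = 0.
    rewrite /box2 /box; case: (_ <= _ <= _); case: (_ <= _ <= _); rewrite ?mulr1 ?mulr0 ?mul0r; by [left|right].
    by rewrite e subrr mul0r mule_ge0 ?lee_fin ?L0.
  rewrite e subr0 mul1r.
  have key := @discrete_sum_le R N s (fun k => (k.2.1 - a, k.2.2 - b)) rho (local_const rho) delta
    (fun n w => gap (g n) w z) (box2 (r + 4^-1)) us rho0 rho_delta C0.
  apply: (@le_trans _ _ ((2 / A)%:E * (\sum_(k <- s) gap (g k.1) (k.2.1 - a, k.2.2 - b) z)%:E)%E).
    by rewrite -EFinM lee_fin.
  rewrite [(2 / A * _)%:E]EFinM -muleA; apply: lee_wpmul2l; first by rewrite lee_fin divr_ge0// ltW.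
  have -> : L z = (\sum_n \int[mu2]_w (box2 (r + 4^-1) w * gap (g n) w z)%:E)%E.
    apply: eq_bigr => n _; apply: eq_integral => w _.
    by rewrite /leak_density /= -/r' e subr0 mulr1.
  apply: key.
  - move=> k l ks ls kl ne /=.
    rewrite (_ : k.2.1 - a - (l.2.1 - a) = k.2.1 - l.2.1); last by ring.
    rewrite (_ : k.2.2 - b - (l.2.2 - b) = k.2.2 - l.2.2); last by ring.
    exact: separated_keys (sL _ ks) (sL _ ls) kl ne.
  - exact: measurable_box2.
  - exact: box2_ge0.
  - move=> k w ks; have [_ [/= k1 k2]] := sS _ ks.
    have [->|] := eqVneq (box2 rho (w.1 - (k.2.1 - a), w.2 - (k.2.2 - b))) 0; first exact: box2_ge0.
    move=> /box2_neq0[/= w1 w2]; rewrite (@box2_1 _ (r + 4^-1) w) ?box2_le1//.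
      rewrite (_ : w.1 = (w.1 - (k.2.1 - a)) + (k.2.1 - a)); last by ring.
      by rewrite [r + _]addrC; apply: le_trans (ler_normD _ _) (lerD (le_trans w1 rho4) k1).
    rewrite (_ : w.2 = (w.2 - (k.2.2 - b)) + (k.2.2 - b)); last by ring.
    by rewrite [r + _]addrC; apply: le_trans (ler_normD _ _) (lerD (le_trans w2 rho4) k2).
  - by move=> n; exact: measurable_gapl.
  - by move=> n w; exact: gap_ge0.
  - by move=> n l; exact: (stft_local_minus z l (gL n) rho_le1).
have /integrableP[/measurable_EFinP mPhi _] := iPhi.
have mb := @measurable_box2 R r'.
have : ((size s + size s)%:R%:E <= (2 * (2 * r') ^+ 2)%:E +
    (2 / A * local_const rho)%:E * \sum_n leak (g n) (r + 4^-1))%E.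
  rewrite -EPhi -EFin_Rintegral//.
  have -> : (\int[mu2]_z (Phi z)%:E = \int[mu2]_z ((box2 r' z * Phi z)%:E + ((1 - box2 r' z) * Phi z)%:E))%E.
    by apply: eq_integral => z _; rewrite -EFinD -mulrDl addrC subrK mul1r.
  have m1 : measurable_fun setT (fun z => (box2 r' z * Phi z)%:E).
    by apply/measurable_EFinP; exact: measurable_funM mb mPhi.
  have m2 : measurable_fun setT (fun z => ((1 - box2 r' z) * Phi z)%:E).
    apply/measurable_EFinP; apply: measurable_funM mPhi.
    by apply: measurable_funB mb.
  have p1 z : (0 <= (box2 r' z * Phi z)%:E)%E by rewrite lee_fin mulr_ge0 ?box2_ge0.
  have p2 z : (0 <= ((1 - box2 r' z) * Phi z)%:E)%E.
    by rewrite lee_fin mulr_ge0// subr_ge0 box2_le1.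
  rewrite (ge0_integralD mu2 measurableT (fun z _ => p1 z) m1 (fun z _ => p2 z) m2).
  apply: leeD.
  - rewrite EFinM -integral_box2; last by rewrite /r'; lra.
    have mb' : measurable_fun setT (fun z => (box2 r' z)%:E) by exact/measurable_EFinP.
    have b0 z : (0 <= (box2 r' z)%:E)%E by rewrite lee_fin box2_ge0.
    rewrite -(ge0_integralZl mu2 measurableT mb' (fun z _ => b0 z)); last by rewrite lee_fin.
    apply: ge0_le_integral => //; first by apply: measurable_funeM.
    by move=> z _; rewrite -EFinM lee_fin mulrC ler_wpM2r// box2_ge0.
  - rewrite -IL.
    have K0 : 0 <= 2 / A * local_const rho by rewrite mulr_ge0// divr_ge0// ltW.
    rewrite -(ge0_integralZl mu2 measurableT mL (fun z _ => L0 z)); last by rewrite lee_fin.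
    by apply: ge0_le_integral => //; apply: measurable_funeM.
have C1 : 0 < local_const rho / A by rewrite divr_gt0// local_const_gt0.
have : (0 <= \sum_n leak (g n) (r + 4^-1))%E by rewrite -IL; apply: integral_ge0.
move: (\sum_n leak (g n) (r + 4^-1))%E => [x _|_ _|//]; last first.
  by rewrite gt0_muley ?lte_fin// addey// leey.
rewrite -!EFinM -!EFinD !lee_fin natrD /r'.
rewrite (_ : 2 * (r + 4^-1 + 4^-1) = 2 * r + 1); last by field.
rewrite (_ : 2 / A * local_const rho = 2 * (local_const rho / A)); last by ring.
by rewrite -mulrA; move: (local_const rho / A * x) ((2 * r + 1) ^+ 2) ((size s)%:R : R) => *; lra.
Qed.

End riesz_count.

Lemma le0_small_multiple (R : realType) (D E : R) : 0 <= E ->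
  (forall theta, 0 < theta -> D <= theta * E) -> D <= 0.
Proof.
move=> E0 H; have [//|D0] := leP D 0; have E1 : 0 < E + 1 by lra.
have := H _ (divr_gt0 D0 E1); rewrite mulrAC ler_pdivlMr//.
by rewrite mulrDr mulr1; lra.
Qed.

(** * Frames *)

Section frame_pairing.
Context {R : realType} (I : choiceType) (f : I -> R -> R[i]).
Hypothesis fL : forall k, inL2 (f k).
Implicit Types (S : set I) (h u w : R -> R[i]).

Definition analysis_r h k : R := rip h (f k).
Definition analysis_i h k : R := rip h (muli (f k)).

Definition bessel S := forall h, inL2 h -> l2fin S (analysis_r h) /\ l2fin S (analysis_i h).

(** The real part of <T h, u>, where T is the frame operator of the atoms indexed by [S]. *)
Definition frame_pair S h u : R :=
  l2pair S (analysis_r h) (analysis_r u) + l2pair S (analysis_i h) (analysis_i u).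

Definition frame_energy S h : R := l2sum S (analysis_r h) + l2sum S (analysis_i h).

Lemma analysisD h u : inL2 h -> inL2 u ->
  analysis_r (sumf h u) = (fun k => analysis_r h k + analysis_r u k) /\
  analysis_i (sumf h u) = (fun k => analysis_i h k + analysis_i u k).
Proof.
by move=> hL uL; split; apply/funext => k; rewrite /analysis_r /analysis_i ripDl//; exact: inL2_muli.
Qed.

Lemma analysisZ t h : inL2 h ->
  analysis_r (rscale t h) = (fun k => t * analysis_r h k) /\
  analysis_i (rscale t h) = (fun k => t * analysis_i h k).
Proof.
by move=> hL; split; apply/funext => k; rewrite /analysis_r /analysis_i ripZl//; exact: inL2_muli.
Qed.

Lemma frame_energyE S h : inL2 h -> bessel S ->
  (\esum_(k in S) (cabs2 (l2inner h (f k)))%:E = (frame_energy S h)%:E)%E.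
Proof.
move=> hL bS; have [hr hi] := bS _ hL.
rewrite /frame_energy EFinD !l2sumE// /l2e -esumD; do ?[by move=> k _; rewrite lee_fin sqr_ge0].
by apply: eq_esum => k _; rewrite -EFinD l2innerE.
Qed.

Section bessel_pairing.
Variable S : set I.
Hypothesis bS : bessel S.

Lemma frame_pairC h u : frame_pair S h u = frame_pair S u h.
Proof. by rewrite /frame_pair l2pairC [X in _ + X]l2pairC. Qed.

Lemma frame_pairDl h u w : inL2 h -> inL2 u -> inL2 w ->
  frame_pair S (sumf h u) w = frame_pair S h w + frame_pair S u w.
Proof.
move=> hL uL wL; have [hr hi] := bS hL; have [ur ui] := bS uL; have [wr wi] := bS wL.
by have [Er Ei] := analysisD hL uL; rewrite /frame_pair Er Ei (l2pairD hr ur wr) (l2pairD hi ui wi) addrACA.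
Qed.

Lemma frame_pairZl t h w : inL2 h -> inL2 w ->
  frame_pair S (rscale t h) w = t * frame_pair S h w.
Proof.
move=> hL wL; have [hr hi] := bS hL; have [wr wi] := bS wL.
by have [Er Ei] := analysisZ t hL; rewrite /frame_pair Er Ei (l2pairZ _ hr wr) (l2pairZ _ hi wi) mulrDr.
Qed.

Lemma frame_pair_sqr h : inL2 h -> frame_pair S h h = frame_energy S h.
Proof. by move=> hL; have [hr hi] := bS hL; rewrite /frame_pair !l2pair_sqr. Qed.

Lemma frame_pair_le h u : inL2 h -> inL2 u ->
  2 * frame_pair S h u <= frame_energy S h + frame_energy S u.
Proof.
move=> hL uL; have [hr hi] := bS hL; have [ur ui] := bS uL.
rewrite /frame_pair /frame_energy mulrDr addrACA lerD//; exact: l2pair_le.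
Qed.

Lemma frame_energyD t h u : inL2 h -> inL2 u ->
  frame_energy S (sumf h (rscale t u)) =
  frame_energy S h + 2 * t * frame_pair S h u + t ^+ 2 * frame_energy S u.
Proof.
move=> hL uL; have tL := inL2_rscale t uL.
have [hr hi] := bS hL; have [tr ti] := bS tL; have [ur ui] := bS uL.
have P : frame_pair S h (rscale t u) = t * frame_pair S h u.
  by rewrite frame_pairC frame_pairZl// frame_pairC.
have Q : frame_energy S (rscale t u) = t ^+ 2 * frame_energy S u.
  have [Er Ei] := analysisZ t uL.
  by rewrite /frame_energy Er Ei (l2sumZ _ ur) (l2sumZ _ ui) mulrDr.
have [Er Ei] := analysisD hL tL.
move: P Q; rewrite /frame_energy /frame_pair Er Ei (l2sumD hr tr) (l2sumD hi ti).
move: (l2pair _ _ _) (l2pair _ _ _) (l2pair _ _ _) (l2pair _ _ _) => p1 p2 p3 p4.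
move: (l2sum _ _) (l2sum _ _) (l2sum _ _) (l2sum _ _) (l2sum _ _) (l2sum _ _) => s1 s2 s3 s4 s5 s6 P Q.
have -> : 2 * t * (p2 + p1) = 2 * (t * (p2 + p1)) by ring.
by rewrite -P -Q; ring.
Qed.

Lemma frame_pair_rlin m (e : 'I_m -> R) (F : 'I_m -> R -> R[i]) h :
  (forall i, inL2 (F i)) -> inL2 h ->
  frame_pair S (rlin e F) h = \sum_i e i * frame_pair S (F i) h.
Proof.
move=> FL hL.
suff H (s : seq 'I_m) : inL2 (fun t => \sum_(i <- s) rscale (e i) (F i) t) /\
    frame_pair S (fun t => \sum_(i <- s) rscale (e i) (F i) t) h =
      \sum_(i <- s) e i * frame_pair S (F i) h by have [] := H (index_enum _).
elim: s => [|i s [IL IE]].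
  rewrite (_ : (fun t => \sum_(i <- [::]) rscale (e i) (F i) t) = rscale 0 h); last first.
    by apply/funext => t; rewrite big_nil /rscale !mul0r.
  by rewrite frame_pairZl// mul0r big_nil; split=> //; exact: inL2_rscale.
rewrite (_ : (fun t => \sum_(j <- i :: s) rscale (e j) (F j) t) =
  sumf (rscale (e i) (F i)) (fun t => \sum_(j <- s) rscale (e j) (F j) t)); last first.
  by apply/funext => t; rewrite big_cons.
have sL := inL2_rscale (e i) (FL i).
by split; [exact: inL2_sumf|rewrite frame_pairDl// frame_pairZl// IE big_cons].
Qed.

Variables (A B : R).
Hypotheses (A0 : 0 < A) (B0 : 0 < B).
Hypothesis lower : forall h, inL2 h -> A * rip h h <= frame_energy S h.
Hypothesis upper : forall h, inL2 h -> frame_energy S h <= B * rip h h.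

(* A near-minimizer of w |-> [frame_energy S w / 2 - rip u w] solves the frame equation up to [eps]; this replaces the inverse frame operator, which would need completeness of L2. *)
Lemma near_dual u (eps : R) : inL2 u -> 0 < eps ->
  exists w, inL2 w /\ forall h, inL2 h ->
    `|frame_pair S w h - rip u h| <= eps * (1 + rip h h).
Proof.
move=> uL e0.
pose J w := frame_energy S w / 2 - rip u w.
pose E := [set J w | w in [set w | inL2 w]].
have E_lb : has_inf E.
  split; first by exists (J u); exists u.
  (* By the weighted inequality 2 <u, w> <= |u|^2 / A + A |w|^2, in which the lower frame bound
     absorbs the last term. *)
  exists (- (rip u u / (2 * A))) => _ [w wL <-].
  have h1 := rip_le (inL2_rscale A^-1 uL) wL; have h2 := lower wL.
  rewrite ripZl// rip_rscale// in h1.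
  have {}h1 : 2 * (A^-1 * rip u w) <= A^-1 ^+ 2 * rip u u + rip w w.
    by apply: le_trans h1; rewrite ler_wpM2l// ler_norm.
  have h3 : A * (2 * (A^-1 * rip u w)) <= A * (A^-1 ^+ 2 * rip u u + rip w w) by rewrite ler_wpM2l// ltW.
  have h4 : 2 * rip u w <= rip u u / A + A * rip w w.
    have e1 (x : R) : A * (2 * (A^-1 * x)) = 2 * x by field; rewrite gt_eqF.
    have e2 (x y : R) : A * (A^-1 ^+ 2 * x + y) = x / A + A * y by field; rewrite gt_eqF.
    by rewrite e1 e2 in h3.
  rewrite /J invfM; move: h4 h2; rewrite mulrCA.
  by move: (frame_energy S w) (rip u w) (rip u u / A) (A * rip w w) => p q x y; lra.
(* The functional is minimized up to q^2 and tested along w + t h at t = q and t = -q. Dividing by q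
   leaves an error of q + q B |h|^2 / 2, which this choice keeps below eps (1 + |h|^2). *)
pose q := eps / (1 + B).
have B1 : 0 < 1 + B by rewrite addr_gt0.
have q0 : 0 < q by rewrite divr_gt0.
have qe : q <= eps by rewrite ler_pdivrMr// ler_peMr ?(ltW e0)// lerDl ltW.
have qB : q * B <= eps.
  by rewrite mulrAC ler_pdivrMr// ler_wpM2l ?(ltW e0)// lerDr.
have [_ [w wL <-] Jw] := inf_adherent (exprn_gt0 2 q0) E_lb.
exists w; split=> // h hL.
have low t : - q ^+ 2 <= t * (frame_pair S w h - rip u h) + t ^+ 2 * frame_energy S h / 2.
  have tL := inL2_rscale t hL; have sL := inL2_sumf wL tL.
  have : inf E <= J (sumf w (rscale t h)).
    by apply: ge_inf; [exact: E_lb.2|exists (sumf w (rscale t h))].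
  rewrite /J frame_energyD// ripC ripDl// ripZl// (ripC w) (ripC h).
  move: Jw; rewrite /J.
  by move: (inf E) (frame_energy S w) (frame_energy S h) (frame_pair S w h) (rip u w) (rip u h) => *; lra.
have up := upper hL.
have D y : - q ^+ 2 <= q * y + q ^+ 2 * frame_energy S h / 2 -> - y <= eps * (1 + rip h h).
  move=> hy; have {}hy : - q <= y + q * frame_energy S h / 2.
    rewrite -(ler_pM2l q0); apply: le_trans (_ : - q ^+ 2 <= _); first by rewrite mulrN expr2.
    by have -> : q * (y + q * frame_energy S h / 2) = q * y + q ^+ 2 * frame_energy S h / 2 by ring.
  have h1 : q * frame_energy S h <= q * (B * rip h h) by rewrite ler_wpM2l// ltW.
  have h2 : q * B * rip h h <= eps * rip h h by rewrite ler_wpM2r// rip_ge0.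
  have h3 := rip_ge0 h; have h4 : 0 <= eps * rip h h by rewrite mulr_ge0// ltW.
  have e4 (x : R) : eps * (1 + x) = eps + eps * x by ring.
  rewrite mulrA in h1; rewrite e4; move: hy h1 h2 h4 qe.
  by move: (q * frame_energy S h) (q * B * rip h h) (eps * rip h h) => *; lra.
rewrite ler_norml lerNl; apply/andP; split; first exact: D (low q).
by rewrite -[X in X <= _]opprK; apply: D; have := low (- q); rewrite sqrrN mulNr mulrN.
Qed.

End bessel_pairing.

Lemma frame_pair_split S (s : seq I) h u : bessel S -> uniq s -> (forall k, k \in s -> S k) ->
  inL2 h -> inL2 u ->
  frame_pair S h u = frame_pair (S `\` [set` s]) h u +
    \sum_j rip h (real_family (fun i => f (tnth (in_tuple s) i)) j) *
           rip u (real_family (fun i => f (tnth (in_tuple s) i)) j).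
Proof.
move=> bS us sS hL uL; have [hr hi] := bS _ hL; have [ur ui] := bS _ uL.
rewrite /frame_pair (l2pair_split us sS hr ur) (l2pair_split us sS hi ui) addrACA; congr (_ + _).
rewrite [RHS]big_split_ord /=; congr (_ + _); rewrite big_tnth; apply: eq_bigr => i _.
  by rewrite real_familyl.
by rewrite real_familyr.
Qed.

Lemma bessel_sub S S' : S' `<=` S -> bessel S -> bessel S'.
Proof.
move=> SS bS h hL; have [hr hi] := bS h hL.
have aux (c : I -> R) : l2fin S c -> l2fin S' c.
  move=> fc; apply: le_lt_trans fc; rewrite /l2e (esum_mkcond S') (esum_mkcond S).
  apply: le_esum => k _; case: ifPn => kS'; last by case: ifPn => // _; rewrite lee_fin sqr_ge0.
  by rewrite ifT// inE; apply: SS; rewrite inE in kS'.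
by split; exact: aux.
Qed.

(** Pair h' with itself through the frame. Since the [w j] are almost dual to the [G j], subtracting
    their combination almost removes from the pairing of h and h' the terms with index in [s]. What
    remains is a pairing over the tail, at most half the sum of the tail energies of h and h'; the
    energy of h' is absorbed on the left, and this doubles the duality error. *)
Lemma residual_le S (A : R) (s : seq I) (eps M : R) (w : 'I_(size s + size s) -> R -> R[i]) h h' :
  bessel S -> uniq s -> (forall k, k \in s -> S k) -> 0 < eps ->
  (forall u, inL2 u -> A * rip u u <= frame_energy S u) ->
  (forall j, inL2 (w j)) ->
  let G := real_family (fun i => f (tnth (in_tuple s) i)) in
  (forall j u, inL2 u -> `|frame_pair S (w j) u - rip (G j) u| <= eps * (1 + rip u u)) ->
  inL2 h -> \sum_j `|rip (G j) h| <= M ->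
  h' = sumf h (rscale (-1) (rlin (fun j => rip (G j) h) w)) ->
  A * rip h' h' <= frame_energy (S `\` [set` s]) h + 2 * eps * M * (1 + rip h' h').
Proof.
move=> bS us sS e0 low wL G near hL cM Eh'.
pose c j := rip (G j) h.
have lL : inL2 (rlin c w) by exact: inL2_rlin.
have nL := inL2_rscale (-1) lL.
have h'L : inL2 h' by rewrite Eh'; exact: inL2_sumf.
have GL j : inL2 (G j) by apply: inL2_real_family => i; exact: fL.
have S'S : S `\` [set` s] `<=` S by move=> k [].
have bS' := bessel_sub S'S bS.
have X := frame_pair_sqr bS h'L.
rewrite [X in frame_pair S X]Eh' (frame_pairDl bS hL nL h'L) (frame_pairZl bS _ lL h'L) (frame_pair_rlin bS _ wL h'L) in X.
rewrite (frame_pair_split bS us sS hL h'L) -/G in X.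
have P := frame_pair_le bS' hL h'L.
have E' : frame_energy S h' = frame_energy (S `\` [set` s]) h' + \sum_j rip h' (G j) ^+ 2.
  rewrite -(frame_pair_sqr bS h'L) (frame_pair_split bS us sS h'L h'L) (frame_pair_sqr bS' h'L).
  by congr (_ + _); apply: eq_bigr => j _; rewrite expr2.
have E0 : frame_energy (S `\` [set` s]) h' <= frame_energy S h'.
  by rewrite E' lerDl sumr_ge0// => j _; exact: sqr_ge0.
have D : \sum_j rip h (G j) * rip h' (G j) - \sum_i c i * frame_pair S (w i) h' <= eps * (1 + rip h' h') * M.
  rewrite -sumrB; apply: (@le_trans _ _ (\sum_j `|c j| * (eps * (1 + rip h' h')))).
    apply: ler_sum => j _; rewrite (ripC h) (ripC h' (G j)) -/(c j) -mulrBr.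
    apply: le_trans (ler_norm _) _; rewrite normrM ler_wpM2l// distrC; exact: near.
  rewrite -mulr_suml mulrC; apply: ler_wpM2l cM.
  by rewrite mulr_ge0 ?(ltW e0)// addr_ge0// rip_ge0.
have := low _ h'L; move: X P E0 D; rewrite mulN1r.
have -> : 2 * eps * M * (1 + rip h' h') = 2 * (eps * (1 + rip h' h') * M) by ring.
move: (frame_energy S h') (frame_energy _ h) (frame_energy _ h') (frame_pair _ h h').
move: (\sum_j _ * _) (\sum_j _ * _) (A * rip h' h') (eps * _ * _) => *; lra.
Qed.

End frame_pairing.

(** * The lower bound for the number of points *)

Section frame_count.
Context {R : realType} (N : nat).
Local Notation mu := (@lebesgue_measure R).
Local Notation mu2 := (mu \x mu)%E.
Local Notation key := ('I_N * (R * R))%type.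
Variables (g : 'I_N -> R -> R[i]) (Lam : 'I_N -> set (R * R)) (delta : 'I_N -> R) (rho : R).
Hypothesis gL : forall n, inL2 (g n).
Hypothesis sepL : forall n, dsep (delta n) (Lam n).
Hypotheses (rho0 : 0 < rho) (rho4 : rho <= 4^-1) (rho_delta : forall n, 3 * rho <= delta n).
Variables (A B : R).
Hypotheses (A0 : 0 < A) (B0 : 0 < B).
Hypothesis fr : is_frame (gab_index Lam) (gab_atom g) A B.

Local Notation S := (gab_index Lam).
Local Notation f := (gab_atom g).
Local Notation fL := (fun k => inL2_gab_atom gL k).

Lemma gab_bessel : bessel f S.
Proof.
move=> h hL; have [_ up] := fr hL.
have fin : (\esum_(k in S) (cabs2 (l2inner h (f k)))%:E < +oo)%E by exact: le_lt_trans up (ltry _).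
split; apply: le_lt_trans fin; apply: le_esum => k _; have kL := inL2_gab_atom gL k;
  by rewrite l2innerE// lee_fin /cabs2 /= ?lerDl ?lerDr sqr_ge0.
Qed.

Lemma frame_bounds h : inL2 h ->
  A * rip h h <= frame_energy f S h /\ frame_energy f S h <= B * rip h h.
Proof.
move=> hL; have := fr hL; rewrite l2norm2E// (frame_energyE fL hL gab_bessel) !lee_fin.
by case.
Qed.

(** The factor restricting [z] to the inner square is omitted because the tail estimate holds for
    every [z]; [leak_out_in] restores it. *)
Definition leak_out r (z : R * R) : \bar R :=
  (\sum_n \int[mu2]_w ((1 - box2 (r + 4^-1) w) * gap (g n) z w)%:E)%E.

(** The atom at (a, b) - z paired with the atom at lambda has modulus |V_phi g| at w - z with w =
    (a, b) - lambda. For lambda outside Q(r) the box about w avoids the square of half-side r - 1/4.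
    Finite subsets of the tail suffice, since its energy is a supremum over them. *)
Lemma tail_energy_le (a b r : R) (s : seq key) (z : R * R) :
  (forall k, S k -> Qsq a b r k.2 -> k \in s) ->
  ((frame_energy f (S `\` [set` s]) (gauss_atom (a - z.1) (b - z.2)))%:E <=
    (local_const rho)%:E * leak_out (r - 2^-1) z)%E.
Proof.
move=> sall; set h := gauss_atom _ _.
have hL : inL2 h by exact: inL2_gauss_atom.
have SS : S `\` [set` s] `<=` S by move=> k [].
rewrite -(frame_energyE fL hL (bessel_sub SS gab_bessel)).
apply: ub_ereal_sup => _ [X [fX XS] <-].
have [t [ut Xt]] : exists t : seq key, uniq t /\ X = [set` t].
  have /finite_seqP[t Xt] := fX; exists (undup t); split; first exact: undup_uniq.
  by rewrite Xt; apply/seteqP; split=> k /=; rewrite mem_undup.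
rewrite Xt -fsbig_seq// sumEFin.
have e3 (x y t0 : R) : x - y - t0 = x - t0 - y by ring.
rewrite (eq_bigr (fun k : key => gap (g k.1) z (a - k.2.1, b - k.2.2))); last first.
  move=> k _; rewrite (cabs2_l2innerC hL (inL2_gab_atom gL k)) /h -stft_atomE /gab_atom (cabs2_stft_tfshift _ _ _ _ (gL _)).
  by rewrite /gap /= e3 [b - _ - _]e3.
have tS k : k \in t -> S k /\ k \notin s.
  move=> kt; have [] := XS k; first by rewrite Xt.
  by move=> Sk /negP ks.
apply: (@discrete_sum_le R N t (fun k => (a - k.2.1, b - k.2.2)) rho (local_const rho) delta
    (fun n w => gap (g n) z w) (fun w => 1 - box2 (r - 2^-1 + 4^-1) w) ut rho0 rho_delta).
- exact/ltW/local_const_gt0.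
- move=> k l kt lt kl ne /=.
  rewrite (_ : a - k.2.1 - (a - l.2.1) = - (k.2.1 - l.2.1)); last by ring.
  rewrite (_ : b - k.2.2 - (b - l.2.2) = - (k.2.2 - l.2.2)); last by ring.
  by rewrite !sqrrN; apply: (separated_keys sepL) ne => //; [exact: (tS k kt).1|exact: (tS l lt).1].
- by apply: measurable_funB => //; exact: measurable_box2.
- by move=> w; rewrite subr_ge0 box2_le1.
(* By contraposition: if the box about the reflected point met the square of half-side r - 1/4, then
   k would lie in Q(r), hence in [s]. *)
- move=> k w kt; have [Sk ks] := tS k kt.
  have [->|] := eqVneq (box2 rho (w.1 - (a - k.2.1), w.2 - (b - k.2.2))) 0.
    by rewrite subr_ge0 box2_le1.
  move=> /box2_neq0[/= w1 w2].
  have [->|] := eqVneq (box2 (r - 2^-1 + 4^-1) w) 0; first by rewrite subr0 box2_le1.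
  move=> /box2_neq0[/= v1 v2]; exfalso; move/negP: ks; apply; apply: sall => //.
  have hr : r - 2^-1 + 4^-1 + 4^-1 = r by field.
  split.
    rewrite (_ : k.2.1 - a = w.1 - (a - k.2.1) - w.1); last by ring.
    by apply: le_trans (ler_normB _ _) _; rewrite -hr addrC; exact: lerD v1 (le_trans w1 rho4).
  rewrite (_ : k.2.2 - b = w.2 - (b - k.2.2) - w.2); last by ring.
  by apply: le_trans (ler_normB _ _) _; rewrite -hr addrC; exact: lerD v2 (le_trans w2 rho4).
- by move=> n; exact: measurable_gapr.
- by move=> n w; exact: gap_ge0.
- by move=> n l; exact: (stft_local_plus z l (gL n) (rho_le1 rho0 rho4)).
Qed.

Lemma tail_energy_muli (T : set key) h : inL2 h -> bessel f T ->
  frame_energy f T (muli h) = frame_energy f T h.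
Proof.
move=> hL bT; apply: EFin_inj; rewrite -!(frame_energyE fL)//; last exact: inL2_muli.
apply: eq_esum => k _; have kL := inL2_gab_atom gL k.
by rewrite !l2innerE//; [rewrite /cabs2 /= rip_muli// rip_mulil// sqrrN addrC|exact: inL2_muli].
Qed.

Definition leak_in r (z : R * R) : \bar R :=
  (\sum_n \int[mu2]_w (leak_density (g n) r (z, w))%:E)%E.

Lemma leak_in_integral r : [/\ measurable_fun setT (leak_in r), (forall z, (0 <= leak_in r z)%E) &
  (\int[mu2]_z leak_in r z = \sum_n leak (g n) r)%E].
Proof.
have D0 n q : (0 <= (leak_density (g n) r q)%:E)%E by rewrite lee_fin leak_density_ge0.
have mL n : measurable_fun setT (fun z : R * R => \int[mu2]_w (leak_density (g n) r (z, w))%:E)%E.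
  exact: (@measurable_prod_integral _ _ R mu _ _ _ (measurable_leak_density r (gL n)) (fun q => D0 n _)).
have L0 n z : (0 <= \int[mu2]_w (leak_density (g n) r (z, w))%:E)%E by apply: integral_ge0.
split.
- by apply: emeasurable_sum => n; exact: mL.
- by move=> z; apply: sume_ge0.
- by rewrite /leak_in (ge0_integral_sum mu2 measurableT (fun n => mL n) (fun n z _ => L0 n z)).
Qed.

Lemma leak_out_in r z : box2 r z = 1 -> leak_out r z = leak_in r z.
Proof.
move=> e; apply: eq_bigr => n _; apply: eq_integral => w _.
by rewrite /leak_density /= e mul1r.
Qed.

Lemma qform_addscalar m (G : 'M[R]_m) eta c :
  qform (G + eta%:M) c = qform G c + eta * \sum_i c i ^+ 2.
Proof.
rewrite /qform mulr_sumr -big_split; apply: eq_bigr => i _ /=.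
rewrite (bigD1 i)//= [in RHS](bigD1 i)//= !mxE eqxx mulr1n -addrA mulrDl mulrDl -!addrA; congr (_ + _).
rewrite [RHS]addrC -mulrA -expr2; congr (_ + _).
by apply: eq_bigr => j ji; rewrite !mxE eq_sym (negbTE ji) mulr0n addr0.
Qed.

Lemma dual_family (s : seq key) (eps : R) : 0 < eps -> exists w : 'I_(size s + size s) -> R -> R[i],
  (forall j, inL2 (w j)) /\
  (forall j u, inL2 u -> `|frame_pair f S (w j) u -
     rip (real_family (fun i => f (tnth (in_tuple s) i)) j) u| <= eps * (1 + rip u u)).
Proof.
move=> e0.
have GL j : inL2 (real_family (fun i => f (tnth (in_tuple s) i)) j).
  by apply: inL2_real_family => i; exact: inL2_gab_atom.
have nd := near_dual fL gab_bessel A0 B0 (fun h hL => (frame_bounds hL).1)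
  (fun h hL => (frame_bounds hL).2) (GL _) e0.
exists (fun j => projT1 (cid (nd j))); split=> [j|j u uL]; case: (cid (nd j)) => w /= [wL wn] //.
exact: wn.
Qed.

Lemma frame_count_ge (a b r : R) (s : seq key) : 2^-1 < r -> uniq s ->
  (forall k, k \in s <-> S k /\ Qsq a b r k.2) ->
  (((2 * r - 1) ^+ 2)%:E - (local_const rho / A)%:E * \sum_n leak (g n) (r - 2^-1) <= (size s)%:R%:E)%E.
Proof.
move=> r2 us sS.
have sL k : k \in s -> S k by move=> /sS[].
pose n := size s.
pose G := real_family (fun i => f (tnth (in_tuple s) i)).
have GL j : inL2 (G j) by apply: inL2_real_family => i; exact: inL2_gab_atom.
pose r' := r - 2^-1.
have r'0 : 0 < r' by rewrite subr_gt0.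
pose T (z : R * R) := (a - z.1, b - z.2).
have mT : measurable_fun setT T by apply/measurable_fun_pair; meas.
have TI g' : inL2 g' -> (\int[mu2]_z (cabs2 (stft g' (T z).1 (T z).2))%:E = (rip g' g')%:E)%E.
  by move=> g'L; exact: (stft_isometry_reflect (a, b)).
have C0 := local_const_gt0 rho0.
have [mL L0 IL] := leak_in_integral r'.
(* A bound for the coefficients of every unit vector, so that [eps] and [eta] can be chosen
   uniformly in [z]. *)
pose cb j := (1 + rip (G j) (G j)) / 2.
pose M := \sum_j cb j.
pose M2 := \sum_j cb j ^+ 2.
have cb0 j : 0 <= cb j by rewrite divr_ge0// addr_ge0// rip_ge0.
have M0 : 0 <= M by apply: sumr_ge0.
have M20 : 0 <= M2 by apply: sumr_ge0 => j _; exact: sqr_ge0.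
have cle h j : inL2 h -> rip h h = 1 -> `|rip (G j) h| <= cb j.
  by move=> hL h1; rewrite /cb ler_pdivlMr// mulrC (le_trans (rip_le (GL j) hL))// h1 addrC.
(* All approximations are expressed through [theta]. The auxiliary functions change with it, but the
   inequality does not mention them, so [theta] can be sent to 0. *)
have main theta : 0 < theta -> (((2 * r') ^+ 2)%:E <=
   (n%:R + 2 * theta * (2 * r') ^+ 2)%:E + ((1 + theta) * (local_const rho / A))%:E * \sum_n leak (g n) r')%E.
  move=> t0.
  (* Chosen so that A - kappa = A / (1 + theta) and kappa / (A - kappa) = theta. *)
  pose kappa := A * theta / (1 + theta).
  pose eta := theta / (1 + M2).
  have t1 : 0 < 1 + theta by rewrite addr_gt0.
  have k0 : 0 < kappa by rewrite divr_gt0// mulr_gt0.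
  have eta0 : 0 < eta by rewrite divr_gt0// ltr_pwDl.
  have etaM : eta * M2 <= theta.
    by rewrite mulrAC ler_pdivrMr ?ltr_pwDl// ler_wpM2l ?(ltW t0)// lerDr.
  have Ak : A - kappa = A / (1 + theta) by rewrite /kappa; field; rewrite gt_eqF.
  have Ak0 : 0 < A - kappa by rewrite Ak divr_gt0.
  pose eps := kappa / (2 * (M + 1)).
  have eps0 : 0 < eps by rewrite divr_gt0// mulr_gt0// ltr_wpDl.
  have epsM : 2 * eps * M <= kappa.
    have M1 : 0 < 2 * (M + 1) by rewrite mulr_gt0// ltr_wpDl.
    rewrite /eps (_ : 2 * (kappa / (2 * (M + 1))) * M = kappa * (2 * M) / (2 * (M + 1))); last by ring.
    by rewrite ler_pdivrMr// ler_wpM2l ?(ltW k0)// ler_wpM2l// lerDl.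
  have [w [wL wn]] := dual_family s eps0.
  (* The approximate duals may be linearly dependent; adding [eta] times the identity makes the form
     coercive, at a cost of at most eta * M2 <= theta. *)
  pose D := gram w + eta%:M.
  have Dsym i j : D i j = D j i by rewrite !mxE (ripC (w i)) eq_sym.
  have Dcoer c : eta * (\sum_i c i ^+ 2) <= qform D c.
    by rewrite qform_addscalar lerDr -rip_rlin_sqr// rip_ge0.
  (* The residual h' has squared norm 1 - 2 (sum of c_j <w_j, h>) plus the Gram form of c, and
     [gram_form_max] bounds this below by 1 - gram_form D - eta |c|^2. The upper bound is
     [residual_le], solved for the norm of h'. *)
  have tail h : inL2 h -> rip h h = 1 ->
      1 <= gram_form D (fun j => rip (w j) h) + eta * M2 +
        (frame_energy f (S `\` [set` s]) h + kappa) / (A - kappa).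
    move=> hL h1; pose c j := rip (G j) h.
    pose h' := sumf h (rscale (-1) (rlin c w)).
    have cM : \sum_j `|rip (G j) h| <= M by apply: ler_sum => j _; exact: cle.
    have res := residual_le fL gab_bessel us sL eps0 (fun u uL => (frame_bounds uL).1) wL wn hL cM (erefl h').
    have E := rip_sub_rlin c wL hL; rewrite -/h' h1 in E.
    have gm := gram_form_max eta0 Dsym Dcoer (fun j => rip (w j) h) c.
    rewrite qform_addscalar /dot in gm.
    have c2 : \sum_j c j ^+ 2 <= M2.
      apply: ler_sum => j _; rewrite -real_normK ?num_real// lerXn2r ?nnegrE//; exact: cle.
    have ec : eta * \sum_j c j ^+ 2 <= eta * M2 by rewrite ler_wpM2l// ltW.
    have h'0 := rip_ge0 h'.
    have hk : 2 * eps * M * (1 + rip h' h') <= kappa * (1 + rip h' h') by rewrite ler_wpM2r// addr_ge0.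
    have hb : rip h' h' <= (frame_energy f (S `\` [set` s]) h + kappa) / (A - kappa).
      have e4 (x : R) : kappa * (1 + x) = kappa + kappa * x by ring.
      rewrite e4 in hk; rewrite ler_pdivlMr// mulrC mulrBl; move: res hk.
      by move: (frame_energy _ _ _) (A * rip h' h') (kappa * rip h' h') (2 * _ * _ * _) => *; lra.
    move: hb gm ec E; move: (_ / (A - kappa)) (gram_form _ _) (eta * M2) (eta * \sum_j _).
    by move: (rip h' h') (\sum_i _ * _) (qform _ _) => *; lra.
  pose Phi z := qform (invmx D) (fun i => coefr (w i) (T z)) + qform (invmx D) (fun i => coefi (w i) (T z)).
  have [iPhi EPhi] := qform_coef_integral mT TI (invmx D) wL; rewrite -/Phi in iPhi EPhi.
  have Phi0 z : 0 <= Phi z by rewrite addr_ge0//; exact: (gram_form_ge0 eta0 Dsym Dcoer).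
  (* The Gram matrix differs from [D] only by [eta] on the diagonal, and the diagonal of the inverse
     of [D] is nonnegative; so the integral is at most the trace of the identity. *)
  have intPhi : \int[mu2]_z Phi z <= 2 * n%:R.
    rewrite EPhi; apply: (@le_trans _ _ (\sum_i \sum_j invmx D i j * D i j)).
      apply: ler_sum => i _; rewrite (bigD1 i)//= [leRHS](bigD1 i)//=; apply: lerD.
        rewrite ler_wpM2l//; first exact: (inv_diag_ge0 eta0 Dsym Dcoer).
        by rewrite [leRHS]mxE [_%:M _ _]mxE eqxx mulr1n lerDl ltW.
      rewrite le_eqVlt; apply/orP; left; apply/eqP; apply: eq_bigr => j ji.
      by rewrite [D i j]mxE [_%:M _ _]mxE eq_sym (negbTE ji) mulr0n addr0.
    by rewrite (trace_gram_inv eta0 Dsym Dcoer) -/n natrD mulr_natl mulr2n.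
  pose q := 2 * (eta * M2 + kappa / (A - kappa)).
  have q0 : 0 <= q.
    apply: mulr_ge0 => //; apply: addr_ge0; first by apply: mulr_ge0 => //; exact: ltW.
    by apply: divr_ge0; exact: ltW.
  pose K := 2 * local_const rho / (A - kappa).
  have K0 : 0 <= K by apply: divr_ge0; [apply: mulr_ge0 => //|]; exact: ltW.
  (* On the inner square this is the sum of the tail inequalities for the Gaussian atom and its
     multiple by i; elsewhere the left side is 0. *)
  have pw z : ((2 * box2 r' z)%:E <= (Phi z)%:E + ((q * box2 r' z)%:E + K%:E * leak_in r' z))%E.
    have [e|e] : box2 r' z = 1 \/ box2 r' z = 0.
      by rewrite /box2 /box; case: (_ <= _ <= _); case: (_ <= _ <= _); rewrite ?mulr1 ?mulr0 ?mul0r; [left|right|right|right].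
      have := @tail_energy_le a b r s z (fun k Sk kQ => (sS k).2 (conj Sk kQ)).
      rewrite -/r' (leak_out_in e) -/(T z).
      have aL := inL2_gauss_atom (T z).1 (T z).2.
      have bS' : bessel f (S `\` [set` s]) by apply: bessel_sub gab_bessel => k [].
      have h1 := tail _ aL (rip_gauss_atom _ _).
      have h2 := tail _ (inL2_muli aL) (etrans (rip_muli aL aL) (rip_gauss_atom _ _)).
      rewrite tail_energy_muli// in h2.
      rewrite e !mulr1; have := L0 z; move: h1 h2; rewrite -/(coefr _ _).
      have -> : (a - z.1) = (T z).1 by []. have -> : (b - z.2) = (T z).2 by [].
      move: (frame_energy f _ _) => E h1 h2.
      case: (leak_in r' z) => [x x0|_ _|//]; last first.
        have [K0'|] := eqVneq K 0; last by move=> Kn; rewrite gt0_muley ?lte_fin ?lt_neqAle 1?eq_sym ?Kn// addeC addye// leey.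
        by move: K0'; rewrite /K => /eqP; rewrite gt_eqF// divr_gt0// mulr_gt0.
      rewrite -!EFinM -!EFinD !lee_fin => Ex.
      have : E / (A - kappa) <= local_const rho * x / (A - kappa) by rewrite ler_pM2r ?invr_gt0.
      rewrite (mulrDl E kappa) in h1 h2; move: h1 h2; rewrite /K /q /Phi.
      rewrite (_ : 2 * local_const rho / (A - kappa) * x = 2 * (local_const rho * x / (A - kappa))); last by ring.
      rewrite /gram_form /coefr /coefi.
      move: (E / _) (kappa / _) (_ * x / _) (eta * M2) (qform _ _) (qform _ _) => *; lra.
    by rewrite e !mulr0 add0e adde_ge0 ?lee_fin ?mule_ge0// ?lee_fin// L0.
  have /integrableP[/measurable_EFinP mPhi _] := iPhi.
  have mb := @measurable_box2 R r'.
  have mb' : measurable_fun setT (fun z => (box2 r' z)%:E) by exact/measurable_EFinP.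
  have b0 z : (0 <= (box2 r' z)%:E)%E by rewrite lee_fin box2_ge0.
  have IB (x : R) : 0 <= x -> (\int[mu2]_z (x * box2 r' z)%:E = (x * (2 * r') ^+ 2)%:E)%E.
    move=> x0; rewrite EFinM -(integral_box2 (ltW r'0)) -(ge0_integralZl mu2 measurableT mb' (fun z _ => b0 z)) ?lee_fin//.
  have mq : measurable_fun setT (fun z => (q * box2 r' z)%:E).
    by apply/measurable_EFinP; exact: measurable_funM.
  have mKL : measurable_fun setT (fun z => (K%:E * leak_in r' z)%E) by exact: measurable_funeM.
  have p1 z : (0 <= (q * box2 r' z)%:E)%E by rewrite lee_fin mulr_ge0 ?box2_ge0.
  have p2 z : (0 <= K%:E * leak_in r' z)%E by rewrite mule_ge0 ?lee_fin// L0.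
  have m12 : measurable_fun setT (fun z => (q * box2 r' z)%:E + K%:E * leak_in r' z)%E.
    exact: emeasurable_funD.
  have mPE : measurable_fun setT (fun z => (Phi z)%:E) by exact/measurable_EFinP.
  have I : ((2 * (2 * r') ^+ 2)%:E <= (2 * n%:R)%:E + ((q * (2 * r') ^+ 2)%:E + K%:E * \sum_n leak (g n) r'))%E.
    rewrite -IB// -IL -IB// -(ge0_integralZl mu2 measurableT mL (fun z _ => L0 z)) ?lee_fin//.
    rewrite -(ge0_integralD mu2 measurableT (fun z _ => p1 z) mq (fun z _ => p2 z) mKL).
    apply: (@le_trans _ _ (\int[mu2]_z (Phi z)%:E + \int[mu2]_z ((q * box2 r' z)%:E + K%:E * leak_in r' z))%E); last first.
      by apply: leeD => //; rewrite EFin_Rintegral// lee_fin.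
    have P0 z : (0 <= (Phi z)%:E)%E by rewrite lee_fin.
    have p12 z : (0 <= (q * box2 r' z)%:E + K%:E * leak_in r' z)%E by exact: adde_ge0.
    rewrite -(ge0_integralD mu2 measurableT (fun z _ => P0 z) mPE (fun z _ => p12 z) m12).
    apply: ge0_le_integral => //.
    - by move=> z _; rewrite lee_fin mulr_ge0 ?box2_ge0.
    - by apply/measurable_EFinP; exact: measurable_funM.
    - exact: emeasurable_funD.
  have KE : K = 2 * ((1 + theta) * (local_const rho / A)).
    by rewrite /K Ak; field; rewrite !gt_eqF.
  have kA : kappa / (A - kappa) = theta by rewrite Ak /kappa; field; rewrite !gt_eqF.
  have qE : q <= 4 * theta by rewrite /q kA; lra.
  have qr : q * (2 * r') ^+ 2 <= 4 * theta * (2 * r') ^+ 2 by rewrite ler_wpM2r// sqr_ge0.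
  have KP : 0 < (1 + theta) * (local_const rho / A) by rewrite mulr_gt0// divr_gt0.
  have : (0 <= \sum_n leak (g n) r')%E by rewrite -IL; apply: integral_ge0 => z _; exact: L0.
  move: I; rewrite KE; case: (\sum_n leak (g n) r')%E => [x|_ _|//]; last first.
    by rewrite gt0_muley ?lte_fin// addey// leey.
  rewrite -!EFinM -!EFinD !lee_fin -mulrA => + _; move: qr.
  rewrite (_ : 4 * theta * (2 * r') ^+ 2 = 4 * (theta * (2 * r') ^+ 2)); last by ring.
  rewrite (_ : 2 * ((1 + theta) * (local_const rho / A)) * x = 2 * ((1 + theta) * (local_const rho / A) * x)); last by ring.
  move: (_ * x); move: (theta * (2 * r') ^+ 2); move: (q * (2 * r') ^+ 2); move: ((2 * r') ^+ 2) => *; lra.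
have C1 : 0 < local_const rho / A by rewrite divr_gt0.
have : (0 <= \sum_n leak (g n) r')%E by rewrite -IL; apply: integral_ge0 => z _; exact: L0.
rewrite -/r'; move: main; case: (\sum_n leak (g n) r')%E => [x|_ _|//]; last first.
  by rewrite gt0_muley ?lte_fin// addeC addNye leNye.
move=> main x0; rewrite -EFinM -EFinB lee_fin -/n.
have -> : 2 * r - 1 = 2 * r' by rewrite /r'; field.
(* Rearranged so that the right side is [theta] times a fixed nonnegative number. *)
have H theta : 0 < theta -> (2 * r') ^+ 2 - local_const rho / A * x - n%:R <=
    theta * (2 * (2 * r') ^+ 2 + local_const rho / A * x).
  move=> /main; rewrite -EFinM -EFinD lee_fin.
  move: ((2 * r') ^+ 2) (local_const rho / A) => v c h.
  have -> : theta * (2 * v + c * x) = 2 * theta * v + theta * (c * x) by ring.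
  have e : (1 + theta) * c * x = c * x + theta * (c * x) by ring.
  rewrite e in h; move: h; move: (theta * (c * x)); move: (c * x) (2 * theta * v) => *; lra.
rewrite lee_fin in x0.
have E0 : 0 <= 2 * (2 * r') ^+ 2 + local_const rho / A * x.
  by rewrite addr_ge0// mulr_ge0 ?sqr_ge0// ltW.
by have := le0_small_multiple E0 H; lra.
Qed.

End frame_count.

(** * Counting points *)

Section counting.
Context {R : realType} (N : nat).
Local Notation key := ('I_N * (R * R))%type.

Lemma sum_npoints (X : 'I_N -> set (R * R)) :
  (\sum_(n < N) npoints (X n) = \esum_(k in [set k : key | X k.1 k.2]) (1 : \bar R))%E.
Proof.
transitivity (\esum_(n in [set: 'I_N]) npoints (X n))%E.
  rewrite esum_fset; [|exact: finite_finset|by move=> n _; apply: esum_ge0].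
  rewrite (@bigfs _ _ _ _ (index_enum 'I_N) predT) ?index_enum_uniq//; last first.
    by move=> n _; rewrite mem_index_enum.
  by rewrite (_ : [set` predT] = [set: 'I_N])//; apply/seteqP.
rewrite /npoints esum_esum//; congr (esum _ _).
by apply/seteqP; split=> -[n p] //= [].
Qed.

Lemma esum_one (t : seq key) : uniq t -> (\esum_(k in [set` t]) (1 : \bar R) = (size t)%:R%:E)%E.
Proof.
move=> ut; rewrite esum_fset//; last exact: finite_seq.
rewrite -fsbig_seq//; elim: t ut => [|k t IH /= /andP[_ /IH e]]; first by rewrite big_nil.
by rewrite big_cons e -EFinD -natr1 addrC.
Qed.

Lemma npoints_le (X : 'I_N -> set (R * R)) (M : \bar R) :
  (forall t : seq key, uniq t -> (forall k, k \in t -> X k.1 k.2) -> ((size t)%:R%:E <= M)%E) ->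
  (\sum_(n < N) npoints (X n) <= M)%E.
Proof.
move=> H; rewrite sum_npoints; apply: ub_ereal_sup => _ [Y [fY YX] <-].
have /finite_seqP[t Yt] := fY.
have Yu : Y = [set` undup t] by rewrite Yt; apply/seteqP; split=> k /=; rewrite mem_undup.
have ut := undup_uniq t.
rewrite -esum_fset// Yu esum_one//; apply: H => // k kt; apply: YX.
by rewrite Yu.
Qed.

(** If the set is infinite the count is +oo and the bound is trivial. Otherwise the whole set is
    enumerated, as the frame argument needs: every index missing from the list must lie outside the
    square. *)
Lemma npoints_ge (X : 'I_N -> set (R * R)) (M : \bar R) :
  (forall t : seq key, uniq t -> (forall k, k \in t <-> X k.1 k.2) -> (M <= (size t)%:R%:E)%E) ->
  (M <= \sum_(n < N) npoints (X n))%E.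
Proof.
move=> H; rewrite sum_npoints; set K := [set k : key | _].
have [fK|iK] := pselect (finite_set K).
  have /finite_seqP[t Kt] := fK.
  have Ku : K = [set` undup t] by rewrite Kt; apply/seteqP; split=> k /=; rewrite mem_undup.
  rewrite Ku esum_one ?undup_uniq//; apply: H; first exact: undup_uniq.
  by move=> k; split=> h; [have : K k by rewrite Ku|have : [set` undup t] k by rewrite -Ku].
suff -> : (\esum_(k in K) (1 : \bar R) = +oo)%E by rewrite leey.
apply/eqyP => y y0; have [F FK cF] := infinite_set_fset (Num.trunc y).+1 iK.
have h1 : (y%:E <= (size (finmap.enum_fset F))%:R%:E)%E.
  rewrite lee_fin; apply: (@le_trans _ _ (Num.trunc y).+1%:R); last by rewrite ler_nat.
  by apply/ltW; have /andP[_] := trunc_itv (ltW y0).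
apply: le_trans h1 _; rewrite -esum_one ?finmap.fset_uniq//.
rewrite (esum_mkcond [set` finmap.enum_fset F]) (esum_mkcond K); apply: le_esum => k _.
case: ifPn => kF; last by case: ifPn.
by rewrite ifT// inE; apply: FK; rewrite inE in kF.
Qed.

(** The minimum of 1/4 and all [delta n / 3], built along the enumeration so that [N = 0] is covered
    as well. *)
Lemma small_radius (delta : 'I_N -> R) : (forall n, 0 < delta n) ->
  exists rho : R, [/\ 0 < rho, rho <= 4^-1 & forall n, 3 * rho <= delta n].
Proof.
move=> d0.
suff [rho [r0 r4 rd]] : exists rho : R, [/\ 0 < rho, rho <= 4^-1 &
    forall n, n \in enum 'I_N -> 3 * rho <= delta n].
  by exists rho; split=> // n; apply: rd; rewrite mem_enum.
elim: (enum 'I_N) => [|m s [rho [r0 r4 rd]]]; first by exists 4^-1; split.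
exists (Num.min rho (delta m / 3)); split.
- by rewrite lt_min r0 divr_gt0.
- by rewrite ge_min r4.
move=> n; rewrite in_cons => /orP[/eqP->|/rd h].
  by rewrite mulrC -ler_pdivlMr// ge_min lexx orbT.
by apply: le_trans h; rewrite ler_wpM2l// ge_min lexx.
Qed.

End counting.

Theorem theorem4 (R : realType) (N : nat) (delta : 'I_N -> R) (A B : R) :
  (forall n, 0 < delta n) -> 0 < A -> 0 < B ->
  exists C : R, 0 < C /\
  (forall (g : 'I_N -> R -> R[i]) (Lam : 'I_N -> set (R * R)),
     (forall n, inL2 (g n)) -> distinct_L2 g ->
     (forall n, dsep (delta n) (Lam n)) ->
     is_riesz_seq (gab_index Lam) (gab_atom g) A B ->
     forall r : R, 0 < r -> forall a b : R,
       (\sum_(n < N) npoints (Lam n `&` Qsq a b r)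
         <= ((2 * r + 1) ^+ 2)%:E
            + C%:E * \sum_(n < N) IG (stft (g n)) (r + 4^-1))%E) /\
  (forall (g : 'I_N -> R -> R[i]) (Lam : 'I_N -> set (R * R)),
     (forall n, inL2 (g n)) -> distinct_L2 g ->
     (forall n, dsep (delta n) (Lam n)) ->
     is_frame (gab_index Lam) (gab_atom g) A B ->
     forall r : R, 2^-1 < r -> forall a b : R,
       (((2 * r - 1) ^+ 2)%:E
            - C%:E * \sum_(n < N) IG (stft (g n)) (r - 2^-1)
         <= \sum_(n < N) npoints (Lam n `&` Qsq a b r))%E).
Proof.
move=> d0 A0 B0; have [rho [r0 r4 rd]] := small_radius d0.
(* The radius comes from the separation constants alone, so the constant is fixed before the
   functions, the point sets and the square are given. *)
exists (local_const rho / A); split; first by rewrite divr_gt0// local_const_gt0.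
split=> g Lam gL _ sep H r rr a b.
- have -> : (\sum_(n < N) IG (stft (g n)) (r + 4^-1) = \sum_n leak (g n) (r + 4^-1))%E.
    by apply: eq_bigr => n _; exact: IG_leak.
  apply: npoints_le => t ut tX.
  exact: (riesz_count_le gL sep r0 r4 rd A0 rr H ut tX).
- have -> : (\sum_(n < N) IG (stft (g n)) (r - 2^-1) = \sum_n leak (g n) (r - 2^-1))%E.
    by apply: eq_bigr => n _; exact: IG_leak.
  apply: npoints_ge => t ut tX.
  exact: (frame_count_ge gL sep r0 r4 rd A0 B0 H rr ut tX).
Qed.
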